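(* Let $C_3$ be the triadic Cantor set with the regular ultrametric $d$ and associated measure $\mu$ described in the context, $s_0=\ln2/\ln3$, let $s<s_0+2$, and let $\Delta_s$ be the associated operator on $L^2(C_3,\mu)$, with eigenvalues $-\lambda_n$ as given in the context. Then the following hold. (i) Let the heat kernel $K_t(x,y)$ be defined by $$\langle f,e^{t\Delta_s}g\rangle=\int_{C_3\times C_3}f(x)K_t(x,y)g(y)\,d\mu(x)d\mu(y),\qquad f,g\in L^2(C_3,\mu).$$ Then $K_t(x,y)=\sum_{n=0}^\infty\kappa_n(x,y)a_n(t,s)$, where $$a_n(t,s)=1-2^ne^{-t\lambda_{n+1}}+\sum_{m=1}^n2^{m-1}e^{-t\lambda_m}\quad(n\ge1),\qquad a_0=1-e^{-t\lambda_1}.$$ Moreover, $K_t(x,y)$ is positive for all $x,y\in C_3$ and $t>0$. In addition, $K_t\in L^\infty(C_3\times C_3,\mu\times\mu)$ for $t>0$. (ii) The Markovian semigroup $\{e^{t\Delta_s}\}$ defines a Markov process $(X_t)_{t\ge0}$ with values in $C_3$ defined by $$\mathbb E\big(f_1(X_{t_1})\cdots f_n(X_{t_n})\big)=\langle1,\hat f_ne^{(t_n-t_{n-1})\Delta_s}\cdots\hat f_1e^{t_1\Delta_s}1\rangle$$ where $f_k\in\mathcal C(C_3)$, $\hat f$ denotes the operator on $L^2(C_3,\mu)$ given by multiplication by $f$, and $t_n>\cdots>t_1>0$. This Markov process is stationary and satisfies the following for $s$ fixed, as $t\downarrow0$: - for $\beta>s_0+2-s$, $$\mathbb E\big(d(X_{t_0},X_{t_0+t})^\beta\big)\sim\left(\frac{\lambda_1}{2}+\frac12\sum_{n=1}^\infty\Big(\frac{1}{2\cdot3^\beta}\Big)^n\Big(2^n\lambda_{n+1}-\sum_{m=1}^n2^{m-1}\lambda_m\Big)\right)t\,(1+o(1));$$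 - for $\beta=s_0+2-s$, $$\mathbb E\big(d(X_{t_0},X_{t_0+t})^\beta\big)\sim\frac{1}{2\beta\ln3}\left(\frac{1}{1-3^{-\beta}}+1\right)\left(1-\frac{1}{3^{\beta+s_0}-1}\right)t\ln(1/t)\,(1+o(1));$$ - for $\beta<s_0+2-s$, $\ \mathbb E\big(d(X_{t_0},X_{t_0+t})^\beta\big)=O\big(t^{\beta/(s_0+2-s)}\ln(1/t)\big)$.
   Context: The triadic Cantor set $C_3\subset[0,1]$ is identified with $\{0,1\}^{\mathbb N}$ via $\omega=(\omega_i)_{i\ge 0}\mapsto\sum_{i\ge0}2\omega_i3^{-(i+1)}$; it is the boundary of the infinite rooted binary tree, whose vertex set $\mathcal V$ is the set of finite $0$-$1$ words (root = empty word, children of $v$ are $v0,v1$, height $\mathrm{ht}(v)$ = length of $v$). $[v]$ is the set of infinite sequences with prefix $v$ and $\chi_v$ its characteristic function. The regular ultrametric is $d(x,y)=3^{-m}$ for $x\ne y$, where $m$ is the length of the longest common prefix of $x,y$, so $\mathrm{diam}[v]=3^{-\mathrm{ht}(v)}$. $\kappa_n(x,y)=1$ if $d(x,y)=3^{-n}$ and $0$ otherwise. A choice function is $\tau:\mathcal V\to C_3\times C_3$, $\tau(v)=(\tau_+(v),\tau_-(v))$ with $\tau_\pm(v)\in[v]$, $d(\tau_+(v),\tau_-(v))=\mathrm{diam}[v]$; $\Upsilon(C_3)$ is the set of choice functions, identified with $\prod_{v}\Upsilon_v$, $\Upsilon_v=([v0]\times[v1])\sqcup([v1]\times[v0])$.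 On $\ell^2(\mathcal V)\otimes\mathbb C^2$ let $(D\psi)(v)=(\mathrm{diam}[v])^{-1}\sigma_1\psi(v)$, $\sigma_1=\begin{pmatrix}0&1\\1&0\end{pmatrix}$, and $(\pi_\tau(f)\psi)(v)=\mathrm{diag}\{f(\tau_+(v)),f(\tau_-(v))\}\psi(v)$. The series $\mathrm{Tr}(|D|^{-s})$ has abscissa of convergence $s_0=\ln2/\ln3$. The associated probability measure $\mu(f)=\lim_{s\downarrow s_0}\mathrm{Tr}(|D|^{-s}\pi_\tau(f))/\mathrm{Tr}(|D|^{-s})$ is the Borel measure on $C_3$ with $\mu([v])=2^{-\mathrm{ht}(v)}$. Let $\nu$ be the product measure on $\Upsilon(C_3)$ of the probability measures $\nu_v$ obtained by normalizing $\mu\times\mu$ on $\Upsilon_v$. For $s\in\mathbb R$ let $Q_s(f,g)=\frac12\int_{\Upsilon(C_3)}\mathrm{Tr}(|D|^{-s}[D,\pi_\tau(f)]^*[D,\pi_\tau(g)])\,d\nu(\tau)$ on the domain $\mathcal E$ = real linear span of $\{\chi_v:v\in\mathcal V\}$. This form is closable in the real Hilbert space $L^2(C_3,\mu)$, and $\Delta_s$ is the non-positive self-adjoint operator associated with its smallest closed extension, so that $\langle-\Delta_sf,g\rangle=Q_s(f,g)$ for $f,g\in\mathcal E$; $\{e^{t\Delta_s}\}_{t>0}$ is a Markovian semigroup. The eigenvalues of $\Delta_s$ are $-\lambda_n$, with $\lambda_0=0$ and $\lambda_n=2\big(1+r+\cdots+r^{n-2}+2r^{n-1}\big)$ for $n\ge1$,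 where $r=3^{s_0+2-s}$ (so $\lambda_1=4$).
   Formalization: For β=s_0+2-s the prefactor is 1/(β ln 3), as the printed 1/(2β ln 3) is too small by a factor 2; the third bullet is for β>-s_0, since the moment is infinite otherwise; the series formula for K_t is stated for x≠y, as all κ_n(x,x) vanish while K_t>0. *)

(* Defs.v *)
From HB Require Import structures.
From mathcomp Require Import all_boot all_order all_algebra.
From mathcomp Require Import all_classical all_reals all_analysis.
From mathcomp.real_closed Require Import complex.

Set Implicit Arguments.
Unset Strict Implicit.
Unset Printing Implicit Defensive.

Import Order.TTheory GRing.Theory Num.Theory.
Import numFieldNormedType.Exports.

Local Open Scope classical_set_scope.
Local Open Scope ring_scope.

(** * The Cantor set *)

(* The point [x] stands for the real number [\sum_i 2 (x i) 3^-(i+1)]. *)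
Definition C3 : Type := cantor_space.
HB.instance Definition _ := Pointed.on C3.
HB.instance Definition _ := Topological.on C3.
HB.instance Definition _ := @isMeasurable.Build (sigma_display (@open C3)) C3
  <<s (@open C3) >> (@sigma_algebra0 _ setT _)
  (@sigma_algebraC C3 (@open C3)) (@sigma_algebra_bigcup _ setT _).

(* Finite words; the children of [v] are [rcons v false] and [rcons v true],
   and its height is [size v]. *)
Definition vertex : Type := seq bool.

Definition cylinder (v : vertex) : set C3 :=
  [set x | forall i, (i < size v)%N -> x i = nth false v i].

Section cantor_metric.
Variable R : realType.

(* [ex_minn] returns the first index at which [x] and [y] differ, that is, the
   length of their longest common prefix. *)
Definition dist (x y : C3) : R :=
  match pselect (exists i, x i != y i) with
  | left xy => 3 ^- ex_minn xy
  | right _ => 0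
  end.

Definition diam (v : vertex) : R := 3 ^- size v.

Definition kappa (n : nat) (x y : C3) : R := (dist x y == 3 ^- n)%:R.

Definition s0 : R := ln 2 / ln 3.

(* The Borel probability measure with [mu [v] = 2^-(ht v)]. *)
Definition is_mu (mu : probability C3 R) : Prop :=
  forall v, mu (cylinder v) = (2 ^- size v)%:E.

End cantor_metric.
Arguments s0 {R}.

(** * Choice functions *)

Definition choice_carrier : Type := vertex -> C3 * C3.

(* Product sigma-algebra, generated by the evaluations at the vertices. *)
Definition choice_space :=
  g_sigma_algebraType
    (\bigcup_(v in [set: vertex])
       preimage_set_system [set: choice_carrier]
         (fun tau : choice_carrier => tau v) measurable).

Section choice_functions.
Variable R : realType.

(* First component: [tau_+ v]; second component: [tau_- v]. *)
Definition Upsilon_at (v : vertex) : set (C3 * C3) :=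
  [set p | [/\ cylinder v p.1, cylinder v p.2 & dist R p.1 p.2 = diam R v]].

Definition Upsilon : set choice_space :=
  [set tau : choice_carrier | forall v, Upsilon_at v (tau v)].

Definition nu_at (mu : probability C3 R) (v : vertex) (A : set (C3 * C3)) : R :=
  fine ((mu \x mu)%E (A `&` Upsilon_at v)) / fine ((mu \x mu)%E (Upsilon_at v)).

(* [nu] lives on all maps [vertex -> C3 * C3]; it is carried by [Upsilon] since
   each factor [nu_at mu v] is carried by [Upsilon_at v]. *)
Definition is_nu (mu : probability C3 R) (nu : probability choice_space R) :
    Prop :=
  forall (F : seq vertex) (A : vertex -> set (C3 * C3)),
    uniq F -> (forall v, measurable (A v)) ->
    nu [set tau : choice_carrier | forall v, v \in F -> A v (tau v)] =
    (\prod_(v <- F) nu_at mu v (A v))%:E.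

End choice_functions.

(** * The spectral triple *)

Section spectral_triple.
Variable R : realType.
Local Notation C := R[i].
Local Notation cst_C x := (Complex (x : R) 0).

(* All operators used below on l^2(vertex) (x) C^2 act fibre by fibre,
   [(A psi) v = A v *m psi v], and are represented by their blocks; products
   and adjoints are then taken blockwise. *)
Definition block_operator : Type := vertex -> 'M[C]_2.

Definition block_mul (A B : block_operator) : block_operator :=
  fun v => A v *m B v.

Definition block_commutator (A B : block_operator) : block_operator :=
  fun v => A v *m B v - B v *m A v.

Definition block_adjoint (A : block_operator) : block_operator :=
  fun v => (map_mx (@conjc R) (A v))^T.

(* Sum of the diagonal matrix coefficients in the canonical basis, the vertices
   being enumerated by increasing height. *)
Definition block_trace (A : block_operator) : C :=
  Complex
    (limn (series (fun n => \sum_(v : n.-tuple bool) complex.Re (\tr (A v)))))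
    (limn (series (fun n => \sum_(v : n.-tuple bool) complex.Im (\tr (A v))))).

Definition sigma1 : 'M[C]_2 := \matrix_(i, j) (i != j)%:R.

Definition dirac_op : block_operator :=
  fun v => cst_C (diam R v)^-1 *: sigma1.

(* [|D|^p]: since [sigma1 ^+ 2 = 1], [D^* D] is the multiplication by
   [(diam v)^-2], so [|D|] is the multiplication by [(diam v)^-1]. *)
Definition abs_dirac_pow (p : R) : block_operator :=
  fun v => (cst_C ((diam R v)^-1 `^ p))%:M.

Definition rep (tau : choice_carrier) (f : C3 -> R) : block_operator :=
  fun v => diag_mx
    (\row_(j < 2) cst_C (f (if j == ord0 then (tau v).1 else (tau v).2))).

(* For real-valued [f] and [g] the trace is real. *)
Definition Q (nu : probability choice_space R) (s : R) (f g : C3 -> R) : R :=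
  2^-1 * \int[nu]_(tau in Upsilon R)
    complex.Re (block_trace (block_mul (abs_dirac_pow (- s))
      (block_mul (block_adjoint (block_commutator dirac_op (rep tau f)))
                 (block_commutator dirac_op (rep tau g))))).

End spectral_triple.

(** * The operator and its semigroup *)

Section operator.
Variables (R : realType) (mu : probability C3 R).

(* Elements of the real Hilbert space L^2(mu) are represented by functions in
   [Lfun mu 2], up to almost everywhere equality. *)
Local Notation L2 := (Lfun mu 2%:E).

Definition inner (f g : C3 -> R) : R := \int[mu]_x (f x * g x).
Definition sqnorm (f : C3 -> R) : R := inner f f.

(* Real linear span of the characteristic functions of the cylinders. *)
Definition Espan : set (C3 -> R) :=
  [set f | exists l : seq (R * vertex),
     f = (fun x => \sum_(p <- l) p.1 * \1_(cylinder p.2) x)].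

Variables (nu : probability choice_space R) (s : R).

(* [f] is in the domain of the smallest closed extension of [Q] iff it admits
   such an approximation; the extension at [(f, g)] is then the limit of
   [Q (fn n) (gn n)] for any approximations [fn] of [f] and [gn] of [g]. *)
Definition form_approx (fn : nat -> C3 -> R) (f : C3 -> R) : Prop :=
  [/\ forall n, Espan (fn n),
      (fun n => sqnorm (fn n \- f)) @ \oo --> (0 : R) &
      forall e : R, 0 < e -> exists N : nat, forall m n, (N <= m)%N ->
        (N <= n)%N -> Q nu s (fn m \- fn n) (fn m \- fn n) < e].

Definition form_dom (f : C3 -> R) : Prop :=
  f \in L2 /\ exists fn, form_approx fn f.

Definition closed_form (f g : C3 -> R) (q : R) : Prop :=
  exists fn gn, [/\ form_approx fn f, form_approx gn g &
    (fun n => Q nu s (fn n) (gn n)) @ \oo --> q].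

(* Graph of the operator of the closed form: [f] is in its domain and is mapped
   to [h] iff [closed_form f g (- <h, g>)] for all [g] in the form domain. *)
Definition Delta (f h : C3 -> R) : Prop :=
  [/\ form_dom f, h \in L2 &
      forall g, form_dom g -> closed_form f g (- inner h g)].

(* The strongly continuous contraction semigroup whose generator is [Delta]. *)
Definition is_heat_semigroup (T : R -> (C3 -> R) -> (C3 -> R)) : Prop :=
  [/\ (forall t f, 0 <= t -> f \in L2 ->
         T t f \in L2 /\ sqnorm (T t f) <= sqnorm f),
      (forall t (a : R) f g, 0 <= t -> f \in L2 -> g \in L2 ->
         {ae mu, forall x,
            T t (fun y => a * f y + g y) x = a * T t f x + T t g x}),
      (forall f, f \in L2 -> {ae mu, forall x, T 0 f x = f x}) /\
      (forall t u f, 0 <= t -> 0 <= u -> f \in L2 ->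
         {ae mu, forall x, T (t + u) f x = T t (T u f) x}),
      (forall f, f \in L2 -> sqnorm (T t f \- f) @[t --> 0^'+] --> (0 : R)) &
      (forall f h, f \in L2 -> h \in L2 ->
         (Delta f h <->
          sqnorm (fun x => t^-1 * (T t f x - f x) - h x) @[t --> 0^'+]
            --> (0 : R)))].

End operator.

(** * Eigenvalues and heat kernel *)

Section heat_kernel.
Variable R : realType.

Definition ratio (s : R) : R := 3 `^ (s0 + 2 - s).

(* [- lambda s n] is the [n]-th eigenvalue of the operator. *)
Definition lambda (s : R) (n : nat) : R :=
  if n is m.+1 then 2 * (\sum_(k < m) ratio s ^+ k + 2 * ratio s ^+ m) else 0.

Definition heat_coef (t s : R) (n : nat) : R :=
  1 - 2 ^+ n * expR (- (t * lambda s n.+1))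
    + \sum_(1 <= m < n.+1) 2 ^+ m.-1 * expR (- (t * lambda s m)).

(* Kernels are determined up to equality almost everywhere. *)
Definition is_heat_kernel (mu : probability C3 R)
    (T : R -> (C3 -> R) -> (C3 -> R)) (t : R) (K : C3 * C3 -> R) : Prop :=
  measurable_fun [set: C3 * C3] K /\
  forall f g, f \in Lfun mu 2%:E -> g \in Lfun mu 2%:E ->
    (mu \x mu)%E.-integrable [set: C3 * C3]
      (fun z => (f z.1 * K z * g z.2)%:E) /\
    inner mu f (T t g) = \int[(mu \x mu)%E]_z (f z.1 * K z * g z.2).

End heat_kernel.

(** * The process *)

Section process.
Variable R : realType.

(* [f_n e^{(t_n - t_{n-1}) Delta} ... f_1 e^{t_1 Delta} 1] for the times
   [t 0 < ... < t n.-1] (so [t_1 = t 0]). *)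
Fixpoint transition_chain (T : R -> (C3 -> R) -> (C3 -> R))
    (t : nat -> R) (f : nat -> C3 -> R) (n : nat) : C3 -> R :=
  if n is m.+1 then
    fun x => f m x *
      T (t m - (if m is k.+1 then t k else 0)) (transition_chain T t f m) x
  else cst 1.

Variables (d : measure_display) (Omega : measurableType d).
Variables (P : probability Omega R) (X : R -> Omega -> C3).

Definition is_process_of (mu : probability C3 R)
    (T : R -> (C3 -> R) -> (C3 -> R)) : Prop :=
  forall (n : nat) (t : nat -> R) (f : nat -> C3 -> R),
    0 < t 0 -> (forall i, (i.+1 < n)%N -> t i < t i.+1) ->
    (forall i, (i < n)%N -> continuous (f i)) ->
    'E_P[fun w => (\prod_(i < n) f i (X (t i) w))%R]%E =
    (inner mu (cst 1) (transition_chain T t f n))%:E.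

(* [Z] is a version of the conditional expectation of the integrable variable
   [Y] given the sub-sigma-algebra [G]. *)
Definition is_cond_expectation (G : set (set Omega)) (Y Z : Omega -> R) :
    Prop :=
  [/\ forall B : set R, measurable B -> G (Z @^-1` B),
      P.-integrable [set: Omega] (EFin \o Z) &
      forall F, G F -> \int[P]_(w in F) Z w = \int[P]_(w in F) Y w].

Definition past (I : set R) (u : R) : set (set Omega) :=
  <<s \bigcup_(r in I `&` [set r | r <= u])
        preimage_set_system [set: Omega] (X r) measurable >>.

(* The conditional laws of [X t] given the past up to time [u] and given [X u]
   coincide. *)
Definition is_markov (I : set R) : Prop :=
  forall u t (A : set C3), I u -> I t -> u < t -> measurable A ->
    exists Z : Omega -> R,
      is_cond_expectation
        (preimage_set_system [set: Omega] (X u) measurable)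
        (fun w => \1_A (X t w)) Z /\
      is_cond_expectation (past I u) (fun w => \1_A (X t w)) Z.

Definition is_stationary (I : set R) : Prop :=
  forall (n : nat) (t : nat -> R) (A : nat -> set C3) (h : R), 0 <= h ->
    (forall i, (i < n)%N -> I (t i) /\ measurable (A i)) ->
    P [set w | forall i, (i < n)%N -> A i (X (t i + h) w)] =
    P [set w | forall i, (i < n)%N -> A i (X (t i) w)].

Definition moment (beta t0 t : R) : R :=
  fine 'E_P[fun w => (dist R (X t0 w) (X (t0 + t) w) `^ beta)%R]%E.

Definition displacement_coef (s beta : R) (n : nat) : R :=
  (2 * 3 `^ beta) ^- n *
  (2 ^+ n * lambda s n.+1 - \sum_(1 <= m < n.+1) 2 ^+ m.-1 * lambda s m).

(* In the three regimes [beta] is compared with [s0 + 2 - s]. For [beta <= - s0]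
   the moment is infinite; above [- s0] it is finite, as the first clause
   asserts, so that [fine] is harmless in [moment]. The constant of the critical
   regime simplifies to [2 / (beta * ln 3)]; with [(2 * beta * ln 3)^-1] in place
   of [(beta * ln 3)^-1] it would be half the limit of
   [moment beta t0 t / (t * ln t^-1)]. *)
Definition moment_asymptotics (s : R) (I : set R) : Prop :=
  forall beta t0 : R, - s0 < beta -> I t0 ->
  [/\ forall t, 0 < t ->
        P.-integrable [set: Omega]
          (fun w => (dist R (X t0 w) (X (t0 + t) w) `^ beta)%:E),
      s0 + 2 - s < beta ->
        let u n := displacement_coef s beta n.+1 in
        cvgn (series u) /\
        moment beta t0 ~_ (0^'+)
          (fun t => (lambda s 1 / 2 + 2^-1 * limn (series u)) * t),
      beta = s0 + 2 - s ->
        moment beta t0 ~_ (0^'+)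
          (fun t => (beta * ln 3)^-1 * ((1 - 3 `^ (- beta))^-1 + 1)
                    * (1 - (3 `^ (beta + s0) - 1)^-1) * (t * ln t^-1)) &
      beta < s0 + 2 - s ->
        moment beta t0 =O_ (0^'+)
          (fun t => t `^ (beta / (s0 + 2 - s)) * ln t^-1)].

End process.

(* Main.v *)
From Pilot Require Import Defs.
From HB Require Import structures.
From mathcomp Require Import all_boot all_order all_algebra.
From mathcomp Require Import all_classical all_reals all_analysis.
From mathcomp Require Import measurable_realfun ess_sup_inf ring lra.
From mathcomp.real_closed Require Import complex.
Import Order.TTheory GRing.Theory Num.Theory.
Import numFieldNormedType.Exports.
Import Pilot.Defs.

Set Implicit Arguments.
Unset Strict Implicit.
Unset Printing Implicit Defensive.
Local Open Scope classical_set_scope.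
Local Open Scope ring_scope.

(** Notation used in the comments: a point is an infinite binary word; a function has level [n]
when it depends on the first [n] bits only ([lev n]); [E n] is the conditional expectation given
the first [n] bits; [r] is [ratio s]; [e_n = exp (- t lambda_n)] and [delta_n = e_n - e_(n+1)].

The form. The commutator of [D] with [pi_tau f] is off-diagonal with entries
[+- (f (tau_+ v) - f (tau_- v)) / diam v], so [Q f g] is a sum over the vertices [v] of a weight
times the [nu]-mean of [(f (tau_+ v) - f (tau_- v)) (g (tau_+ v) - g (tau_- v))]. Only the
marginals of [nu] at single vertices occur, and under them [tau_+ v] and [tau_- v] are independent
and uniform in the two halves of [[v]], in either order. If [h] has level [n+1] and [E n h = 0],
then the vertices of height [k < n] contribute [2 r^k <h, g>], those of height [n] contribute
[4 r^n <h, g>] and the others nothing: [Q h g = lambda_(n+1) <h, g>] ([Q_eigen]). As the form is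
continuous in [g], such an [h] is an eigenvector of the operator ([Delta_eigen]), hence of the
semigroup: iterating the estimate [T u h = exp (- u lambda) h + o(u)] costs nothing because [T]
is contractive ([T_eigen]). A function of level [N] is a constant plus [N] such eigenvectors.

The kernel. Abel summation turns [sum_n e_n (E n - E (n-1))] into [sum_n delta_n E n]. So the
semigroup is the mixture, with the positive weights [delta_n], of the conditional expectations,
and its kernel is [kern t (x, y)], the sum of [2^n delta_n] over the [n] such that [x] and [y]
share their first [n] bits. It is positive, and bounded and continuous since [2^n delta_n] decreases
super-exponentially; if [x] and [y] first differ at the bit [n], it is the finite sum [a_n]
([kern_offdiag]). It agrees with [T t] on locally constant functions ([T_lev]) and, these being
dense, on all of L^2 ([T_heat]).

The process. Everything follows from one description, [has_fdd]: the mean of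
[f_1 (X t_1) ... f_n (X t_n)], for locally constant [f_k], is the integral of the chain of heat
operators. It is equivalent to the formula defining the process ([fdd_of_process],
[process_of_fdd]). It involves the differences of the times only, whence stationarity. Since the
heat operator is symmetric, [heat (t - u) 1_A (X u)] and [1_A (X t)] have the same integrals over
the events that depend on finitely many times of the past, whence the Markov property. For the
existence, the random walks on finite grids of times and points are probabilities on the compact
space of all paths; along an ultrafilter they converge on the clopen sets, and a finitely additive
function on the clopen sets of a compact space is countably additive ([mean_limit],
[process_exists]).

The moments. Put [b = 3^-beta]. The probability that [X t_0] and [X (t_0 + t)] first differ at the
bit [n] is the sum over [m <= n] of [2^(m-n-1) delta_m], since a mixture of level [m] makes the
bits from [m] on uniform. Summing against [b^n], the moment is [(2 - b)^-1 sum_n b^n delta_n]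
([moment_profile]). As [t] tends to zero [delta_n] is about [t (lambda_(n+1) - lambda_n)] as long as
[t r^n] is small, and [b^n (lambda_(n+1) - lambda_n)] is geometric with ratio
[b r = 3^(s_0 + 2 - s - beta)]. If [b r < 1] the series of these terms converges and its sum is the
constant; if [b r = 1] each of the [ln (1/t) / ln r] levels with [t r^n < 1] contributes
[2 (2 - b) t]; if [b r > 1] the level with [t r^n] of order one dominates, and there
[b^n] is of order [t^(beta / (s_0 + 2 - s))]. *)

(** * Words, cylinders and the Borel structure of the Cantor set *)

Definition pre (n : nat) (x : C3) : vertex := mkseq x n.
Definition pt (v : vertex) : C3 := (fun i : nat => nth false v i).

Lemma size_pre n x : size (pre n x) = n. Proof. exact: size_mkseq. Qed.

Lemma pre_eqP n x y : pre n x = pre n y <-> forall i, (i < n)%N -> x i = y i.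
Proof.
split=> [e i i_n|e]; first by move/(congr1 (nth false ^~ i)): e; rewrite !nth_mkseq.
apply: (@eq_from_nth _ false); rewrite !size_pre// => i i_n.
by rewrite !nth_mkseq// e.
Qed.

Lemma pre_le m n x y : (m <= n)%N -> pre n x = pre n y -> pre m x = pre m y.
Proof. by move=> mn /pre_eqP e; apply/pre_eqP => i im; apply/e/(leq_trans im). Qed.

Lemma pre_pt v : pre (size v) (pt v) = v. Proof. exact: mkseq_nth. Qed.

Lemma pre_pt_tuple n (w : n.-tuple bool) : pre n (pt w) = w.
Proof. by rewrite -[X in pre X](size_tuple w) pre_pt. Qed.

Lemma take_pre m n x : (m <= n)%N -> take m (pre n x) = pre m x.
Proof.
move=> mn; apply: (@eq_from_nth _ false).
  by rewrite size_take_min !size_pre; apply/minn_idPl.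
rewrite size_take_min size_pre (minn_idPl mn) => i im.
by rewrite nth_take// !nth_mkseq// (leq_trans im).
Qed.

Lemma preS n x : pre n.+1 x = rcons (pre n x) (x n).
Proof. exact: mkseqS. Qed.

Lemma cylinderE v x : cylinder v x <-> pre (size v) x = v.
Proof.
split=> [vx|e i iv]; last by rewrite -e nth_mkseq.
apply: (@eq_from_nth _ false); rewrite size_pre// => i iv.
by rewrite nth_mkseq// vx.
Qed.

Lemma cylinder_pre n x y : cylinder (pre n x) y <-> pre n y = pre n x.
Proof. by rewrite cylinderE size_pre. Qed.

Lemma cylinder_nil : cylinder [::] = setT.
Proof. by apply/seteqP; split => // x _ i. Qed.

Lemma clopen_coord i b : clopen [set x : C3 | x i = b].
Proof.
rewrite (_ : [set x : C3 | x i = b] = (@proj nat (fun=> bool) i) @^-1` [set b])//.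
apply: preimage_clopen; last exact: (@proj_continuous nat (fun=> bool)).
by split; [exact: discrete_open | exact: discrete_closed].
Qed.

Lemma clopen_cylinder v : clopen (cylinder v).
Proof.
suff H n : clopen [set x : C3 | forall i, (i < n)%N -> x i = nth false v i].
  exact: H.
elim: n => [|n IH].
  by rewrite (_ : mkset _ = setT); [exact: clopenT|apply/seteqP; split].
rewrite (_ : mkset _ = [set x : C3 | forall i, (i < n)%N -> x i = nth false v i]
   `&` [set x : C3 | x n = nth false v n]); last first.
  apply/seteqP; split=> [x H|x [H1 H2] i].
    by split; [move=> i i_n; apply/H/ltnW|apply: H].
  by rewrite ltnS leq_eqVlt => /predU1P[->//|]; exact: H1.
exact/clopenI/clopen_coord.
Qed.

Lemma measurable_cylinder v : measurable (cylinder v).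
Proof. by apply: sub_sigma_algebra; case: (clopen_cylinder v). Qed.

(** The cylinders are a base of the product topology: a neighbourhood restricts finitely many
coordinates. *)
Lemma nbhs_cylinder (x : C3) (A : set C3) :
  nbhs x A <-> exists n, cylinder (pre n x) `<=` A.
Proof.
split; last first.
  move=> [n nA]; apply: (filterS nA); apply: open_nbhs_nbhs; split.
    by case: (clopen_cylinder (pre n x)).
  exact/cylinder_pre.
pose F : set_system C3 := [set B | exists n, cylinder (pre n x) `<=` B].
have FF : Filter F.
  split; first by exists 0%N.
    move=> P Q [m mP] [n nQ]; exists (maxn m n) => y /cylinder_pre e.
    split; [apply: mP | apply: nQ]; apply/cylinder_pre;
      apply: (pre_le _ e); [exact: leq_maxl | exact: leq_maxr].
  by move=> P Q PQ [n nP]; exists n; apply: subset_trans nP PQ.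
suff : F --> x by apply.
apply/cvg_sup => i; apply/cvg_image.
  by apply/seteqP; split => // b _; exists (fun=> b).
move=> B /nbhs_singleton Bx.
exists [set y : C3 | B (y i)].
  by exists i.+1 => y /cylinder_pre/pre_eqP e; rewrite /= e.
apply/seteqP; split => [_ [y /= By <-]//|b Bb].
by exists (fun=> b).
Qed.

(** The empty set is added to make the family stable under intersection. *)
Definition cylinders : set (set C3) :=
  [set A | A = set0 \/ exists v, A = cylinder v].

Lemma cylinders_setI : setI_closed cylinders.
Proof.
move=> A B [->|[v ->]]; first by rewrite set0I; left.
move=> [->|[w ->]]; first by rewrite setI0; left.
wlog vw : v w / (size v <= size w)%N => [H|].
  by have [|/ltnW] := leqP (size v) (size w); [exact: H|rewrite setIC; exact: H].
have [wv|wv] := pselect (take (size v) w = v).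
  right; exists w; apply/seteqP; split => [x []//|x /[dup] wx /cylinderE e].
  by split => //; apply/cylinderE; rewrite -(take_pre _ vw) e.
left; apply/seteqP; split => // x [/cylinderE xv /cylinderE xw]; apply: wv.
by rewrite -xw take_pre.
Qed.

Lemma cylinders_measurable : cylinders `<=` measurable.
Proof. by move=> A [->|[v ->]]; [exact: measurable0|exact: measurable_cylinder]. Qed.

(** An open set is the union of the countably many cylinders that it contains. *)
Lemma measurable_cylinders : @measurable _ C3 = <<s cylinders >>.
Proof.
apply/seteqP; split; last first.
  by apply: smallest_sub => //; [exact: sigma_algebra_measurable|exact: cylinders_measurable].
apply: smallest_sub; first exact: smallest_sigma_algebra.
move=> A; rewrite openE => oA.
rewrite (_ : A = \bigcup_k (if unpickle k is Some v then
    if pselect (cylinder v `<=` A) then cylinder v else set0 else set0)).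
  apply: sigma_algebra_bigcup => k /=.
  case: (pselect _) => ?; last exact: sigma_algebra0.
  by apply: sub_sigma_algebra; right; eexists.
apply/seteqP; split=> [x /oA/nbhs_cylinder[n nA]|x [k _]].
  exists (pickle (pre n x)) => //; rewrite pickleK; case: (pselect _) => // ?.
  exact/cylinder_pre.
by move=> /=; case: (pselect _) => // vA; exact: vA.
Qed.

(** The pi-lambda theorem for the cylinders. *)
Lemma C3_induction (P : set (set C3)) :
  P set0 -> (forall v, P (cylinder v)) ->
  (forall A, measurable A -> P A -> P (~` A)) ->
  (forall F : (set C3)^nat, (forall n, measurable (F n)) -> trivIset setT F ->
     (forall n, P (F n)) -> P (\bigcup_k F k)) ->
  forall A, measurable A -> P A.
Proof.
move=> P0 Pv PC PU A; rewrite measurable_cylinders.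
apply: (dynkin_induction measurable_cylinders cylinders_setI) => //.
- by rewrite -cylinder_nil.
- by move=> _ [->|[v ->]].
Qed.

(** * Locally constant functions *)

Section lev.
Variable V : Type.
Implicit Types f : C3 -> V.

(** Equivalently, [f] is constant on every ball of radius [3^-n]. *)
Definition lev (n : nat) f := forall x y, pre n x = pre n y -> f x = f y.

Lemma lev_le m n f : (m <= n)%N -> lev m f -> lev n f.
Proof. by move=> mn fm x y e; apply/fm/(pre_le mn e). Qed.

Lemma lev_cst n (c : V) : lev n (cst c). Proof. by []. Qed.

Lemma lev_pt n f x : lev n f -> f x = f (pt (pre n x)).
Proof. by apply; have := pre_pt (pre n x); rewrite size_pre => ->. Qed.

Lemma lev_cylinder n f v x y : lev n f -> (n <= size v)%N ->
  cylinder v x -> cylinder v y -> f x = f y.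
Proof.
move=> fn nv /cylinderE xv /cylinderE yv; apply: fn.
by apply: (pre_le nv); rewrite xv yv.
Qed.

End lev.

Lemma lev_comp (V W : Type) (g : V -> W) n (f : C3 -> V) : lev n f -> lev n (g \o f).
Proof. by move=> fn x y e; rewrite /= (fn x y). Qed.

Lemma lev_op2 (V W U : Type) (op : V -> W -> U) n (f : C3 -> V) (g : C3 -> W) :
  lev n f -> lev n g -> lev n (fun x => op (f x) (g x)).
Proof. by move=> fn gn x y e; rewrite (fn x y)// (gn x y). Qed.

Lemma lev_indic (R : realType) v : lev (size v) (\1_(cylinder v) : C3 -> R).
Proof.
move=> x y e; rewrite !indicE; congr (_%:R); congr nat_of_bool.
apply/idP/idP; rewrite !inE => /cylinderE h; apply/cylinderE; first by rewrite -e.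
by rewrite e.
Qed.

(** On a compact space, a locally constant function has a uniform level. *)
Lemma lev_nbhs_uniform (P : nat -> C3 -> Prop) :
  (forall m n x, (m <= n)%N -> P m x -> P n x) ->
  (forall x, exists n, forall y, pre n y = pre n x -> P n y) ->
  exists n, forall x, P n x.
Proof.
move=> Pmono H.
pose U (n : nat) : set C3 := [set x | forall y, pre n y = pre n x -> P n y].
have oU n : open (U n).
  rewrite openE => x Ux; apply/nbhs_cylinder; exists n => y /cylinder_pre e z ez.
  by apply: Ux; rewrite ez.
have cov : [set: C3] `<=` \bigcup_(n in setT) U n.
  by move=> x _; have [n nx] := H x; exists n.
have := cantor_space_compact; rewrite compact_cover => /(_ nat setT U) [||D _ DU].
- by move=> n _; exact: oU.
- exact: cov.
exists (\max_(i <- finmap.enum_fset D) i)%N => x; have [i /= iD Ux] := DU x I.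
by apply: (Pmono i); [by apply: leq_bigmax_seq|exact: Ux].
Qed.

(** * Integration of bounded functions and the space of square integrable functions *)

Section bounded_measurable.
Context d (T : measurableType d) (R : realType).
Implicit Types f g : T -> R.

(** Bounded measurable functions; they multiply integrable functions into integrable ones, which
keeps the integrability side conditions trivial below. *)
Definition bm f := measurable_fun setT f /\ exists M : R, forall x, `|f x| <= M.

Lemma eq_bm f g : f =1 g -> bm f -> bm g.
Proof. by move=> /funext ->. Qed.

Lemma bm_cst (c : R) : bm (cst c).
Proof. by split; [exact: measurable_cst|exists `|c|]. Qed.

Lemma bmD f g : bm f -> bm g -> bm (fun x => f x + g x).
Proof.
move=> [mf [M fM]] [mg [N gN]]; split; first exact: measurable_funD.
by exists (M + N) => x; rewrite (le_trans (ler_normD _ _))// lerD.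
Qed.

Lemma bmM f g : bm f -> bm g -> bm (fun x => f x * g x).
Proof.
move=> [mf [M fM]] [mg [N gN]]; split; first exact: measurable_funM.
by exists (M * N) => x; rewrite normrM ler_pM.
Qed.

Lemma bmZ c f : bm f -> bm (fun x => c * f x).
Proof. by apply: bmM; exact: bm_cst. Qed.

Lemma bmN f : bm f -> bm (fun x => - f x).
Proof. by move=> /(bmZ (-1)); apply: eq_bm => x; rewrite mulN1r. Qed.

Lemma bmB f g : bm f -> bm g -> bm (fun x => f x - g x).
Proof. by move=> bf /bmN; exact: bmD. Qed.

Lemma bm_sum (I : Type) (r : seq I) (P : pred I) (f : I -> T -> R) :
  (forall i, P i -> bm (f i)) -> bm (fun x => \sum_(i <- r | P i) f i x).
Proof.
move=> bf; elim: r => [|i r IH].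
  by apply: (eq_bm _ (bm_cst 0)) => x; rewrite big_nil.
have [Pi|nPi] := boolP (P i); last first.
  by apply: (eq_bm _ IH) => x; rewrite big_cons (negbTE nPi).
by apply: (eq_bm _ (bmD (bf i Pi) IH)) => x; rewrite big_cons Pi.
Qed.

Lemma bm_prod (I : Type) (r : seq I) (P : pred I) (f : I -> T -> R) :
  (forall i, P i -> bm (f i)) -> bm (fun x => \prod_(i <- r | P i) f i x).
Proof.
move=> bf; elim: r => [|i r IH].
  by apply: (eq_bm _ (bm_cst 1)) => x; rewrite big_nil.
have [Pi|nPi] := boolP (P i); last first.
  by apply: (eq_bm _ IH) => x; rewrite big_cons (negbTE nPi).
by apply: (eq_bm _ (bmM (bf i Pi) IH)) => x; rewrite big_cons Pi.
Qed.

Lemma bm_indic (A : set T) : measurable A -> bm (\1_A).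
Proof.
move=> mA; split; first exact: measurable_indic.
by exists 1 => x; rewrite indicE; case: (_ \in _); rewrite ?normr0 ?normr1.
Qed.

End bounded_measurable.

Lemma bm_comp d d' (T : measurableType d) (U : measurableType d') (R : realType)
    (f : U -> R) (g : T -> U) :
  measurable_fun setT g -> bm f -> bm (fun x => f (g x)).
Proof.
move=> mg [mf [M fM]]; split; last by exists M.
exact: (measurableT_comp mf).
Qed.

Section integral_calculus.
Context d (T : measurableType d) (R : realType) (mu : probability T R).
Implicit Types f g h : T -> R.

Definition intg f := mu.-integrable setT (EFin \o f).

Lemma eq_intg f g : f =1 g -> intg f -> intg g.
Proof. by move=> /funext ->. Qed.

Lemma bm_intg f : bm f -> intg f.
Proof.
move=> [mf [M fM]]; apply: measurable_bounded_integrable => //.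
  by rewrite ltey_eq fin_num_measure.
by exists M; split; [exact: num_real|move=> y My x _; exact: le_trans (fM _) (ltW My)].
Qed.

Lemma intg_measurable f : intg f -> measurable_fun setT f.
Proof. by move=> /integrableP[/measurable_EFinP]. Qed.

Lemma intgD f g : intg f -> intg g -> intg (fun x => f x + g x).
Proof. by move=> fi gi; have := integrableD measurableT fi gi. Qed.

Lemma intgZ c f : intg f -> intg (fun x => c * f x).
Proof. by move=> fi; have := integrableZl measurableT c fi. Qed.

Lemma intgB f g : intg f -> intg g -> intg (fun x => f x - g x).
Proof. by move=> fi gi; have := integrableB measurableT fi gi. Qed.

Lemma bm_intgM f g : bm f -> intg g -> intg (fun x => f x * g x).
Proof.
move=> [mf [M fM]] gi; have mg := intg_measurable gi.
apply: (@le_integrable _ _ _ mu setT measurableT _ (EFin \o (fun x => M * g x))).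
- exact/measurable_EFinP/measurable_funM.
- move=> x _; rewrite /= lee_fin !normrM ler_wpM2r//.
  by rewrite (le_trans (fM x))// ler_norm.
- exact: intgZ.
Qed.

Lemma intg_sum (I : Type) (r : seq I) (P : pred I) (f : I -> T -> R) :
  (forall i, P i -> intg (f i)) -> intg (fun x => \sum_(i <- r | P i) f i x).
Proof.
move=> bf; elim: r => [|i r IH].
  by apply: (eq_intg _ (bm_intg (bm_cst T 0))) => x; rewrite big_nil.
have [Pi|nPi] := boolP (P i); last first.
  by apply: (eq_intg _ IH) => x; rewrite big_cons (negbTE nPi).
by apply: (eq_intg _ (intgD (bf i Pi) IH)) => x; rewrite big_cons Pi.
Qed.

Lemma meanD f g : intg f -> intg g ->
  \int[mu]_x (f x + g x) = \int[mu]_x f x + \int[mu]_x g x.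
Proof. exact: RintegralD. Qed.

Lemma meanB f g : intg f -> intg g ->
  \int[mu]_x (f x - g x) = \int[mu]_x f x - \int[mu]_x g x.
Proof. exact: RintegralB. Qed.

Lemma meanZ c f : intg f -> \int[mu]_x (c * f x) = c * \int[mu]_x f x.
Proof. exact: RintegralZl. Qed.

Lemma mean_cst (c : R) : \int[mu]_x c = c.
Proof.
by rewrite Rintegral_cst// (_ : _ setT = 1%E) ?mulr1//; exact: probability_setT.
Qed.

Lemma mean_sum (I : Type) (r : seq I) (P : pred I) (f : I -> T -> R) :
  (forall i, P i -> intg (f i)) ->
  \int[mu]_x (\sum_(i <- r | P i) f i x) = \sum_(i <- r | P i) \int[mu]_x f i x.
Proof.
move=> bf; elim: r => [|i r IH].
  by rewrite big_nil; under eq_Rintegral do rewrite big_nil; rewrite mean_cst.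
rewrite big_cons; under eq_Rintegral do rewrite big_cons.
by case: ifP => // Pi; rewrite meanD ?IH//; [exact: bf|exact: intg_sum].
Qed.

Lemma mean_indic (A : set T) : measurable A -> \int[mu]_x (\1_A x) = fine (mu A).
Proof. by move=> mA; rewrite /Rintegral integral_indic// setIT. Qed.

Lemma mean_indicl (A : set T) f : measurable A ->
  \int[mu]_x (\1_A x * f x) = \int[mu]_(x in A) f x.
Proof.
move=> mA; rewrite [RHS]Rintegral_mkcond; apply: eq_Rintegral => x _.
by rewrite patchE indicE; case: ifP => _; rewrite ?mul1r ?mul0r.
Qed.

Lemma le_mean f g : intg f -> intg g -> (forall x, f x <= g x) ->
  \int[mu]_x f x <= \int[mu]_x g x.
Proof. by move=> fi gi fg; apply: le_Rintegral. Qed.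

Lemma ler_norm_mean f g : intg f -> intg g -> (forall x, `|f x| <= g x) ->
  `|\int[mu]_x f x| <= \int[mu]_x g x.
Proof.
move=> fi gi fg; apply: (le_trans (le_normr_Rintegral _ _)) => //.
apply: le_mean => //; exact: (integrable_norm fi).
Qed.

Lemma ler_norm_mean_cst f (c : R) : intg f -> (forall x, `|f x| <= c) ->
  `|\int[mu]_x f x| <= c.
Proof.
by move=> fi fc; rewrite -[leRHS]mean_cst; apply: ler_norm_mean => //; apply: bm_intg; exact: bm_cst.
Qed.

Lemma ae_mean f g : measurable_fun setT f -> measurable_fun setT g ->
  {ae mu, forall x, f x = g x} -> \int[mu]_x f x = \int[mu]_x g x.
Proof.
move=> mf mg fg; congr fine; apply: ae_eq_integral => //; [exact/measurable_EFinP..|].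
by apply: filterS fg => x fgx _; rewrite fgx.
Qed.

Lemma EFin_mean f : intg f -> (\int[mu]_x (f x)%:E)%E = (\int[mu]_x f x)%:E.
Proof. by move=> fi; rewrite fineK//; exact: integrable_fin_num. Qed.

(** Continuity of the measure along an increasing union; it reduces countable unions to finite ones
up to an error that is small in mean. *)
Lemma bigcup_tail (F : (set T)^nat) (e : R) : (forall n, measurable (F n)) -> 0 < e ->
  exists n, fine (mu (\bigcup_k F k `\` \bigcup_(k < n) F k)) < e.
Proof.
move=> mF e0; have fin := fin_num_measure mu.
have mU : measurable (\bigcup_k F k) by exact: bigcup_measurable.
pose S n := \bigcup_(k < n) F k.
have mS n : measurable (S n) by exact: bigcup_measurable.
have cv : (fun n => fine (mu (S n))) @ \oo --> fine (mu (\bigcup_k F k)).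
  apply: fine_cvg; rewrite fineK; last exact: fin.
  rewrite (_ : \bigcup_k F k = \bigcup_n S n); last first.
    apply/seteqP; split => [x [k _ Fx]|x [n _ [k _ Fx]]]; last by exists k.
    by exists k.+1 => //; exists k => //=.
  apply: nondecreasing_cvg_mu => //; first exact: bigcup_measurable.
  move=> m n mn; apply/subsetPset => x [k km Fx]; exists k => //=.
  exact: leq_trans mn.
have /cvgrPdist_lt/(_ _ e0)[N _ /(_ N (leqnn N)) HN] := cv.
have SU : S N `<=` \bigcup_k F k by move=> x [k _ Fx]; exists k.
exists N; have mSN := mS N; rewrite -/(S N); apply: le_lt_trans HN; rewrite measureD//; last by rewrite ltey_eq fin.
by rewrite setIidr// fineB ?fin//; exact: ler_norm.
Qed.

Lemma indic_bigcup_ord (F : (set T)^nat) n : trivIset setT F ->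
  \1_(\bigcup_(k < n) F k) = (fun x => \sum_(k < n) \1_(F k) x) :> (T -> R).
Proof.
move=> tF; apply/funext => x; rewrite indicE.
have [/set_mem[k /= kn Fx]|nS] := boolP (x \in \bigcup_(k < n) F k).
  rewrite (bigD1 (Ordinal kn))//= indicE mem_set// big1 ?addr0// => j jk.
  rewrite indicE memNset// => Fjx; move: jk; rewrite -val_eqE/= => /eqP; apply.
  by apply: (tF j k) => //; exists x.
rewrite big1// => j _; rewrite indicE memNset// => Fjx; move/negP: nS; apply.
by apply/mem_set; exists j => /=.
Qed.

Lemma indic_setDl (A B : set T) : B `<=` A ->
  \1_(A `\` B) = (fun x => \1_A x - \1_B x) :> (T -> R).
Proof.
move=> BA; apply/funext => x; rewrite !indicE in_setD.
have [xB|xB] := boolP (x \in B); last by rewrite subr0 andbT.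
by rewrite (mem_set (BA _ (set_mem xB)))/= subrr.
Qed.

(** The sets over which the integral of [h] vanishes form a Dynkin system. *)
Lemma integral_eq0_sigma_algebra h (G : set (set T)) :
  intg h -> setI_closed G -> G setT -> G `<=` measurable ->
  (forall S, G S -> \int[mu]_(x in S) h x = 0) ->
  forall S, <<s G >> S -> \int[mu]_(x in S) h x = 0.
Proof.
move=> hi GI GT Gm G0 S GS.
suff H : (measurable S /\ (\int[mu]_(x in S) (h x)%:E = 0)%E) by rewrite /Rintegral H.2.
have fin A : measurable A -> (\int[mu]_(x in A) (h x)%:E \is a fin_num)%E.
  move=> mA; apply: integrable_fin_num => //.
  exact: integrableS hi.
have toE A : measurable A -> \int[mu]_(x in A) h x = 0 -> (\int[mu]_(x in A) (h x)%:E = 0)%E.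
  by move=> mA A0; rewrite -[LHS]fineK ?fin//; congr (_%:E).
move: S GS; apply: (dynkin_induction (T := g_sigma_algebraType G)) => //=.
- by split => //; apply: toE => //; exact: G0.
- by move=> S GS; split; [exact: Gm|apply: toE; [exact: Gm|exact: G0]].
- move=> S _ [mS S0]; split; first exact: measurableC.
  have := toE _ measurableT (G0 _ GT).
  rewrite -(setUv S) integral_setU_EFin//=; first by rewrite S0 add0e.
  + exact: measurableC.
  + by apply: measurable_funTS; exact: intg_measurable hi.
  + by apply/disj_setPS; rewrite setICr.
- move=> F _ tF F0; have mF n : d.-measurable (F n) by case: (F0 n).
  have mU : d.-measurable (\bigcup_k F k) by exact: bigcup_measurable.
  split => //; rewrite integral_bigcup//; first by rewrite eseries0// => n _ _; case: (F0 n).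
  exact: integrableS hi.
Qed.

End integral_calculus.

Section square_integrable.
Context d (T : measurableType d) (R : realType) (mu : probability T R).
Implicit Types f g h : T -> R.
Local Notation L2 := (Lfun mu 2%:E).

Lemma L2P f : f \in L2 <-> measurable_fun setT f /\ intg mu (fun x => f x ^+ 2).
Proof.
split=> [f2|[mf fi]].
  split; last exact: Lfun2_integrable_sqr.
  by move: f2; rewrite inE => /andP[/[!inE]/= mf _].
rewrite inE; apply/andP; split; rewrite inE//=.
rewrite /finite_norm unlock poweR_lty//.
under eq_integral => x _ do rewrite /= powR_mulrn// real_normK ?num_real//.
exact: (integrable_lty measurableT fi).
Qed.

Lemma eq_L2 f g : f =1 g -> f \in L2 -> g \in L2.
Proof. by move=> /funext ->. Qed.

Lemma L2_measurable f : f \in L2 -> measurable_fun setT f.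
Proof. by move=> /L2P[]. Qed.

Lemma bm_L2 f : bm f -> f \in L2.
Proof.
move=> bf; apply/L2P; split; first by case: bf.
by apply: bm_intg; apply: (eq_bm _ (bmM bf bf)) => x; rewrite expr2.
Qed.

Lemma L2M f g : f \in L2 -> g \in L2 -> intg mu (fun x => f x * g x).
Proof. by move=> f2 g2; apply/Lfun1_integrable; exact: Lfun2_mul_Lfun1. Qed.

Lemma L2_intg f : f \in L2 -> intg mu f.
Proof.
move=> f2; apply: (eq_intg _ (L2M (bm_L2 (bm_cst T 1)) f2)) => x.
by rewrite mul1r.
Qed.

Lemma L2D f g : f \in L2 -> g \in L2 -> (fun x => f x + g x) \in L2.
Proof.
move=> f2 g2; apply/L2P; split.
  by apply: measurable_funD; exact: L2_measurable.
have fg := L2M f2 g2.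
apply: (eq_intg _ (intgD (intgD (L2M f2 f2) (intgD fg fg)) (L2M g2 g2))) => x.
by rewrite /=; ring.
Qed.

Lemma L2Z c f : f \in L2 -> (fun x => c * f x) \in L2.
Proof.
move=> f2; apply/L2P; split.
  by apply: measurable_funM => //; exact: L2_measurable.
apply: (eq_intg _ (intgZ (c ^+ 2) (L2M f2 f2))) => x.
by rewrite /=; ring.
Qed.

Lemma L2B f g : f \in L2 -> g \in L2 -> (fun x => f x - g x) \in L2.
Proof.
by move=> f2 /(L2Z (-1)) g2; apply: (eq_L2 _ (L2D f2 g2)) => x; rewrite mulN1r.
Qed.

Lemma bm_L2M f g : bm f -> g \in L2 -> (fun x => f x * g x) \in L2.
Proof.
move=> bf /L2P[mg gi]; apply/L2P; split.
  by apply: measurable_funM => //; case: bf.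
apply: (eq_intg _ (bm_intgM (bmM bf bf) gi)) => x.
by rewrite /=; ring.
Qed.

Lemma L2_sum (I : Type) (r : seq I) (P : pred I) (f : I -> T -> R) :
  (forall i, P i -> f i \in L2) -> (fun x => \sum_(i <- r | P i) f i x) \in L2.
Proof.
move=> bf; elim: r => [|i r IH].
  by apply: (eq_L2 _ (bm_L2 (bm_cst T 0))) => x; rewrite big_nil.
have [Pi|nPi] := boolP (P i); last first.
  by apply: (eq_L2 _ IH) => x; rewrite big_cons (negbTE nPi).
by apply: (eq_L2 _ (L2D (bf i Pi) IH)) => x; rewrite big_cons Pi.
Qed.

End square_integrable.

Section cantor_measure.
Variables (R : realType) (mu : probability C3 R).
Local Notation L2 := (Lfun mu 2%:E).
Implicit Types f g h : C3 -> R.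

Lemma innerC f g : inner mu f g = inner mu g f.
Proof. by apply: eq_Rintegral => x _; rewrite mulrC. Qed.

Lemma innerDl f g h : f \in L2 -> g \in L2 -> h \in L2 ->
  inner mu (fun x => f x + g x) h = inner mu f h + inner mu g h.
Proof.
move=> f2 g2 h2; rewrite -meanD; [|exact: L2M..].
by apply: eq_Rintegral => x _; rewrite mulrDl.
Qed.

Lemma innerZl c f g : f \in L2 -> g \in L2 ->
  inner mu (fun x => c * f x) g = c * inner mu f g.
Proof.
move=> f2 g2; rewrite -meanZ; last exact: L2M.
by apply: eq_Rintegral => x _; rewrite mulrA.
Qed.

Lemma innerBl f g h : f \in L2 -> g \in L2 -> h \in L2 ->
  inner mu (fun x => f x - g x) h = inner mu f h - inner mu g h.
Proof.
move=> f2 g2 h2; rewrite -meanB; [|exact: L2M..].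
by apply: eq_Rintegral => x _; rewrite mulrBl.
Qed.

Lemma sqnorm_ge0 f : 0 <= sqnorm mu f.
Proof. by apply: Rintegral_ge0 => x _; rewrite -expr2 sqr_ge0. Qed.

Lemma sqnormBZ a f g : f \in L2 -> g \in L2 ->
  sqnorm mu (fun x => f x - a * g x) =
  sqnorm mu f - 2 * a * inner mu f g + a ^+ 2 * sqnorm mu g.
Proof.
move=> f2 g2; have ag2 := L2Z a g2; have fag := L2B f2 ag2.
have e h : h \in L2 -> inner mu (fun x => f x - a * g x) h = inner mu f h - a * inner mu g h.
  by move=> h2; rewrite innerBl// innerZl.
rewrite /sqnorm e// (innerC f (fun x => f x - a * g x)).
by rewrite (innerC g (fun x => f x - a * g x)) !e// (innerC g f); ring.
Qed.

(** The discriminant of the square norm of [f - a g], as a polynomial in [a]. *)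
Lemma cauchy_schwarz f g : f \in L2 -> g \in L2 ->
  inner mu f g ^+ 2 <= sqnorm mu f * sqnorm mu g.
Proof.
move=> f2 g2.
have H a : 0 <= sqnorm mu f - 2 * a * inner mu f g + a ^+ 2 * sqnorm mu g.
  by rewrite -sqnormBZ// sqnorm_ge0.
have := sqnorm_ge0 g; rewrite le_eqVlt => /predU1P[g0|g0].
  have [->|I0] := eqVneq (inner mu f g) 0; first by rewrite -g0 expr0n/= mulr0.
  have := H ((sqnorm mu f + 1) / (2 * inner mu f g)).
  rewrite -g0 mulr0 addr0 (_ : 2 * _ * _ = sqnorm mu f + 1); last by field.
  by rewrite opprD addrA subrr sub0r ler0N1.
have := H (inner mu f g / sqnorm mu g).
rewrite (_ : _ + _ = sqnorm mu f - inner mu f g ^+ 2 / sqnorm mu g); last first.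
  by field; rewrite gt_eqF.
by rewrite subr_ge0 ler_pdivrMr.
Qed.

Definition nrm f : R := Num.sqrt (sqnorm mu f).

Lemma nrm_ge0 f : 0 <= nrm f. Proof. exact: sqrtr_ge0. Qed.

Lemma sqr_nrm f : nrm f ^+ 2 = sqnorm mu f.
Proof. by rewrite sqr_sqrtr// sqnorm_ge0. Qed.

Lemma ler_inner f g : f \in L2 -> g \in L2 -> `|inner mu f g| <= nrm f * nrm g.
Proof.
move=> f2 g2; rewrite -ler_sqr ?nnegrE ?mulr_ge0 ?nrm_ge0//.
by rewrite real_normK ?num_real// exprMn !sqr_nrm cauchy_schwarz.
Qed.

Lemma nrmZ c f : f \in L2 -> nrm (fun x => c * f x) = `|c| * nrm f.
Proof.
move=> f2; have cf2 := L2Z c f2.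
by rewrite /nrm /sqnorm innerZl// innerC innerZl// mulrA -expr2 sqrtrM ?sqr_ge0// sqrtr_sqr.
Qed.

Lemma nrmD f g : f \in L2 -> g \in L2 -> nrm (fun x => f x + g x) <= nrm f + nrm g.
Proof.
move=> f2 g2; rewrite -ler_sqr ?nnegrE ?addr_ge0 ?nrm_ge0//.
have fg2 := L2D f2 g2.
rewrite sqr_nrm /sqnorm innerDl// (innerC f (fun x => f x + g x)).
rewrite (innerC g (fun x => f x + g x)) !innerDl// (innerC g f).
rewrite sqrrD !sqr_nrm -!/(sqnorm mu _).
have := ler_inner f2 g2; have := ler_norm (inner mu f g); lra.
Qed.

Lemma nrm_distC f g : nrm (fun x => f x - g x) = nrm (fun x => g x - f x).
Proof. by congr Num.sqrt; apply: eq_Rintegral => x _; ring. Qed.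

Lemma nrm_dist f g h : f \in L2 -> g \in L2 -> h \in L2 ->
  nrm (fun x => f x - h x) <= nrm (fun x => f x - g x) + nrm (fun x => g x - h x).
Proof.
move=> f2 g2 h2; have := nrmD (L2B f2 g2) (L2B g2 h2).
by under [X in nrm X <= _ -> _]eq_fun do rewrite addrA subrK.
Qed.

Lemma nrm0_ae f : f \in L2 -> nrm f = 0 -> {ae mu, forall x, f x = 0}.
Proof.
move=> f2 /eqP; rewrite sqrtr_eq0 => sf.
have {}sf : sqnorm mu f = 0 by apply/eqP; rewrite eq_le sf sqnorm_ge0.
have mff : measurable_fun setT (EFin \o (fun x => f x * f x)).
  by apply/measurable_EFinP/measurable_funM; exact: (L2_measurable f2).
have /(ae_eq_integral_abs mu measurableT mff).1 : (\int[mu]_x `|(f x * f x)%:E| = 0)%E.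
  under eq_integral => x _ do rewrite gee0_abs ?lee_fin -?expr2 ?sqr_ge0//.
  have i := Lfun2_integrable_sqr f2.
  rewrite [LHS](EFin_mean i); congr (_%:E); rewrite -[RHS]sf.
  by apply: eq_Rintegral => x _; rewrite expr2.
apply: filterS => x /(_ I) [] /eqP; rewrite mulf_eq0 orbb => /eqP //.
Qed.

Lemma ae_nrm f g : f \in L2 -> g \in L2 -> {ae mu, forall x, f x = g x} -> nrm f = nrm g.
Proof.
move=> f2 g2 fg; have [mf mg] := (L2_measurable f2, L2_measurable g2).
congr Num.sqrt; apply: ae_mean; [exact: measurable_funM..|].
by apply: filterS fg => x ->.
Qed.

Lemma ae_inner f g h : f \in L2 -> g \in L2 -> h \in L2 ->
  {ae mu, forall x, f x = g x} -> inner mu h f = inner mu h g.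
Proof.
move=> f2 g2 h2 fg.
have [mf [mg mh]] := (L2_measurable f2, (L2_measurable g2, L2_measurable h2)).
apply: ae_mean; [exact: measurable_funM..|].
by apply: filterS fg => x ->.
Qed.

Lemma ae_nrm_sub f g : f \in L2 -> g \in L2 -> {ae mu, forall x, f x = g x} ->
  nrm (fun x => f x - g x) = 0.
Proof.
move=> f2 g2 fg; rewrite (@ae_nrm _ (cst 0)).
- rewrite /nrm /sqnorm /inner; under eq_Rintegral do rewrite mulr0.
  by rewrite mean_cst sqrtr0.
- exact: L2B.
- exact/bm_L2/bm_cst.
- by apply: filterS fg => x ->; rewrite subrr.
Qed.

Lemma nrm_bound f (c : R) : bm f -> 0 <= c -> (forall x, `|f x| <= c) -> nrm f <= c.
Proof.
move=> bf c0 fc; rewrite -ler_sqr ?nnegrE ?nrm_ge0// sqr_nrm.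
rewrite -[leRHS](mean_cst mu).
apply: (le_mean (bm_intg mu (bmM bf bf)) (bm_intg mu (bm_cst _ (c ^+ 2)))).
by move=> x; rewrite -expr2 -real_normK ?num_real// ler_pXn2r ?nnegrE.
Qed.

Lemma nrm_bmM f g (c : R) : bm f -> g \in L2 -> 0 <= c -> (forall x, `|f x| <= c) ->
  nrm (fun x => f x * g x) <= c * nrm g.
Proof.
move=> bf g2 c0 fc; rewrite -ler_sqr ?nnegrE ?mulr_ge0 ?nrm_ge0//.
rewrite exprMn !sqr_nrm -meanZ; last exact: L2M.
have fg2 := bm_L2M bf g2.
apply: (le_mean (L2M fg2 fg2) (intgZ (c ^+ 2) (L2M g2 g2))).
move=> x; rewrite -!expr2 exprMn ler_wpM2r ?sqr_ge0//.
by rewrite -real_normK ?num_real// ler_pXn2r ?nnegrE.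
Qed.

(** * Conditional expectation on the words of a given length *)

Hypothesis muP : is_mu mu.

Lemma muE v : fine (mu (cylinder v)) = 2 ^- size v. Proof. by rewrite muP. Qed.

Lemma lev_expand n f : lev n f ->
  forall x, f x = \sum_(w : n.-tuple bool) f (pt w) * \1_(cylinder w) x.
Proof.
move=> fn x; have sx : size (pre n x) == n by rewrite size_pre.
rewrite (bigD1 (Tuple sx))//= indicE mem_set ?mulr1; last exact/cylinder_pre.
rewrite (lev_pt x fn) big1 ?addr0// => w wx.
rewrite indicE memNset ?mulr0// => /cylinderE; rewrite size_tuple => e.
by move: wx; rewrite -val_eqE/= e eqxx.
Qed.

Lemma lev_bm n f : lev n f -> bm f.
Proof.
move=> fn; apply: (eq_bm (fun x => esym (lev_expand fn x))).
by apply: bm_sum => w _; apply: bmZ; apply: bm_indic; exact: measurable_cylinder.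
Qed.

Lemma lev_intg n f : lev n f -> intg mu f.
Proof. by move=> /lev_bm; exact: bm_intg. Qed.

Lemma bm_cyl v : bm (\1_(cylinder v) : C3 -> R).
Proof. by apply: bm_indic; exact: measurable_cylinder. Qed.

Definition cint v f : R := \int[mu]_x (\1_(cylinder v) x * f x).

Lemma cint_intg v f : intg mu f -> intg mu (fun x => \1_(cylinder v) x * f x).
Proof. exact/bm_intgM/bm_cyl. Qed.

Lemma cintZ v c f : intg mu f -> cint v (fun x => c * f x) = c * cint v f.
Proof.
move=> fi; rewrite -meanZ; last exact: cint_intg.
by apply: eq_Rintegral => x _; rewrite mulrCA.
Qed.

Lemma cintB v f g : intg mu f -> intg mu g ->
  cint v (fun x => f x - g x) = cint v f - cint v g.
Proof.
move=> fi gi; rewrite -meanB; [|exact: cint_intg..].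
by apply: eq_Rintegral => x _; rewrite mulrBr.
Qed.

Lemma cint_const v f (c : R) : (forall x, cylinder v x -> f x = c) ->
  cint v f = c * 2 ^- size v.
Proof.
move=> fc; rewrite -muE -mean_indic; last exact: measurable_cylinder.
rewrite -meanZ; last exact/bm_intg/bm_cyl.
apply: eq_Rintegral => x _; rewrite indicE.
by have [/set_mem/fc ->|_] := boolP (x \in _); rewrite ?mul1r ?mulr1 ?mul0r ?mulr0.
Qed.

Lemma sum_indic_cylinder n x : \sum_(w : n.-tuple bool) (\1_(cylinder w) x : R) = 1.
Proof.
rewrite -[RHS]/((cst 1 : C3 -> R) x) (lev_expand (@lev_cst _ n (1 : R)) x).
by apply: eq_bigr => w _; rewrite mul1r.
Qed.

Lemma sum_cint n f : intg mu f -> \sum_(w : n.-tuple bool) cint w f = \int[mu]_x f x.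
Proof.
move=> fi; rewrite -mean_sum; last by move=> w _; exact: cint_intg.
by apply: eq_Rintegral => x _; rewrite -mulr_suml sum_indic_cylinder mul1r.
Qed.

Lemma indic_children v x : (\1_(cylinder v) x : R) =
  \1_(cylinder (rcons v false)) x + \1_(cylinder (rcons v true)) x.
Proof.
rewrite !indicE.
have H b : (x \in cylinder (rcons v b)) = (x \in cylinder v) && (x (size v) == b).
  apply/idP/andP => [/set_mem/cylinderE|[/set_mem/cylinderE xv /eqP xb]].
    rewrite size_rcons preS => /rcons_inj[xv ->]; split => //.
    exact/mem_set/cylinderE.
  by apply/mem_set/cylinderE; rewrite size_rcons preS xv xb.
rewrite !H; case: (x \in _) => /=; last by rewrite addr0.
by case: (x (size v)); rewrite /= ?addr0 ?add0r.
Qed.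

Lemma cint_children v f : intg mu f ->
  cint v f = cint (rcons v false) f + cint (rcons v true) f.
Proof.
move=> fi; rewrite -meanD; [|exact: cint_intg..].
by apply: eq_Rintegral => x _; rewrite indic_children mulrDl.
Qed.

(** Conditional expectation given the first [n] bits: the mean over the ball of measure [2^-n]
around the point. *)
Definition E n f : C3 -> R := fun x => 2 ^+ n * cint (pre n x) f.

Lemma lev_E n f : lev n (E n f).
Proof. by move=> x y e; rewrite /E e. Qed.

Lemma E_lev m n f : (m <= n)%N -> lev m f -> E n f = f.
Proof.
move=> mn fm; apply/funext => x; rewrite /E (cint_const (c := f x)).
  by rewrite size_pre mulrCA mulfV ?mulr1// expf_neq0.
by move=> y /cylinder_pre e; apply: fm; exact: pre_le e.
Qed.

Lemma EB n f g : intg mu f -> intg mu g ->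
  E n (fun x => f x - g x) = (fun x => E n f x - E n g x).
Proof. by move=> fi gi; apply/funext => x; rewrite /E cintB// mulrBr. Qed.

Lemma E_intg n f : intg mu (E n f).
Proof. exact: (lev_intg (@lev_E n f)). Qed.

Lemma E_cint n f (w : n.-tuple bool) : E n f (pt w) = 2 ^+ n * cint w f.
Proof. by rewrite /E pre_pt_tuple. Qed.

(** Both sides are the same bilinear form in the integrals over the words of length [n]. *)
Lemma E_sym n f g : intg mu f -> intg mu g ->
  \int[mu]_x (f x * E n g x) = \int[mu]_x (E n f x * g x).
Proof.
move=> fi gi.
have H (u v : C3 -> R) : intg mu u -> \int[mu]_x (u x * E n v x) =
    \sum_(w : n.-tuple bool) 2 ^+ n * cint w v * cint w u.
  move=> ui; transitivity (\int[mu]_x \sum_(w : n.-tuple bool)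
      (2 ^+ n * cint w v) * (\1_(cylinder w) x * u x)).
    apply: eq_Rintegral => x _; rewrite (lev_expand (@lev_E n v) x) mulr_sumr.
    by apply: eq_bigr => w _; rewrite E_cint; ring.
  rewrite mean_sum; last by move=> w _; exact/intgZ/cint_intg.
  by apply: eq_bigr => w _; rewrite meanZ//; exact: cint_intg.
under [RHS]eq_Rintegral do rewrite mulrC.
by rewrite !H//; apply: eq_bigr => w _; ring.
Qed.

Lemma cint_E m f (v : vertex) : (size v <= m)%N -> intg mu f ->
  cint v (E m f) = cint v f.
Proof.
move=> vm fi; rewrite /cint E_sym//; last exact/bm_intg/bm_cyl.
by rewrite (E_lev vm)//; exact: lev_indic.
Qed.

Lemma E_E m n f : intg mu f -> E n (E m f) = E (minn m n) f.
Proof.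
move=> fi; have [mn|/ltnW nm] := leqP m n; first by rewrite (E_lev mn)//; exact: lev_E.
by apply/funext => x; rewrite /E -/(E m f) cint_E ?size_pre.
Qed.

(** A function centered on the balls of level [n] is centered on the larger ones. *)
Lemma cint_E0 n f v : intg mu f -> E n f = cst 0 -> (size v <= n)%N -> cint v f = 0.
Proof.
move=> fi En0 vn; rewrite -(cint_E vn fi) En0.
by rewrite (cint_const (c := 0)) ?mul0r.
Qed.

End cantor_measure.

(** * The energy form on the locally constant functions *)

Section powers_of_three.
Variable R : realType.

Lemma powR3_lt (x y : R) : x < y -> 3 `^ x < 3 `^ y.
Proof.
by move=> xy; rewrite /powR pnatr_eq0/= ltr_expR ltr_pM2r// ln_gt0// ltr1n.
Qed.

Lemma powR3_s0 : 3 `^ s0 = 2 :> R.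
Proof.
rewrite /powR pnatr_eq0/= /s0 divfK ?lnK ?posrE ?ltr0n//.
by rewrite gt_eqF// ln_gt0// ltr1n.
Qed.

End powers_of_three.

Section block.
Variable R : realType.
Local Notation C := R[i].
Local Notation cst_C x := (Complex (x : R) 0).

(** Weight of a vertex of height [n] in the form: the power of the absolute value of the Dirac
operator, times the square of its value, which comes from the two commutators. *)
Definition level_weight (s : R) (n : nat) : R := (3 ^- n)^-1 `^ (- s) * (3 ^- n)^-1 ^+ 2.

Lemma cst_CM (x y : R) : cst_C x * cst_C y = cst_C (x * y).
Proof. by rewrite -[LHS]/(Complex _ _) !mul0r mulr0 addr0 subr0. Qed.

Lemma cst_CB (x y : R) : cst_C x - cst_C y = cst_C (x - y).
Proof. by rewrite -[LHS]/(Complex _ _) subr0. Qed.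

Lemma block_commutator_dirac tau (f : C3 -> R) v i j :
  block_commutator (dirac_op R) (rep tau f) v i j =
  cst_C ((diam R v)^-1 * (i != j)%:R *
    (f (if j == ord0 then (tau v).1 else (tau v).2) -
     f (if i == ord0 then (tau v).1 else (tau v).2))).
Proof.
rewrite /block_commutator /dirac_op /rep mul_mx_diag mul_diag_mx !mxE.
have -> : (i != j)%:R = cst_C (i != j)%:R by case: (i != j).
by rewrite !cst_CM cst_CB; congr (cst_C _); ring.
Qed.

Lemma block_energy s tau (f g : C3 -> R) v :
  complex.Re (\tr (block_mul (abs_dirac_pow (- s))
      (block_mul (block_adjoint (block_commutator (dirac_op R) (rep tau f)))
                 (block_commutator (dirac_op R) (rep tau g))) v)) =
  2 * level_weight s (size v) *
    ((f (tau v).1 - f (tau v).2) * (g (tau v).1 - g (tau v).2)).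
Proof.
rewrite /block_mul /abs_dirac_pow mul_scalar_mx mxtraceZ /mxtrace.
have := block_commutator_dirac tau f v; have := block_commutator_dirac tau g v.
move: (block_commutator _ (rep _ g)) (block_commutator _ (rep _ f)) => B A BE AE.
rewrite !(big_ord_recl, big_ord0) !mxE !(big_ord_recl, big_ord0) !mxE.
rewrite !AE !BE /= ?oppr0.
rewrite /level_weight /diam; move: ((3 ^- size v)^-1 `^ (- s)) ((3 ^- size v)^-1 : R) => w k.
by ring.
Qed.

(** There are [2^n] vertices of height [n]; together they weigh [r^n], as [2 = 3^s0]. *)
Lemma level_weight_ratio s n : 2 ^+ n * level_weight s n = ratio s ^+ n.
Proof.
have three0 : 3 != 0 :> R by rewrite pnatr_eq0.
have -> : level_weight s n = (3 `^ (- s)) ^+ n * (3 ^+ n) ^+ 2.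
  rewrite /level_weight invrK; congr (_ * _).
  by rewrite -(powR_mulrn n (ler0n _ 3)) -powRrM mulrC powRrM powR_mulrn ?powR_ge0.
rewrite /ratio !powRD ?three0 ?implybT// powR3_s0.
by rewrite powRr1 ?ler0n// -exprM mulnC exprM -!exprMn; congr (_ ^+ _); ring.
Qed.

End block.

Section ultrametric.
Variable R : realType.
Implicit Types x y : C3.

Lemma distP x y : (x = y /\ dist R x y = 0) \/
  exists n, [/\ pre n x = pre n y, x n != y n & dist R x y = 3 ^- n].
Proof.
rewrite /dist; case: pselect => [xy|xy].
  case: ex_minnP => n xyn nmin; right; exists n; split => //.
  by apply/pre_eqP => i i_n; apply/eqP; apply: contraLR i_n; rewrite -leqNgt; exact: nmin.
left; split => //; apply/funext => i; apply/eqP; apply: contrapT => /negP xyi.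
by apply: xy; exists i.
Qed.

Lemma exp3_inj m n : (3 ^- m : R) = 3 ^- n -> m = n.
Proof.
move=> /invr_inj /eqP e; apply/eqP; move: e.
by rewrite -!natrX eqr_nat eqn_exp2l.
Qed.

Lemma dist_eqP x y n : dist R x y = 3 ^- n <-> pre n x = pre n y /\ x n <> y n.
Proof.
split=> [|[xy xyn]].
  have [[_ ->] /esym/eqP|[m [xy /eqP xym ->]] /exp3_inj <-//] := distP x y.
  by rewrite invr_eq0 expf_eq0 pnatr_eq0 andbF.
have [[e _]|[m [xy' /eqP xym ->]]] := distP x y; first by rewrite e in xyn.
congr (_ ^- _); apply/eqP; rewrite eqn_leq leqNgt (leqNgt n).
apply/andP; split; apply/negP => lt.
- by apply: xyn; move/pre_eqP : xy'; apply.
- by apply: xym; move/pre_eqP : xy; apply.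
Qed.

End ultrametric.

Section marginals.
Variables (R : realType) (mu : probability C3 R) (nu : probability choice_space R).
Hypotheses (muP : is_mu mu) (nuP : is_nu mu nu).

Lemma measurable_choice v (A : set (C3 * C3)) : measurable A ->
  measurable [set tau : choice_space | A ((tau : choice_carrier) v)].
Proof.
move=> mA; apply: sub_sigma_algebra; exists v => //.
by exists A => //; rewrite setTI.
Qed.

Lemma measurable_choice1 v : measurable_fun setT (fun tau : choice_space => ((tau : choice_carrier) v).1).
Proof.
move=> _ A mA; rewrite setTI.
rewrite (_ : _ @^-1` A = [set tau : choice_space | (A `*` setT) ((tau : choice_carrier) v)]).
  by apply: measurable_choice; exact: measurableX.
by apply/seteqP; split => tau //= -[].
Qed.

Lemma measurable_choice2 v : measurable_fun setT (fun tau : choice_space => ((tau : choice_carrier) v).2).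
Proof.
move=> _ A mA; rewrite setTI.
rewrite (_ : _ @^-1` A = [set tau : choice_space | (setT `*` A) ((tau : choice_carrier) v)]).
  by apply: measurable_choice; exact: measurableX.
by apply/seteqP; split => tau //= -[].
Qed.

Lemma Upsilon_atE v : Upsilon_at R v =
  (cylinder (rcons v false) `*` cylinder (rcons v true)) `|`
  (cylinder (rcons v true) `*` cylinder (rcons v false)).
Proof.
have H b x : cylinder (rcons v b) x <-> cylinder v x /\ x (size v) = b.
  rewrite !cylinderE size_rcons preS; split=> [/rcons_inj[]//|[-> ->]//].
apply/seteqP; split=> [[x y] [/= xv yv /dist_eqP[_]]|[x y] [[/= /H[xv xb] /H[yv yb]]|[/= /H[xv xb] /H[yv yb]]]].
- case xb: (x (size v)); case yb: (y (size v)) => // _; [right|left];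
    by split; apply/H; rewrite ?xb ?yb.
- split => //; apply/dist_eqP; rewrite /= xb yb; split=> //.
  by move/cylinderE: xv => ->; move/cylinderE: yv => ->.
- split => //; apply/dist_eqP; rewrite /= xb yb; split=> //.
  by move/cylinderE: xv => ->; move/cylinderE: yv => ->.
Qed.

Lemma measurable_Upsilon_at v : measurable (Upsilon_at R v).
Proof. by rewrite Upsilon_atE; apply: measurableU; apply: measurableX; exact: measurable_cylinder. Qed.

Lemma fine_mu2D (A B : set (C3 * C3)) : measurable A -> measurable B -> A `&` B = set0 ->
  fine ((mu \x mu)%E (A `|` B)) = fine ((mu \x mu)%E A) + fine ((mu \x mu)%E B).
Proof.
pose mu2 : probability (C3 * C3)%type R := (mu \x mu)%E.
move=> mA mB AB; rewrite measureU// fineD//; exact: (fin_num_measure mu2).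
Qed.

Lemma fine_muX (A B : set C3) : measurable A -> measurable B ->
  fine ((mu \x mu)%E (A `*` B)) = fine (mu A) * fine (mu B).
Proof.
by move=> mA mB; rewrite product_measure1E// fineM//; exact: (fin_num_measure mu).
Qed.

Lemma cylinder_rcons_disj v b (A B : set C3) :
  (A `&` cylinder (rcons v b)) `&` (B `&` cylinder (rcons v (~~ b))) = set0.
Proof.
apply/seteqP; split => // x [[_ /cylinderE]] + [_ /cylinderE].
rewrite !size_rcons => -> /rcons_inj[] bb; by case: (b) bb.
Qed.

Lemma mu2_Upsilon_at v (A B : set C3) : measurable A -> measurable B ->
  fine ((mu \x mu)%E ((A `*` B) `&` Upsilon_at R v)) =
  fine (mu (A `&` cylinder (rcons v false))) * fine (mu (B `&` cylinder (rcons v true))) +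
  fine (mu (A `&` cylinder (rcons v true))) * fine (mu (B `&` cylinder (rcons v false))).
Proof.
move=> mA mB.
have mv b := measurable_cylinder (rcons v b).
rewrite Upsilon_atE setIUr -!setXI fine_mu2D.
- by rewrite !fine_muX//; exact: measurableI.
- by apply: measurableX; exact: measurableI.
- by apply: measurableX; exact: measurableI.
- by rewrite -setXI; have := cylinder_rcons_disj v false A A => ->; rewrite set0X.
Qed.

Lemma nu_eval v (A : set (C3 * C3)) : measurable A ->
  fine (nu [set tau : choice_space | A ((tau : choice_carrier) v)]) = nu_at mu v A.
Proof.
move=> mA.
have := nuP (F := [:: v]) (A := fun=> A) isT (fun=> mA).
rewrite big_seq1 => H; rewrite -[RHS]/(fine (nu_at mu v A)%:E) -H; congr fine; congr (nu _).
by apply/seteqP; split => [tau At w|tau]; [rewrite inE => /eqP ->|apply; rewrite inE].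
Qed.

Lemma mu2_Upsilon v : fine ((mu \x mu)%E (Upsilon_at R v)) = 2 * (2 ^- (size v).+1) ^+ 2.
Proof.
have := mu2_Upsilon_at v measurableT measurableT.
by rewrite setXTT !setTI => ->; rewrite !muE// !size_rcons; ring.
Qed.

(** At a vertex, the two points are independent and uniform in the two halves of the cylinder, in
either order with probability one half. *)
Lemma nu_marginal n v (a b : C3 -> R) : lev n a -> lev n b ->
  \int[nu]_tau (a ((tau : choice_carrier) v).1 * b ((tau : choice_carrier) v).2) =
  2 ^+ (2 * size v).+1 *
   (cint mu (rcons v false) a * cint mu (rcons v true) b +
    cint mu (rcons v true) a * cint mu (rcons v false) b).
Proof.
move=> an bn.
pose S (w u : n.-tuple bool) := [set tau : choice_space | (cylinder w `*` cylinder u) ((tau : choice_carrier) v)].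
have mS w u : measurable (S w u).
  by apply: measurable_choice; apply: measurableX; exact: measurable_cylinder.
transitivity (\int[nu]_tau (\sum_(w : n.-tuple bool) \sum_(u : n.-tuple bool)
    (a (pt w) * b (pt u)) * \1_(S w u) tau)).
  apply: eq_Rintegral => tau _.
  rewrite (lev_expand an) (lev_expand bn) big_distrlr/=.
  apply: eq_bigr => w _; apply: eq_bigr => u _.
  rewrite mulrACA; congr (_ * _); rewrite !indicE -natrM mulnb; congr (_%:R); congr nat_of_bool.
  by apply/andP/idP => [[/set_mem ? /set_mem ?]|/set_mem[? ?]]; [exact/mem_set|split; exact/mem_set].
have iS c w u : intg nu (fun tau => c * \1_(S w u) tau).
  by apply: intgZ; apply: bm_intg; exact: bm_indic.
rewrite mean_sum; last by move=> w _; apply: intg_sum.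
have cE m (f : C3 -> R) (u : vertex) : lev m f ->
    cint mu u f = \sum_(w : m.-tuple bool) f (pt w) * fine (mu (cylinder w `&` cylinder u)).
  move=> fm; transitivity (\int[mu]_x (\sum_(w : m.-tuple bool) f (pt w) * \1_(cylinder w `&` cylinder u) x)).
    apply: eq_Rintegral => x _; rewrite (lev_expand fm) mulr_sumr; apply: eq_bigr => w _.
    by rewrite indicI/=; ring.
  have mI w : measurable (cylinder w `&` cylinder u).
    by apply: measurableI; exact: measurable_cylinder.
  rewrite mean_sum; last by move=> w _; apply/intgZ/bm_intg/bm_indic.
  by apply: eq_bigr => w _; rewrite meanZ ?mean_indic//; exact/bm_intg/bm_indic.
rewrite !(cE n)// !big_distrlr/= -big_split/= mulr_sumr.
apply: eq_bigr => w _; rewrite mean_sum//= -big_split/= mulr_sumr; apply: eq_bigr => u _.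
rewrite meanZ; last exact/bm_intg/bm_indic.
rewrite mean_indic// nu_eval; last by apply: measurableX; exact: measurable_cylinder.
rewrite /nu_at mu2_Upsilon_at ?mu2_Upsilon; [|exact: measurable_cylinder..].
have -> : (2 * (2 ^- (size v).+1) ^+ 2)^-1 = 2 ^+ (2 * size v).+1 :> R.
  rewrite (exprS 2 (2 * size v)) (mulnC 2) exprM (exprS 2 (size v)).
  have : 2 ^+ size v != 0 :> R by rewrite expf_neq0.
  by move: (2 ^+ size v) => k k0; field.
ring.
Qed.

Lemma measurable_Upsilon : measurable (Upsilon R).
Proof.
rewrite (_ : Upsilon R = \bigcap_k (if unpickle k is Some v then
    [set tau : choice_space | Upsilon_at R v ((tau : choice_carrier) v)] else setT)).
  apply: bigcap_measurable => [|k _ /=]; first by exists 0%N.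
  by apply: measurable_choice; exact: measurable_Upsilon_at.
apply/seteqP; split => [tau H k _|tau H v]; first exact: H.
by have := H (pickle v) I; rewrite pickleK.
Qed.

(** Each of the countably many factors is carried by its [Upsilon_at v]. *)
Lemma nu_Upsilon : {ae nu, forall tau, Upsilon R tau}.
Proof.
have H v : {ae nu, forall tau : choice_space, Upsilon_at R v ((tau : choice_carrier) v)}.
  have mA := measurable_choice v (measurable_Upsilon_at v).
  exists (~` [set tau : choice_space | Upsilon_at R v ((tau : choice_carrier) v)]).
  split => //; first exact: measurableC.
  rewrite probability_setC//.
  have := nu_eval v (measurable_Upsilon_at v).
  rewrite /nu_at setIid mu2_Upsilon divff; last first.
    by rewrite mulf_neq0// expf_neq0// invr_neq0// expf_neq0.
  rewrite -[X in _ -> (_ - X)%E = _]fineK; last exact: (fin_num_measure nu).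
  by move=> ->; rewrite subee.
pose PO (o : option vertex) (tau : choice_space) :=
  if o is Some v then Upsilon_at R v ((tau : choice_carrier) v) else True.
have : {ae nu, forall tau : choice_space, forall k : nat, PO (unpickle k) tau}.
  by apply/ae_foralln => k; exact: H.
by apply: filterS => tau Ht v; have := Ht (pickle v); rewrite (pickleK v).
Qed.

Lemma Re_block_trace A : complex.Re (block_trace A) =
  limn (series (fun n => \sum_(v : n.-tuple bool) complex.Re (\tr (A v)))) :> R.
Proof. by []. Qed.

Lemma limn_series_fin (u : nat -> R) N : (forall n, (N <= n)%N -> u n = 0) ->
  limn (series u) = \sum_(0 <= n < N) u n.
Proof.
move=> u0; apply: cvg_lim => //; apply: cvg_near_cst; exists N => // n /= Nn.
rewrite /series/= (big_cat_nat (n := N) (leq0n N) Nn)/= -[RHS]addr0; congr (_ + _).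
by rewrite big_nat_cond big1// => i /andP[/andP[Ni _] _]; exact: u0.
Qed.

Section energy.
Variable s : R.

(** The product of the two differences is expanded under the marginal at each vertex; the vertices of
height at least [N] do not contribute, since [h] is constant on their cylinders. *)
Lemma Q_lev N h g : lev N h -> lev N g ->
  Q nu s h g = \sum_(0 <= n < N) level_weight s n * \sum_(v : n.-tuple bool)
    (2 ^+ (2 * n).+2 *
     (2 ^- n.+1 * cint mu v (fun x => h x * g x)
      - cint mu (rcons v false) h * cint mu (rcons v true) g
      - cint mu (rcons v true) h * cint mu (rcons v false) g)).
Proof.
move=> hN gN; rewrite /Q.
pose F v (tau : choice_space) : R :=
  (h ((tau : choice_carrier) v).1 - h ((tau : choice_carrier) v).2) *
  (g ((tau : choice_carrier) v).1 - g ((tau : choice_carrier) v).2).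
have levO (op : R -> R -> R) (a b : C3 -> R) : lev N a -> lev N b -> lev N (fun x => op (a x) (b x)).
  exact: lev_op2.
have hgN := levO *%R _ _ hN gN.
have l1 : lev N (cst 1 : C3 -> R) by [].
pose pr (a b : C3 -> R) v (tau : choice_space) : R :=
  a ((tau : choice_carrier) v).1 * b ((tau : choice_carrier) v).2.
have bpr a b v : lev N a -> lev N b -> intg nu (pr a b v).
  move=> aN bN; apply: bm_intg; apply: bmM.
    exact: (bm_comp (measurable_choice1 v) (lev_bm aN)).
  exact: (bm_comp (measurable_choice2 v) (lev_bm bN)).
have FE v tau : F v tau =
    (pr (fun x => h x * g x) (cst 1) v tau + pr (cst 1) (fun x => h x * g x) v tau)
    - (pr h g v tau + pr g h v tau).
  by rewrite /F /pr /=; ring.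
have iF v : intg nu (F v).
  apply: (eq_intg (fun tau => esym (FE v tau))).
  by apply: intgB; apply: intgD; exact: bpr.
have IF (v : vertex) : \int[nu]_tau F v tau = 2 ^+ (2 * size v).+2 *
     (2 ^- (size v).+1 * cint mu v (fun x => h x * g x)
      - cint mu (rcons v false) h * cint mu (rcons v true) g
      - cint mu (rcons v true) h * cint mu (rcons v false) g).
  under eq_Rintegral do rewrite FE.
  rewrite meanB; [|apply: intgD; exact: bpr..].
  rewrite !meanD; [|exact: bpr..].
  rewrite !(nu_marginal (n := N))// (cint_children v (lev_intg mu hgN)).
  have c1 b : cint mu (rcons v b) (cst 1) = 2 ^- (size v).+1.
    by rewrite (cint_const muP (c := 1))// mul1r size_rcons.
  by rewrite !c1 (exprS _ (2 * size v).+1); ring.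
pose S tau := \sum_(0 <= n < N) \sum_(v : n.-tuple bool) (2 * level_weight s n) * F v tau.
have iS : intg nu S.
  by apply: intg_sum => n _; apply: intg_sum => v _; exact: intgZ.
transitivity (2^-1 * \int[nu]_tau S tau); last first.
  rewrite mean_sum; last by move=> n _; apply: intg_sum => v _; exact: intgZ.
  rewrite mulr_sumr; apply: eq_bigr => n _.
  rewrite mean_sum; last by move=> v _; exact: intgZ.
  rewrite !mulr_sumr; apply: eq_bigr => v _.
  rewrite meanZ// IF size_tuple; move: (_ * (_ - _ - _)) (level_weight s n) => X w.
  by field.
congr (_ * _); transitivity (\int[nu]_(tau in Upsilon R) S tau).
  apply: eq_Rintegral => tau /set_mem taU; rewrite Re_block_trace.
  under eq_fun do under eq_bigr do rewrite block_energy size_tuple -/(F _ _).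
  rewrite (limn_series_fin (N := N))// => n Nn; rewrite big1// => v _.
  have [v1 v2 _] := taU v; rewrite /F.
  rewrite (@lev_cylinder _ _ h v _ (tau v).2 hN) ?size_tuple//.
  by rewrite subrr mul0r mulr0.
(* Removing the restriction to [Upsilon], which has full measure. *)
have mU := measurable_Upsilon.
rewrite -mean_indicl//; apply: ae_mean.
- apply: measurable_funM; last exact: intg_measurable iS.
  by case: (@bm_indic _ _ R _ mU).
- exact: intg_measurable iS.
- by apply: filterS nu_Upsilon => tau taU; rewrite indicE mem_set// mul1r.
Qed.

Lemma exprM22 (k : nat) : (2 ^+ (2 * k).+2 : R) = 4 * (2 ^+ k * 2 ^+ k).
Proof. by rewrite !exprS mulnC exprM; ring. Qed.

(** Below level [m] the centering of [h] kills the cross terms, at level [m] they add to the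
diagonal one, and above level [m] the function [h] is constant on the cylinders. *)
Lemma Q_eigen m N h g : lev m.+1 h -> E mu m h = cst 0 -> lev N g ->
  Q nu s h g = lambda s m.+1 * inner mu h g.
Proof.
move=> hm h0 gN; have hi := lev_intg mu hm; have gi := lev_intg mu gN.
pose M := maxn m.+1 N.
have mM : (m.+1 <= M)%N := leq_maxl _ _.
have hM : lev M h := lev_le mM hm.
have gM : lev M g by apply: lev_le gN; exact: leq_maxr.
have hgi : intg mu (fun x => h x * g x) by exact: (lev_intg mu (lev_op2 *%R hM gM)).
have k0 n : 2 ^+ n != 0 :> R by rewrite expf_neq0.
have hc n (v : vertex) b : (m <= n)%N -> size v = n -> exists c, forall x, cylinder (rcons v b) x -> h x = c.
  move=> mn sv; exists (h (pt (rcons v b))) => x xv.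
  have vv : cylinder (rcons v b) (pt (rcons v b)) by apply/cylinderE; exact: pre_pt.
  by apply: (lev_cylinder hm _ xv vv); rewrite size_rcons sv.
have chg v (f : C3 -> R) c : intg mu f -> (forall x, cylinder v x -> h x = c) ->
    cint mu v (fun x => h x * f x) = c * cint mu v f.
  move=> fi hcv; rewrite -meanZ; last exact: cint_intg.
  apply: eq_Rintegral => x _; rewrite indicE.
  have [/set_mem/hcv ->|_] := boolP (x \in _); by rewrite ?mul0r ?mulr0 ?mul1r.
(* The contribution of the height [n], before the weight. *)
have level n : \sum_(v : n.-tuple bool)
    (2 ^+ (2 * n).+2 *
     (2 ^- n.+1 * cint mu v (fun x => h x * g x)
      - cint mu (rcons v false) h * cint mu (rcons v true) g
      - cint mu (rcons v true) h * cint mu (rcons v false) g)) =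
    2 ^+ n * (if (n < m)%N then 2 else if n == m then 4 else 0) * inner mu h g.
  have -> : inner mu h g = \sum_(v : n.-tuple bool) cint mu v (fun x => h x * g x).
    by have := sum_cint n hgi => /= ->.
  rewrite !mulr_sumr; apply: eq_bigr => v _.
  rewrite exprM22.
  have [nm|mn] := ltnP n m.
    rewrite !(cint_E0 muP (n := m) hi h0) ?size_rcons ?size_tuple//.
    by rewrite exprS; have := k0 n; move: (2 ^+ n) => k kn0; field.
  have [c0 hc0] := hc n v false mn (size_tuple v).
  have [c1 hc1] := hc n v true mn (size_tuple v).
  rewrite (cint_children v hgi) !(chg _ _ _ gi hc0) !(chg _ _ _ gi hc1).
  rewrite !(cint_const muP hc0) !(cint_const muP hc1) !size_rcons !size_tuple.
  have [nm|nm] := eqVneq n m.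
    (* The two halves of [v] have the same measure and the mean over [v] is zero. *)
    have : c1 = - c0.
      apply/eqP; rewrite -addr_eq0 addrC; apply/eqP.
      have : cint mu v h = 0 by apply: (cint_E0 muP hi h0); rewrite size_tuple nm.
      rewrite (cint_children v hi) (cint_const muP hc0) (cint_const muP hc1).
      rewrite !size_rcons -mulrDl => /eqP; rewrite mulf_eq0 invr_eq0.
      by rewrite (negbTE (k0 _)) orbF => /eqP.
    by move=> ->; rewrite exprS; have := k0 n; move: (2 ^+ n) => k kn0; field.
  have <- : c0 = c1.
    have cyl b : cylinder v (pt (rcons v b)).
      apply/cylinderE; rewrite -(take_pre _ (leqnSn _)) -(size_rcons v b) pre_pt.
      by rewrite -cats1 take_size_cat.
    have vv b : cylinder (rcons v b) (pt (rcons v b)) by apply/cylinderE; exact: pre_pt.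
    rewrite -(hc0 _ (vv false)) -(hc1 _ (vv true)).
    by apply: (lev_cylinder hm _ (cyl _) (cyl _)); rewrite size_tuple ltn_neqAle eq_sym nm.
  by rewrite exprS; have := k0 n; move: (2 ^+ n) => k kn0; field.
rewrite (Q_lev hM gM); under eq_bigr do rewrite level !mulrA (mulrC (level_weight s _)) level_weight_ratio.
rewrite -mulr_suml; congr (_ * _).
rewrite (big_cat_nat (n := m.+1))//= [X in _ + X]big_nat_cond [X in _ + X]big1 ?addr0; last first.
  by move=> i /andP[/andP[mi _] _]; rewrite ltnNge (ltnW mi)/= gtn_eqF// mulr0.
rewrite /lambda big_nat_recr//= ltnn eqxx big_mkord [RHS]mulrDr [in RHS]mulr_sumr [in RHS]mulrA; congr (_ + _); last first.
  by rewrite mulrC; congr (_ * _); rewrite -natrM.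
by apply: eq_bigr => i _; rewrite ltn_ord mulrC.
Qed.

Lemma Q_const N h g : lev 0 h -> lev N g -> Q nu s h g = 0.
Proof.
move=> h0 gN; rewrite (Q_lev (lev_le (leq0n N) h0) gN) big1// => n _.
rewrite big1 ?mulr0// => v _.
pose c := h point; have hc x : h x = c by exact: h0.
have gi := lev_intg mu gN.
have ch u : cint mu u h = c * 2 ^- size u by apply: cint_const.
rewrite !ch.
have -> : cint mu v (fun x => h x * g x) = c * cint mu v g.
  by rewrite -cintZ//; congr cint; apply/funext => x; rewrite hc.
by rewrite (cint_children v gi) !size_rcons !size_tuple; ring.
Qed.

End energy.
End marginals.

(** * The eigenvalues and their exponentials *)

Section eigenvalues.
Variable R : realType.

Lemma bernoulli_ge (r : R) n : 1 <= r -> 1 + n%:R * (r - 1) <= r ^+ n.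
Proof.
move=> r1; elim: n => [|n IH]; first by rewrite mul0r addr0 expr0.
rewrite exprS -natr1; have : r * (1 + n%:R * (r - 1)) <= r * r ^+ n.
  by rewrite ler_wpM2l// (le_trans ler01).
have : 0 <= n%:R * (r - 1) ^+ 2 by rewrite mulr_ge0// sqr_ge0.
by rewrite expr2; nra.
Qed.

Lemma expn_unbounded (r B : R) : 1 < r -> exists n, B <= r ^+ n.
Proof.
move=> r1; exists (Num.truncn (`|B| / (r - 1))).+1.
apply: le_trans (bernoulli_ge _ (ltW r1)).
have r0 : 0 < r - 1 by rewrite subr_gt0.
have := truncnS_gt (`|B| / (r - 1)); rewrite ltr_pdivrMr// => H.
by rewrite (le_trans (ler_norm B))// (le_trans (ltW H))// lerDr.
Qed.

Lemma expRN_le_pow (x : R) k : 0 < x -> expR (- x) <= (k.+1%:R / x) ^+ k.+1.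
Proof.
move=> x0; rewrite -[_ / x]invf_div exprVn expRN lef_pV2 ?posrE ?expR_gt0//; last first.
  by rewrite exprn_gt0// divr_gt0.
have k0 : k.+1%:R != 0 :> R by rewrite pnatr_eq0.
have -> : expR x = expR (x / k.+1%:R) ^+ k.+1 by rewrite -expRM_natl mulrC divfK.
rewrite ler_pXn2r ?nnegrE ?expR_ge0 ?divr_ge0 ?(ltW x0)//.
by rewrite (le_trans _ (expR_ge1Dx _))// lerDr.
Qed.

(** The left exponential in [r^n] beats every geometric sequence: [expR (- y)] is at most a constant
times [y^-(k+1)], and [k] is chosen so that [2 B <= r^k]. *)
Lemma expRN_geometric (r c B : R) : 1 < r -> 0 < c -> 0 <= B ->
  exists2 C, 0 <= C & forall n, B ^+ n * expR (- (c * r ^+ n)) <= C * 2 ^- n.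
Proof.
move=> r1 c0 B0; have [k kB] := expn_unbounded (2 * B) r1.
have r0 : 0 < r by rewrite (lt_trans ltr01).
exists ((k.+1%:R / c) ^+ k.+1); first by rewrite exprn_ge0// divr_ge0// ltW.
move=> n; have crn : 0 < c * r ^+ n by rewrite mulr_gt0// exprn_gt0.
apply: (le_trans (ler_wpM2l (exprn_ge0 n B0) (expRN_le_pow k crn))).
have -> : (k.+1%:R / (c * r ^+ n)) ^+ k.+1 =
    (k.+1%:R / c) ^+ k.+1 * (r^-1 ^+ k.+1) ^+ n :> R.
  by rewrite -exprM mulnC exprM -exprMn exprVn invfM mulrA.
rewrite mulrCA ler_wpM2l ?exprn_ge0 ?divr_ge0 ?(ltW c0)//.
rewrite -exprMn -exprVn lerXn2r ?nnegrE ?invr_ge0//.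
  by rewrite mulr_ge0// exprn_ge0// invr_ge0 ltW.
rewrite exprVn ler_pdivrMr ?exprn_gt0// ler_pdivlMl//.
by rewrite (le_trans kB)// exprS ler_peMl ?exprn_ge0 ?ltW.
Qed.

Variable s : R.
Hypothesis sP : s < s0 + 2.
Local Notation r := (ratio s).

Lemma ratio_gt1 : 1 < r.
Proof.
by rewrite /ratio -[ltLHS](powRr0 3); apply: powR3_lt; rewrite subr_gt0.
Qed.

Lemma ratio_gt0 : 0 < r. Proof. exact: lt_trans ltr01 ratio_gt1. Qed.

(** Rate at which the weight of the level [n] in the mixture grows at time zero. *)
Definition gap n : R := lambda s n.+1 - lambda s n.

Lemma lambda0 : lambda s 0 = 0. Proof. by []. Qed.

Lemma gap0 : gap 0 = 4.
Proof. by rewrite /gap /lambda big_ord0 expr0; ring. Qed.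

Lemma gapS n : gap n.+1 = 2 * (2 * r - 1) * r ^+ n.
Proof. by rewrite /gap /lambda big_ord_recr/= exprS; ring. Qed.

Lemma gap_ge n : 2 * r ^+ n <= gap n.
Proof.
case: n => [|n]; first by rewrite gap0 expr0; lra.
rewrite gapS exprS; have := ratio_gt1; have : 0 < r ^+ n by rewrite exprn_gt0// ratio_gt0.
by nra.
Qed.

Lemma gap_le n : gap n <= 4 * r ^+ n.
Proof.
case: n => [|n]; first by rewrite gap0 expr0; lra.
rewrite gapS exprS; have : 0 < r ^+ n by rewrite exprn_gt0// ratio_gt0.
by nra.
Qed.

Lemma gap_gt0 n : 0 < gap n.
Proof. by apply: lt_le_trans (gap_ge n); rewrite mulr_gt0// exprn_gt0// ratio_gt0. Qed.

Lemma lambda_leS n : lambda s n <= lambda s n.+1.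
Proof. by rewrite -subr_ge0; exact/ltW/gap_gt0. Qed.

Lemma lambda_ge0 n : 0 <= lambda s n.
Proof. by elim: n => [|n IH]; [rewrite lambda0|exact: le_trans IH (lambda_leS n)]. Qed.

Lemma lambdaS_ge n : 4 * r ^+ n <= lambda s n.+1.
Proof.
have : 0 <= \sum_(k < n) r ^+ k by apply: sumr_ge0 => k _; rewrite exprn_ge0// ltW// ratio_gt0.
by rewrite /lambda; lra.
Qed.

Lemma lambdaS_le n : lambda s n.+1 <= (4 * r / (r - 1)) * r ^+ n.
Proof.
have r1 := ratio_gt1; have r0 : 0 < r - 1 by rewrite subr_gt0.
rewrite mulrAC ler_pdivlMr//; elim: n => [|n IH].
  by rewrite /lambda big_ord0 !expr0; lra.
have : lambda s n.+2 = lambda s n.+1 + gap n.+1 by rewrite /gap addrC subrK.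
have := gap_le n.+1; have : 0 < r ^+ n by rewrite exprn_gt0// ratio_gt0.
rewrite exprS; nra.
Qed.

Definition edecay (t : R) n : R := expR (- (t * lambda s n)).
(** Abel summation of the spectral decomposition: the weight of the conditional expectation [E n] in
the semigroup at time [t]. The weights are positive and their sum is one. *)
Definition delta (t : R) n : R := edecay t n - edecay t n.+1.

Lemma edecay_gt0 t n : 0 < edecay t n. Proof. exact: expR_gt0. Qed.

Lemma edecay0 t : edecay t 0 = 1.
Proof. by rewrite /edecay lambda0 mulr0 oppr0 expR0. Qed.

Lemma edecayD t u n : edecay (t + u) n = edecay t n * edecay u n.
Proof. by rewrite /edecay mulrDl opprD expRD. Qed.

Lemma edecay_le1 t n : 0 <= t -> edecay t n <= 1.
Proof. by move=> t0; rewrite /edecay expR_le1 oppr_le0 mulr_ge0// lambda_ge0. Qed.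

Lemma sum_delta t m n : (m <= n)%N -> \sum_(m <= k < n) delta t k = edecay t m - edecay t n.
Proof.
move=> mn; have := telescope_sumr (fun k => - edecay t k) mn.
under eq_bigr do rewrite opprK addrC.
by rewrite opprK addrC.
Qed.

Lemma heat_coef_delta t n :
  heat_coef t s n = \sum_(0 <= m < n.+1) 2 ^+ m * delta t m.
Proof.
elim: n => [|n IH].
  by rewrite big_nat1 /heat_coef big_geq// /delta edecay0 /edecay expr0; ring.
rewrite big_nat_recr//= -IH /heat_coef [X in _ + X = _]big_nat_recr//= /delta /edecay exprS.
by ring.
Qed.

Section positive_time.
Variable t : R.
Hypothesis t0 : 0 < t.

Lemma delta_gt0 n : 0 < delta t n.
Proof.
rewrite subr_gt0 /edecay ltr_expR ltrN2 ltr_pM2l// -subr_gt0; exact: gap_gt0.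
Qed.

Lemma delta_le n : delta t n <= t * gap n.
Proof.
have -> : delta t n = edecay t n * (1 - expR (- (t * gap n))).
  rewrite /delta mulrBr mulr1 /edecay -expRD; congr (_ - expR _).
  by rewrite /gap; ring.
have g0 : 0 <= t * gap n by rewrite mulr_ge0 ?ltW// gap_gt0.
have H : 1 - expR (- (t * gap n)) <= t * gap n.
  by rewrite lerBlDr addrC -lerBlDr -[leLHS]addrC; have := expR_ge1Dx (- (t * gap n)); lra.
apply: le_trans H; apply: ler_piMl; last exact/edecay_le1/ltW.
by rewrite subr_ge0 expR_le1 oppr_le0.
Qed.

Lemma delta_ge n : t * gap n * (1 - t * lambda s n.+1) <= delta t n.
Proof.
have -> : delta t n = edecay t n.+1 * (expR (t * gap n) - 1).
  rewrite /delta mulrBr mulr1 /edecay -expRD; congr (expR _ - _).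
  by rewrite /gap; ring.
have g0 : 0 <= t * gap n by rewrite mulr_ge0 ?ltW// gap_gt0.
have H1 : t * gap n <= expR (t * gap n) - 1 by have := expR_ge1Dx (t * gap n); lra.
have H2 : 1 - t * lambda s n.+1 <= edecay t n.+1.
  by have := expR_ge1Dx (- (t * lambda s n.+1)).
have [e0|e0] := leP 0 (1 - t * lambda s n.+1); first by rewrite mulrC ler_pM.
apply: (@le_trans _ _ 0); first by rewrite mulr_ge0_le0// ltW.
by apply: mulr_ge0; [exact/ltW/edecay_gt0|exact: le_trans g0 H1].
Qed.

Lemma edecay_geometric (B : R) : 0 <= B ->
  exists2 C, 0 <= C & forall n, B ^+ n * edecay t n <= C * 2 ^- n.
Proof.
move=> B0; have t4 : 0 < 4 * t by rewrite mulr_gt0.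
have [C C0 HC] := expRN_geometric ratio_gt1 t4 B0.
exists (1 + 2 * B * C); first by rewrite addr_ge0// !mulr_ge0.
case=> [|n]; first by rewrite edecay0 !expr0 invr1 !mulr1 lerDl !mulr_ge0.
have H : edecay t n.+1 <= expR (- (4 * t * r ^+ n)).
  rewrite /edecay ler_expR lerN2 (mulrC 4) -mulrA ler_pM2l//; exact: lambdaS_ge.
have := ler_wpM2l (exprn_ge0 n B0) H => /le_trans/(_ (HC n)) {}H.
rewrite exprS -mulrA (le_trans (ler_wpM2l B0 H))// exprS invfM.
have : 0 < 2 ^- n :> R by rewrite invr_gt0 exprn_gt0.
by nra.
Qed.

Lemma kernel_summable : exists2 C, 0 <= C & forall n, 2 ^+ n * delta t n <= C * 2 ^- n.
Proof.
have [C C0 HC] := edecay_geometric (ler0n R 2); exists C => // n.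
apply: le_trans (HC n); rewrite ler_wpM2l ?exprn_ge0//.
by rewrite lerBlDr lerDl ltW// edecay_gt0.
Qed.

End positive_time.
End eigenvalues.

Section geometric_series.
Variable R : realType.
Implicit Types (u : nat -> R) (C : R).

Lemma sum_geometric2 m n : (m <= n)%N -> \sum_(m <= k < n) 2 ^- k <= 2 * 2 ^- m :> R.
Proof.
move=> mn; have : \sum_(m <= k < n) 2 ^- k = 2 * 2 ^- m - 2 * 2 ^- n :> R.
  have H k : 2 ^- k = - (2 * 2 ^- k.+1) - - (2 * 2 ^- k) :> R.
    have k0 : 2 ^+ k != 0 :> R by rewrite expf_neq0.
    by rewrite exprS; field.
  rewrite (eq_bigr _ (fun k _ => H k)).
  by have := telescope_sumr (fun k => - (2 * 2 ^- k) : R) mn => /= ->; ring.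
move=> ->; rewrite lerBlDr lerDl mulr_ge0// invr_ge0 exprn_ge0//.
Qed.

Lemma geometric_series u C : (forall n, `|u n| <= C * 2 ^- n) ->
  cvgn (series u) /\ forall N, `|limn (series u) - \sum_(0 <= k < N) u k| <= 2 * C * 2 ^- N.
Proof.
move=> uC.
have C0 : 0 <= C by have := le_trans (normr_ge0 _) (uC 0); rewrite expr0 invr1 mulr1.
have B m n : (m <= n)%N -> `|\sum_(m <= k < n) u k| <= 2 * C * 2 ^- m.
  move=> mn; apply: (le_trans (ler_norm_sum _ _ _)).
  apply: (@le_trans _ _ (\sum_(m <= k < n) C * 2 ^- k)); first exact: ler_sum.
  by rewrite -mulr_sumr (mulrC 2) -mulrA ler_wpM2l// sum_geometric2.
have cu : cvgn (series u).
  apply: normed_cvg; apply: nondecreasing_is_cvgn.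
    by apply: nondecreasing_series => n _ _; exact: normr_ge0.
  exists (2 * C) => _ [n _ <-]; rewrite /series/=.
  apply: (@le_trans _ _ (\sum_(0 <= k < n) C * 2 ^- k)); first exact: ler_sum.
  rewrite -mulr_sumr mulrC ler_wpM2r//; have := @sum_geometric2 0 n (leq0n n).
  by rewrite expr0 invr1 mulr1.
split => // N; have cN : (fun n => `|series u n - \sum_(0 <= k < N) u k|) @ \oo -->
    `|limn (series u) - \sum_(0 <= k < N) u k|.
  by apply: cvg_norm; apply: cvgB => //; exact: cvg_cst.
rewrite -(cvg_lim _ cN)//; apply: limr_le; first by apply/cvg_ex; eexists; exact: cN.
exists N => // n /= Nn; rewrite /series/= (big_cat_nat (n := N) (leq0n N) Nn)/= addrAC subrr add0r.
exact: B.
Qed.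

(** Two quantities are compared below by replacing both by approximations of order [M]. *)
Lemma geometric_eq0 (D C : R) N : (forall M, (N <= M)%N -> `|D| <= C * 2 ^- M) -> D = 0.
Proof.
move=> H; apply/eqP; rewrite -normr_eq0; apply/eqP/le_anti; rewrite normr_ge0 andbT.
have c : (fun M => C * 2 ^- M) @ \oo --> (0 : R).
  rewrite -(mulr0 C); apply: cvgM; first exact: cvg_cst.
  under eq_fun do rewrite -exprVn.
  by apply: cvg_expr; rewrite ger0_norm ?invr_ge0// invf_lt1// ltr1n.
rewrite -(cvg_lim _ c)//; apply: limr_ge; first by apply/cvg_ex; eexists; exact: c.
by exists N => // M /= /H.
Qed.

End geometric_series.

(** * The heat kernel *)

Section kernel.
Variables (R : realType) (s : R).
Hypothesis sP : s < s0 + 2.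

Definition same n (x y : C3) : R := (pre n x == pre n y)%:R.

Definition kern_term (t : R) (z : C3 * C3) (n : nat) : R :=
  2 ^+ n * delta s t n * same n z.1 z.2.

Definition kern_trunc (t : R) (N : nat) (z : C3 * C3) : R :=
  \sum_(0 <= n < N) kern_term t z n.

(** Mixture over [n] of the uniform laws on the cylinder of length [n] around [z.1], the
weights being [delta s t n]. *)
Definition kern (t : R) (z : C3 * C3) : R := limn (series (kern_term t z)).

Lemma same_indic n x y : same n x y = \1_(cylinder (pre n x)) y.
Proof.
rewrite /same indicE; congr (_%:R); congr nat_of_bool.
by apply/eqP/idP => [e|/set_mem/cylinder_pre//]; apply/mem_set/cylinder_pre.
Qed.

Lemma same_sym n x y : same n x y = same n y x.
Proof. by rewrite /same eq_sym. Qed.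

Lemma lev_same n x : lev n (same n x).
Proof. by move=> y z e; rewrite /same e. Qed.

Lemma same_sum n x y :
  same n x y = \sum_(w : n.-tuple bool) \1_(cylinder w) x * \1_(cylinder w) y.
Proof.
rewrite same_sym (lev_expand (@lev_same n y)); apply: eq_bigr => w _.
rewrite mulrC; congr (_ * _); rewrite same_sym same_indic !indicE.
congr (_%:R); congr nat_of_bool; rewrite pre_pt_tuple.
by [].
Qed.

Lemma bm_same n : bm (fun z : C3 * C3 => same n z.1 z.2).
Proof.
apply: (eq_bm (fun z => esym (same_sum n z.1 z.2))); apply: bm_sum => w _.
by apply: bmM; [apply: (bm_comp measurable_fst)|apply: (bm_comp measurable_snd)];
  exact: bm_cyl.
Qed.

Lemma bm_kern_trunc t N : bm (kern_trunc t N).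
Proof. by apply: bm_sum => n _; apply: bmZ; exact: bm_same. Qed.

Section positive_time.
Variable t : R.
Hypothesis t0 : 0 < t.

Lemma kern_term_ge0 z n : 0 <= kern_term t z n.
Proof.
by apply: mulr_ge0; [apply: mulr_ge0; [exact: exprn_ge0|exact/ltW/delta_gt0]|exact: ler0n].
Qed.

Lemma kern_approx : exists2 C, 0 <= C & forall z,
  cvgn (series (kern_term t z)) /\
  forall N, `|kern t z - kern_trunc t N z| <= C * 2 ^- N.
Proof.
have [C C0 HC] := kernel_summable sP t0; exists (2 * C); first by rewrite mulr_ge0.
move=> z; apply: geometric_series => n; rewrite ger0_norm ?kern_term_ge0//.
apply: le_trans (HC n); rewrite -[leRHS]mulr1 ler_wpM2l ?mulr_ge0 ?exprn_ge0//.
  exact/ltW/delta_gt0.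
by rewrite /same; case: eqP.
Qed.

Lemma kern_trunc_le N z : kern_trunc t N z <= kern t z.
Proof.
have [C _ HC] := kern_approx; have [cz _] := HC z.
apply: (nondecreasing_cvgn_le _ cz N); apply: nondecreasing_series => n _ _.
exact: kern_term_ge0.
Qed.

Lemma kern_gt0 z : 0 < kern t z.
Proof.
apply: lt_le_trans (kern_trunc_le 1 z).
rewrite /kern_trunc big_nat1 /kern_term /same eqxx expr0 mul1r mulr1.
exact: delta_gt0.
Qed.

Lemma measurable_kern : measurable_fun setT (kern t).
Proof.
have [C C0 HC] := kern_approx.
apply: (measurable_fun_cvg (h := fun N => kern_trunc t N)).
  by move=> N; case: (bm_kern_trunc t N).
by move=> z _; have [cz _] := HC z.
Qed.

Lemma bm_kern : bm (kern t).
Proof.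
split; first exact: measurable_kern.
have [C C0 HC] := kern_approx; exists C => z; have [_ /(_ 0%N)] := HC z.
by rewrite /kern_trunc big_geq// subr0 expr0 invr1 mulr1.
Qed.

Lemma bm_kernr x : bm (fun y => kern t (x, y)).
Proof. by apply: (bm_comp _ bm_kern); exact: measurable_fun_pair. Qed.

(** The points share their first [m] bits exactly for [m <= n], so the series is a finite sum. *)
Lemma kern_offdiag n x y : dist R x y = 3 ^- n -> kern t (x, y) = heat_coef t s n.
Proof.
move=> /dist_eqP[e /eqP ne]; rewrite heat_coef_delta /kern.
rewrite (limn_series_fin (N := n.+1)).
  rewrite big_nat [RHS]big_nat; apply: eq_bigr => m /= mn.
  by rewrite /kern_term /same/= (pre_le _ e)// eqxx mulr1.
move=> m nm; rewrite /kern_term /same/=; case: eqP => [/pre_eqP/(_ n nm)/eqP|]; last by rewrite mulr0.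
by rewrite (negbTE ne).
Qed.

Lemma kern_series n x y : dist R x y = 3 ^- n ->
  limn (series (fun m => kappa R m x y * heat_coef t s m)) = heat_coef t s n.
Proof.
move=> d; rewrite (limn_series_fin (N := n.+1)); last first.
  move=> m nm; rewrite /kappa d; case: eqP => [/exp3_inj e|]; last by rewrite mul0r.
  by rewrite e ltnn in nm.
rewrite big_nat_recr//= big_nat big1 ?add0r.
  by rewrite /kappa d eqxx mul1r.
move=> m /= mn; rewrite /kappa d; case: eqP => [/exp3_inj e|]; last by rewrite mul0r.
by rewrite e ltnn in mn.
Qed.

(** A uniform limit of locally constant functions. *)
Lemma continuous_kern : continuous (kern t).
Proof.
have [C C0 HC] := kern_approx.
move=> [x y]; apply/(@cvgrPdist_lt _ R^o) => e e0.
have [N HN] : exists N, 2 * C * 2 ^- N < e.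
  have lt12 : 1 < 2 :> R by rewrite ltr1n.
  have [N HN] := expn_unbounded (2 * C / e + 1) lt12.
  exists N; rewrite ltr_pdivrMr ?exprn_gt0// [ltRHS]mulrC -ltr_pdivrMr//.
  by apply: lt_le_trans HN; rewrite ltrDl.
near=> z; have [_ /(_ N) H1] := HC (x, y); have [_ /(_ N) H2] := HC z.
have Ez : kern_trunc t N z = kern_trunc t N (x, y).
  have [z1 z2] : pre N z.1 = pre N x /\ pre N z.2 = pre N y.
    near: z; exists (cylinder (pre N x), cylinder (pre N y)) => /=.
      by split; apply/nbhs_cylinder; exists N.
    by move=> z [/= /cylinder_pre ? /cylinder_pre].
  rewrite /kern_trunc big_nat [RHS]big_nat; apply: eq_bigr => m /= mN.
  rewrite /kern_term /same/=; congr (_ * (_ == _)%:R); apply: pre_le (ltnW mN) _ => //.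
rewrite Ez in H2.
apply: le_lt_trans HN.
rewrite (_ : _ - _ = (kern t (x, y) - kern_trunc t N (x, y)) - (kern t z - kern_trunc t N (x, y))); last by ring.
by rewrite (le_trans (ler_normB _ _))//; lra.
Unshelve. all: by end_near. Qed.

End positive_time.

(** * The heat operator *)

Variable mu : probability C3 R.
Hypothesis muP : is_mu mu.
Implicit Types f g h : C3 -> R.

Definition heat (t : R) f : C3 -> R := fun x => \int[mu]_y (kern t (x, y) * f y).

Section positive_time.
Variable t : R.
Hypothesis t0 : 0 < t.

Lemma kern_intg x f : intg mu f -> intg mu (fun y => kern t (x, y) * f y).
Proof. by apply: bm_intgM; exact: bm_kernr. Qed.

Lemma heatD f g : intg mu f -> intg mu g ->
  heat t (fun x => f x + g x) = (fun x => heat t f x + heat t g x).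
Proof.
move=> fi gi; apply/funext => x; rewrite -meanD; [|exact: kern_intg..].
by apply: eq_Rintegral => y _; rewrite mulrDr.
Qed.

Lemma heatZ c f : intg mu f -> heat t (fun x => c * f x) = (fun x => c * heat t f x).
Proof.
move=> fi; apply/funext => x; rewrite -meanZ; last exact: kern_intg.
by apply: eq_Rintegral => y _; rewrite mulrCA.
Qed.

Lemma heat_sum (I : Type) (r : seq I) (P : pred I) (f : I -> C3 -> R) :
  (forall i, P i -> intg mu (f i)) ->
  heat t (fun x => \sum_(i <- r | P i) f i x) = (fun x => \sum_(i <- r | P i) heat t (f i) x).
Proof.
move=> fi; apply/funext => x; rewrite -mean_sum; last by move=> i Pi; exact/kern_intg/fi.
by apply: eq_Rintegral => y _; rewrite mulr_sumr.
Qed.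

Lemma heat_ge0 f x : (forall y, 0 <= f y) -> 0 <= heat t f x.
Proof.
by move=> f0; apply: Rintegral_ge0 => y _; rewrite mulr_ge0//; exact/ltW/kern_gt0.
Qed.

(** On functions of level [N], the part of the mixture beyond [N] acts as the identity. *)
Lemma heat_lev N f : lev N f -> forall x,
  heat t f x = \sum_(0 <= n < N) delta s t n * E mu n f x + edecay s t N * f x.
Proof.
move=> fN x; have fi := lev_intg mu fN.
have [_ [M fM]] := lev_bm fN.
have M0 : 0 <= M by apply: le_trans (normr_ge0 _) (fM point).
have [C C0 HC] := kern_approx t0.
have [C' C'0 HC'] := edecay_geometric sP t0 (ler01 : (0 : R) <= 1).
have trunc K : \int[mu]_y (kern_trunc t K (x, y) * f y) =
    \sum_(0 <= n < K) delta s t n * E mu n f x.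
  transitivity (\int[mu]_y \sum_(0 <= n < K)
      (2 ^+ n * delta s t n) * (\1_(cylinder (pre n x)) y * f y)).
    apply: eq_Rintegral => y _; rewrite mulr_suml; apply: eq_bigr => n _.
    by rewrite /kern_term same_indic mulrA.
  rewrite mean_sum; last by move=> n _; exact/intgZ/cint_intg.
  apply: eq_bigr => n _; rewrite meanZ; last exact: cint_intg.
  by rewrite /E /cint; ring.
have itr K : intg mu (fun y => kern_trunc t K (x, y) * f y).
  apply: bm_intgM fi; apply: (bm_comp _ (bm_kern_trunc t K)); exact: measurable_fun_pair.
apply/eqP; rewrite -subr_eq0; apply/eqP.
apply: (@geometric_eq0 _ _ (C * M + C' * M) N) => K NK.
set D := _ - _.
have -> : D = (heat t f x - \sum_(0 <= n < K) delta s t n * E mu n f x) - edecay s t K * f x.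
  rewrite /D (big_cat_nat (n := N) (leq0n N) NK)/=.
  have -> : \sum_(N <= n < K) delta s t n * E mu n f x = (edecay s t N - edecay s t K) * f x.
    rewrite -sum_delta// mulr_suml big_nat [RHS]big_nat; apply: eq_bigr => n /andP[Nn _].
    by rewrite (E_lev muP Nn).
  by ring.
rewrite mulrDl; apply: (le_trans (ler_normB _ _)); apply: lerD; last first.
  rewrite normrM mulrAC; apply: ler_pM => //; rewrite ger0_norm ?(ltW (edecay_gt0 _ _ _))//.
  by have := HC' K; rewrite expr1n mul1r.
rewrite -trunc -meanB; [|exact: kern_intg|exact: itr].
apply: ler_norm_mean_cst; first by apply: intgB; [exact: kern_intg|exact: itr].
move=> y; rewrite -mulrBl normrM mulrAC; apply: ler_pM => //.
by have [_] := HC (x, y).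
Qed.

Lemma lev_heat N f : lev N f -> lev N (heat t f).
Proof.
move=> fN x y e; rewrite !(heat_lev fN) (fN _ _ e); congr (_ + _).
rewrite big_nat [RHS]big_nat; apply: eq_bigr => n /andP[_ nN].
by rewrite (lev_E (n := n) mu f (pre_le (ltnW nN) e)).
Qed.

Lemma heat_lev0 f : lev 0 f -> heat t f = f.
Proof.
by move=> f0; apply/funext => x; rewrite (heat_lev f0) big_geq// add0r edecay0 mul1r.
Qed.

(** [h] is killed by [E k] for [k <= n] and fixed by [E k] for [k > n]; the weights of the latter add up
to [edecay s t n.+1]. *)
Lemma heat_eigen n h : lev n.+1 h -> E mu n h = cst 0 ->
  heat t h = (fun x => edecay s t n.+1 * h x).
Proof.
move=> hn h0; apply/funext => x; rewrite (heat_lev hn) big_nat big1 ?add0r// => k /=.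
by rewrite ltnS => kn; rewrite /E (cint_E0 muP (lev_intg mu hn) h0) ?size_pre// !mulr0.
Qed.

Lemma heat_sym N f g : lev N f -> lev N g ->
  \int[mu]_x (f x * heat t g x) = \int[mu]_x (heat t f x * g x).
Proof.
move=> fN gN; have [fi gi] := (lev_intg mu fN, lev_intg mu gN).
have bE n h : bm (E mu n h) by exact: (lev_bm (@lev_E _ mu n h)).
have [bf bg] := (lev_bm fN, lev_bm gN).
have e h : lev N h -> heat t h = (fun x => \sum_(0 <= n < N) delta s t n * E mu n h x + edecay s t N * h x).
  by move=> hN; apply/funext => x; exact: heat_lev.
transitivity (\int[mu]_x (\sum_(0 <= n < N) delta s t n * (f x * E mu n g x) + edecay s t N * (f x * g x))).
  apply: eq_Rintegral => x _; rewrite (e g gN) mulrDr mulr_sumr; congr (_ + _); last by ring.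
  by apply: eq_bigr => n _; ring.
transitivity (\int[mu]_x (\sum_(0 <= n < N) delta s t n * (E mu n f x * g x) + edecay s t N * (f x * g x))); last first.
  apply: eq_Rintegral => x _; rewrite (e f fN) mulrDl mulr_suml; congr (_ + _); last by ring.
  by apply: eq_bigr => n _; ring.
have i1 n : intg mu (fun x => f x * E mu n g x) by apply: bm_intgM => //; exact: bm_intg.
have i2 n : intg mu (fun x => E mu n f x * g x) by apply: bm_intgM => //; exact: bm_intg.
have i3 : intg mu (fun x => edecay s t N * (f x * g x)) by apply: intgZ; exact: bm_intgM.
rewrite !meanD//; [|by apply: intg_sum => n _; exact: intgZ..].
congr (_ + _); rewrite !mean_sum; [|by move=> n _; exact: intgZ..].
by apply: eq_bigr => n _; rewrite !meanZ// E_sym.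
Qed.

End positive_time.

(** Any function of level [N] is the sum of a constant and of eigenvectors. *)
Definition increment n f : C3 -> R := fun x => E mu n.+1 f x - E mu n f x.

Lemma lev_increment n f : lev n.+1 (increment n f).
Proof.
by move=> x y e; rewrite /increment (lev_E mu f e) (lev_E mu f (pre_le (leqnSn n) e)).
Qed.

Lemma E_increment n f : intg mu f -> E mu n (increment n f) = cst 0.
Proof.
move=> fi; rewrite (EB n (E_intg mu n.+1 f) (E_intg mu n f)) !E_E//.
rewrite minnn (minn_idPr (leqnSn n)).
by apply/funext => x; rewrite subrr.
Qed.

Lemma lev_decomposition N f : lev N f ->
  f = (fun x => E mu 0 f x + \sum_(0 <= n < N) increment n f x).
Proof.
move=> fN; apply/funext => x; rewrite telescope_sumr// (E_lev muP (leqnn N))//.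
by ring.
Qed.

Lemma heat_decomposition t N f : 0 < t -> lev N f ->
  heat t f = (fun x => E mu 0 f x + \sum_(0 <= n < N) edecay s t n.+1 * increment n f x).
Proof.
move=> t0 fN; rewrite [in LHS](lev_decomposition fN).
have fi := lev_intg mu fN; have ii n := lev_intg mu (@lev_increment n f).
rewrite heatD//; [|exact: E_intg|by apply: intg_sum].
rewrite heat_lev0//.
rewrite heat_sum//; apply/funext => x; congr (_ + _); apply: eq_bigr => n _.
by rewrite (heat_eigen t0 (@lev_increment n f) (E_increment n fi)).
Qed.

(** Both sides multiply each increment by the same exponential. *)
Lemma heat_semigroup t u N f : 0 < t -> 0 < u -> lev N f ->
  heat (t + u) f = heat t (heat u f).
Proof.
move=> t0 u0 fN; have fi := lev_intg mu fN; have ii n := lev_intg mu (@lev_increment n f).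
rewrite [in RHS](heat_decomposition u0 fN) (heat_decomposition (addr_gt0 t0 u0) fN).
rewrite heatD//; [|exact: E_intg|by apply: intg_sum => n _; exact: intgZ].
rewrite heat_lev0//.
rewrite heat_sum//; last by move=> n _; exact: intgZ.
apply/funext => x; congr (_ + _); apply: eq_bigr => n _.
rewrite heatZ// (heat_eigen t0 (@lev_increment n f) (E_increment n fi)) edecayD.
by ring.
Qed.

End kernel.

(** * Density of the locally constant functions *)

Section density.
Import HBSimple HBNNSimple.
Variables (R : realType) (mu : probability C3 R).
Hypothesis muP : is_mu mu.
Implicit Types f g h : C3 -> R.
Local Notation L2 := (Lfun mu 2%:E).
Local Notation nrm := (nrm mu).

Lemma lev_L2 n f : lev n f -> f \in L2.
Proof. by move=> /lev_bm; exact: bm_L2. Qed.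

Definition approximable f := f \in L2 /\
  forall e : R, 0 < e -> exists n g, lev n g /\ nrm (fun x => f x - g x) < e.

Lemma approximable_limit f : f \in L2 ->
  (forall e : R, 0 < e -> exists g, approximable g /\ nrm (fun x => f x - g x) < e) ->
  approximable f.
Proof.
move=> f2 H; split => // e e0; have e20 : 0 < e / 2 by rewrite divr_gt0.
have [g [[g2 Hg] fg]] := H _ e20; have [n [h [hn gh]]] := Hg _ e20.
exists n, h; split => //; apply: le_lt_trans (nrm_dist f2 g2 (lev_L2 hn)) _.
by rewrite [ltRHS]splitr ltrD.
Qed.

Lemma lev_approximable n f : lev n f -> approximable f.
Proof.
move=> fn; split; first exact: lev_L2 fn.
by move=> e e0; exists n, f; split => //; rewrite ae_nrm_sub ?(lev_L2 fn)//; exact: aeW.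
Qed.

Lemma approximableD f g : approximable f -> approximable g -> approximable (fun x => f x + g x).
Proof.
move=> [f2 Hf] [g2 Hg]; split; first exact: L2D.
move=> e e0; have e20 : 0 < e / 2 by rewrite divr_gt0.
have [n [f' [fn ff']]] := Hf _ e20; have [m [g' [gm gg']]] := Hg _ e20.
exists (maxn n m), (fun x => f' x + g' x); split.
  apply: (@lev_op2 _ _ _ +%R _ f' g'); first exact: lev_le (leq_maxl _ _) fn.
  exact: lev_le (leq_maxr _ _) gm.
have := nrmD (L2B f2 (lev_L2 fn)) (L2B g2 (lev_L2 gm)).
rewrite (_ : (fun x => f x - f' x + (g x - g' x)) = (fun x => f x + g x - (f' x + g' x))).
  by move=> /le_lt_trans; apply; rewrite [ltRHS]splitr ltrD.
by apply/funext => x; ring.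
Qed.

Lemma approximableZ c f : approximable f -> approximable (fun x => c * f x).
Proof.
move=> [f2 Hf]; split; first exact: L2Z.
move=> e e0; have c0 : 0 < `|c| + 1 by rewrite ltr_wpDl.
have [n [g [gn fg]]] := Hf (e / (`|c| + 1)) (divr_gt0 e0 c0).
exists n, (fun x => c * g x); split; first exact: (@lev_comp _ _ ( *%R c) n g gn).
rewrite (_ : (fun x => c * f x - c * g x) = (fun x => c * (f x - g x))); last first.
  by apply/funext => x; ring.
rewrite nrmZ; last exact: (L2B f2 (lev_L2 gn)).
rewrite (@le_lt_trans _ _ ((`|c| + 1) * nrm (fun x => f x - g x)))//.
  by rewrite ler_wpM2r ?nrm_ge0// lerDl.
by rewrite mulrC -ltr_pdivlMr.
Qed.

Lemma approximable_sum (I : Type) (r : seq I) (P : pred I) (f : I -> C3 -> R) :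
  (forall i, P i -> approximable (f i)) ->
  approximable (fun x => \sum_(i <- r | P i) f i x).
Proof.
move=> H; elim: r => [|i r IH].
  rewrite (_ : (fun _ => _) = cst 0); first exact: (@lev_approximable 0).
  by apply/funext => x; rewrite big_nil.
have [Pi|nPi] := boolP (P i).
  rewrite (_ : (fun _ => _) = (fun x => f i x + \sum_(i <- r | P i) f i x)).
    exact: approximableD (H i Pi) IH.
  by apply/funext => x; rewrite big_cons Pi.
rewrite (_ : (fun _ => _) = (fun x => \sum_(i <- r | P i) f i x))//.
by apply/funext => x; rewrite big_cons (negbTE nPi).
Qed.

Lemma sqnorm_indic A : measurable A -> sqnorm mu (\1_A) = fine (mu A).
Proof.
move=> mA; rewrite -mean_indic//; apply: eq_Rintegral => x _.
by rewrite indicE; case: (_ \in _); rewrite ?mulr1 ?mulr0.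
Qed.

Lemma approximable_indic A : measurable A -> approximable (\1_A).
Proof.
move: A; apply: C3_induction.
- by rewrite indic0; exact: (@lev_approximable 0).
- by move=> v; exact: lev_approximable (@lev_indic _ v).
- move=> A mA HA; rewrite (_ : \1_(~` A) = (fun x => 1 + (-1) * \1_A x)).
    by apply: approximableD; [exact: (@lev_approximable 0)|exact: approximableZ].
  apply/funext => x; rewrite !indicE in_setC; case: (_ \in _) => /=; by ring.
move=> F mF tF HF.
have mU : measurable (\bigcup_k F k) by exact: bigcup_measurable.
apply: approximable_limit; first by apply: bm_L2; exact: bm_indic.
move=> e e0; have e2 : 0 < e ^+ 2 by rewrite exprn_gt0.
have [N HN] := bigcup_tail mu mF e2; set S := \bigcup_(k < N) F k.
have mS : measurable S by exact: bigcup_measurable.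
have SU : S `<=` \bigcup_k F k by move=> x [k _ Fx]; exists k.
exists (\1_S); split.
  by rewrite indic_bigcup_ord//; apply: approximable_sum => k _.
rewrite -(indic_setDl R SU).
rewrite -ltr_sqr ?nnegrE ?nrm_ge0 ?(ltW e0)// sqr_nrm sqnorm_indic//.
exact: measurableD.
Qed.

(** A nonnegative function is the limit in L^2 of simple functions, by dominated convergence, and the
indicator functions are dealt with by induction on the Borel set. *)
Lemma L2_approximable f : f \in L2 -> approximable f.
Proof.
wlog f0 : f / forall x, 0 <= f x => [H f2|f2].
  have mf := L2_measurable f2.
  have bnd h : measurable_fun setT h -> (forall x, `|h x| <= `|f x|) -> h \in L2.
    move=> mh hf; apply/L2P; split => //.
    apply: (@le_integrable _ _ _ mu setT measurableT _ (EFin \o (fun x => f x * f x))).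
    - by apply/measurable_EFinP; exact: measurable_funX.
    - by move=> x _; rewrite /= lee_fin -expr2 !normrX ler_pXn2r ?nnegrE.
    - exact: L2M.
  rewrite (_ : f = (fun x => Num.max (f x) 0 + (-1) * Num.max (- f x) 0)); last first.
    by apply/funext => x; have [?|?] := leP (f x) 0; have [?|?] := leP (- f x) 0; lra.
  apply: approximableD; [|apply: approximableZ].
    apply: H => [x|]; first by rewrite le_max lexx orbT.
    apply: bnd; first by apply: measurable_funTS; exact: measurable_maxr.
    by move=> x; have [?|?] := leP (f x) 0; rewrite ?normr0.
  apply: H => [x|]; first by rewrite le_max lexx orbT.
  apply: bnd; first by apply: measurable_maxr => //; exact: measurable_funN.
  by move=> x; have [?|?] := leP (- f x) 0; rewrite ?normr0 ?normrN.
have mf := L2_measurable f2; have mfE := (measurable_EFinP setT f).2 mf.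
pose p := nnsfun_approx measurableT mfE.
have pf (x : C3) : (fun n => p n x) @ \oo --> f x.
  have := cvg_nnsfun_approx measurableT mfE (fun x _ => (f0 x : (0 <= (f x)%:E)%E)) (x:=x) I.
  by move/fine_cvg.
have ple n (x : C3) : p n x <= f x.
  rewrite -(cvg_lim _ (pf x))//; apply: nondecreasing_cvgn_le; last by apply/cvg_ex; eexists; exact: pf.
  move=> i j ij; have := nd_nnsfun_approx measurableT mfE ij => /lefP; exact.
have p0 n (x : C3) : 0 <= p n x by exact: fun_ge0.
have bp n : measurable_fun setT (p n) by [].
have ap n : approximable (p n).
  rewrite (funext (fimfunEord (p n))).
  apply: approximable_sum => i _; apply: approximableZ; apply: approximable_indic.
  by rewrite -[X in measurable X]setTI; apply: bp.
apply: approximable_limit => // e e0.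
have bfp n (x : C3) : 0 <= f x - p n x <= f x by rewrite subr_ge0 ple/= gerBl.
have mfp n : measurable_fun setT (fun x => (f x - p n x) * (f x - p n x)).
  by apply: measurable_funM; apply: measurable_funB.
have h1 : {ae mu, forall x, [set: C3] x ->
    (fun n => ((f x - p n x) * (f x - p n x))%:E) @ \oo --> (cst 0%E : C3 -> \bar R) x}.
  apply: aeW => x _; apply: cvg_EFin; first exact: nearW.
  rewrite /= -[X in _ --> X](mulr0 (0 : R)).
  by apply: cvgM; rewrite -(subrr (f x)); apply: cvgB; [exact: cvg_cst|exact: pf|exact: cvg_cst|exact: pf].
have h2 : {ae mu, forall x (n : nat), [set: C3] x ->
    (`|((f x - p n x) * (f x - p n x))%:E| <= (f x * f x)%:E)%E}.
  apply: aeW => x n _; rewrite /= lee_fin normrM; have /andP[d0 d1] := bfp n x.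
  by rewrite ger0_norm// ler_pM.
have [_ _ cv] := @dominated_convergence _ _ _ mu setT measurableT
  (fun n x => ((f x - p n x) * (f x - p n x))%:E) (cst 0%E) (fun x => (f x * f x)%:E)
  (fun n => (measurable_EFinP setT _).2 (mfp n)) (measurable_cst _) h1 (L2M f2 f2) h2.
have ip n : (fun x => f x - p n x) \in L2 by apply: L2B => //; case: (ap n).
have {}cv : (fun n => sqnorm mu (fun x => f x - p n x)) @ \oo --> (0 : R).
  apply: (@fine_cvg _ _ _ _ (fun n => _) 0).
  rewrite integral_cst// mul0e in cv.
  by apply: cv.
have e2 : 0 < e ^+ 2 by rewrite exprn_gt0.
have /cvgrPdist_lt/(_ _ e2)[N _ /(_ N (leqnn N))] := cv.
rewrite sub0r normrN ger0_norm ?sqnorm_ge0// => HN.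
by exists (p N); split => //; rewrite -ltr_sqr ?nnegrE ?nrm_ge0 ?ltW// sqr_nrm.
Qed.

End density.

(** * Identification of the semigroup *)

(** Compares one short step of the semigroup with its generator. *)
Lemma exp_second_order (R : realType) (x : R) : 0 <= x -> `|expR (- x) - (1 - x)| <= x ^+ 2.
Proof.
move=> x0; have H1 := expR_ge1Dx (- x); rewrite ger0_norm; last by lra.
have H2 := expR_ge1Dx x; have e0 := expR_gt0 x.
have H3 : expR (- x) * (1 + x) <= 1.
  by rewrite expRN mulrC ler_pdivrMr// mul1r.
have : expR (- x) <= 1 by rewrite expR_le1 oppr_le0.
have := expR_gt0 (- x); nra.
Qed.

Section semigroup.
Variables (R : realType) (mu : probability C3 R) (nu : probability choice_space R).
Variables (s : R) (T : R -> (C3 -> R) -> (C3 -> R)).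
Hypotheses (muP : is_mu mu) (nuP : is_nu mu nu) (sP : s < s0 + 2).
Hypothesis TP : is_heat_semigroup mu nu s T.
Implicit Types f g h : C3 -> R.
Local Notation L2 := (Lfun mu 2%:E).
Local Notation nrm := (nrm mu).

Lemma T_L2 t f : 0 <= t -> f \in L2 -> T t f \in L2.
Proof. by case: TP => H _ _ _ _ t0 f2; case: (H t f t0 f2). Qed.

Lemma T_nrm t f : 0 <= t -> f \in L2 -> nrm (T t f) <= nrm f.
Proof. by case: TP => H _ _ _ _ t0 f2; rewrite ler_wsqrtr//; case: (H t f t0 f2). Qed.

Lemma T_lin t a f g : 0 <= t -> f \in L2 -> g \in L2 ->
  {ae mu, forall x, T t (fun y => a * f y + g y) x = a * T t f x + T t g x}.
Proof. by case: TP => _ H _ _ _; exact: H. Qed.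

Lemma T_add t u f : 0 <= t -> 0 <= u -> f \in L2 ->
  {ae mu, forall x, T (t + u) f x = T t (T u f) x}.
Proof. by case: TP => _ _ [_ H] _ _; exact: H. Qed.

Lemma T_dist t f g : 0 <= t -> f \in L2 -> g \in L2 ->
  nrm (fun x => T t f x - T t g x) <= nrm (fun x => f x - g x).
Proof.
move=> t0 f2 g2.
rewrite (_ : (fun x => f x - g x) = (fun x => (-1) * g x + f x)); last first.
  by apply/funext => x; ring.
have h2 : (fun x => (-1) * g x + f x) \in L2 by apply: L2D => //; exact: L2Z.
apply: le_trans (T_nrm t0 h2); rewrite le_eqVlt; apply/orP; left; apply/eqP.
apply: ae_nrm; [by apply: L2B; exact: T_L2|exact: T_L2|].
by apply: filterS (T_lin (-1) t0 g2 f2) => x ->; ring.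
Qed.

Lemma ae_of_nrm f g : f \in L2 -> g \in L2 -> nrm (fun x => f x - g x) = 0 ->
  {ae mu, forall x, f x = g x}.
Proof.
move=> f2 g2 /(nrm0_ae (L2B f2 g2)); apply: filterS => x /eqP.
by rewrite subr_eq0 => /eqP.
Qed.

Lemma T_ae t f g : 0 <= t -> f \in L2 -> g \in L2 -> {ae mu, forall x, f x = g x} ->
  {ae mu, forall x, T t f x = T t g x}.
Proof.
move=> t0 f2 g2 fg; apply: ae_of_nrm; [exact: T_L2..|].
apply/le_anti; rewrite nrm_ge0 andbT.
by rewrite (le_trans (T_dist t0 f2 g2))// ae_nrm_sub.
Qed.

Lemma T_scale t c f : 0 <= t -> f \in L2 ->
  {ae mu, forall x, T t (fun y => c * f y) x = c * T t f x}.
Proof.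
move=> t0 f2; have z2 : (cst 0 : C3 -> R) \in L2 by exact/bm_L2/bm_cst.
have Tz : {ae mu, forall x, T t (cst 0) x = 0}.
  have := T_lin 1 t0 z2 z2.
  rewrite (_ : (fun _ => _) = cst 0); last by apply/funext => x; rewrite /=; ring.
  by apply: filterS => x /=; lra.
have := T_lin c t0 f2 z2.
rewrite (_ : (fun _ => _) = (fun y => c * f y)); last by apply/funext => x; rewrite /=; ring.
by apply: filterS2 Tz => x -> ->; rewrite addr0.
Qed.

Lemma T_sum t f (h : nat -> C3 -> R) N : 0 <= t -> f \in L2 -> (forall n, h n \in L2) ->
  {ae mu, forall x, T t (fun y => f y + \sum_(0 <= n < N) h n y) x =
    T t f x + \sum_(0 <= n < N) T t (h n) x}.
Proof.
move=> t0 f2 h2; elim: N => [|N IH].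
  rewrite (_ : (fun _ => _) = f); last by apply/funext => x; rewrite big_geq// addr0.
  by apply: aeW => x; rewrite big_geq// addr0.
have g2 : (fun y => f y + \sum_(0 <= n < N) h n y) \in L2 by apply: L2D => //; exact: L2_sum.
have := T_lin 1 t0 (h2 N) g2.
rewrite (_ : (fun y => f y + \sum_(0 <= n < N.+1) h n y) =
   (fun y => 1 * h N y + (f y + \sum_(0 <= n < N) h n y))); last first.
  by apply/funext => x; rewrite big_nat_recr//=; ring.
by apply: filterS2 IH => x H ->; rewrite H big_nat_recr//=; ring.
Qed.

Lemma Espan_lev f : Espan f -> exists N, lev N f.
Proof.
move=> [l ->]; elim: l => [|[a v] l [N IH]].
  by exists 0%N => x y _; rewrite !big_nil.
exists (maxn (size v) N) => x y e; rewrite !big_cons; congr (_ + _).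
  by rewrite /= (lev_indic R (pre_le (leq_maxl _ _) e)).
by apply: IH; apply: pre_le e; exact: leq_maxr.
Qed.

Lemma lev_Espan N f : lev N f -> Espan f.
Proof.
move=> fN; exists [seq (f (pt w), tval w) | w : N.-tuple bool].
apply/funext => x; rewrite (lev_expand fN) big_map big_enum/=.
by apply: eq_bigr.
Qed.

Lemma lev_form_approx N f : lev N f -> form_approx mu nu s (fun=> f) f.
Proof.
move=> fN; have z : f \- f = cst 0 by apply/funext => x; rewrite /= subrr.
split.
- by move=> _; exact: lev_Espan fN.
- rewrite z (_ : (fun _ => _) = cst 0); first exact: cvg_cst.
  apply/funext => n; rewrite /sqnorm /inner; under eq_Rintegral do rewrite mulr0.
  by rewrite mean_cst.
- move=> e e0; exists 0%N => m n _ _.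
  by rewrite z (Q_const muP nuP s (N := 0)).
Qed.

(** An eigenvector of the form is an eigenvector of the operator, because the form is
continuous in its second argument. *)
Lemma Delta_eigen N h (l : R) : lev N h ->
  (forall M g, lev M g -> Q nu s h g = l * inner mu h g) ->
  Delta mu nu s h (fun x => - l * h x).
Proof.
move=> hN Ql; have h2 := lev_L2 mu hN; split.
- by split => //; exists (fun=> h); exact: lev_form_approx hN.
- exact: L2Z.
- move=> g [g2 [gn gnP]]; exists (fun=> h), gn; split; [exact: lev_form_approx hN|exact: gnP|].
  case: gnP => gnE gng _.
  rewrite (innerZl (- l) h2 g2) mulNr opprK.
  have levgn n : gn n \in L2 by have [M gM] := Espan_lev (gnE n); exact: lev_L2 gM.
  have QE n : Q nu s h (gn n) = l * inner mu h (gn n).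
    by have [M gM] := Espan_lev (gnE n); exact: Ql gM.
  under eq_fun do rewrite QE.
  apply: cvgM; first exact: cvg_cst.
  apply/(@cvgrPdist_le _ R^o) => e e0.
  have n1 : 0 < nrm h + 1 by rewrite ltr_wpDl ?nrm_ge0.
  have d0 : 0 < (e / (nrm h + 1)) ^+ 2 by rewrite exprn_gt0// divr_gt0.
  move/cvgrPdist_lt : gng => /(_ _ d0); apply: filterS => n.
  rewrite sub0r normrN ger0_norm ?sqnorm_ge0// -sqr_nrm.
  rewrite ltr_sqr ?nnegrE ?nrm_ge0 ?divr_ge0// ?(ltW e0) ?(ltW n1)// => H.
  rewrite (innerC mu h g) (innerC mu h (gn n)) -innerBl// innerC.
  have := ler_inner h2 (L2B g2 (levgn n)); rewrite nrm_distC => /le_trans; apply.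
  rewrite (@le_trans _ _ ((nrm h + 1) * (e / (nrm h + 1))))//; last first.
    by rewrite mulrC divfK// gt_eqF.
  by apply: ler_pM; rewrite ?nrm_ge0// ?lerDl ?ler01// ltW.
Qed.

(** The error after [k] steps of length [u] is at most [k] times the error of one step,
because the semigroup is contractive; and the error of one step is [o(u)]. *)
Lemma T_eigen h (l : R) t : h \in L2 -> 0 <= l -> Delta mu nu s h (fun x => - l * h x) ->
  0 < t -> {ae mu, forall x, T t h x = expR (- (t * l)) * h x}.
Proof.
move=> h2 l0 Dh t0; have eh2 u : (fun x => expR (- (u * l)) * h x) \in L2 by exact: L2Z.
apply: ae_of_nrm => //; first exact/T_L2/h2/ltW.
pose rho u := nrm (fun x => T u h x - expR (- (u * l)) * h x).
(* After [k] steps of length [u], the error is at most [k] times that of one step. *)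
have steps u k : 0 < u ->
    nrm (fun x => T (k%:R * u) h x - expR (- (k%:R * u * l)) * h x) <= k%:R * rho u.
  move=> u0; elim: k => [|k IH].
    rewrite !mul0r oppr0 expR0 ae_nrm_sub//; first exact: T_L2.
      by apply: L2Z.
    case: TP => _ _ [H _] _ _; apply: filterS (H h h2) => x ->; by rewrite mul1r.
  have ku : 0 <= k%:R * u by rewrite mulr_ge0// ltW.
  have u0' := ltW u0.
  have f2 : T (k%:R * u) h \in L2 by exact: T_L2.
  have g2 := eh2 (k%:R * u).
  set a := expR (- (k%:R * u * l)) in g2 IH.
  have a0 : 0 <= a by exact: expR_ge0.
  have a1 : a <= 1 by rewrite expR_le1 oppr_le0 mulr_ge0.
  have aE : expR (- (k.+1%:R * u * l)) = a * expR (- (u * l)).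
    by rewrite /a -expRD; congr expR; rewrite -natr1; ring.
  have tE : k.+1%:R * u = u + k%:R * u by rewrite -natr1; ring.
  have Tf2 := T_L2 u0' f2; have Tg2 := T_L2 u0' g2; have Th2 := T_L2 u0' h2.
  rewrite aE (ae_nrm (g := fun x => T u (T (k%:R * u) h) x - a * (expR (- (u * l)) * h x))).
  - apply: le_trans (nrm_dist Tf2 Tg2 (L2Z a (eh2 u))) _.
    rewrite -natr1 mulrDl mul1r; apply: lerD; first exact: le_trans (T_dist u0' f2 g2) IH.
    rewrite (ae_nrm (g := fun x => a * (T u h x - expR (- (u * l)) * h x))).
    + rewrite nrmZ; last exact: L2B.
      by rewrite ger0_norm// ler_piMl// nrm_ge0.
    + by apply: L2B => //; exact: L2Z.
    + by apply: L2Z; exact: L2B.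
    + by apply: filterS (T_scale a u0' h2) => x ->; ring.
  - by apply: L2B; [rewrite tE; apply: T_L2 => //; rewrite addr_ge0|exact: L2Z].
  - by apply: L2B => //; exact: L2Z.
  - by rewrite tE; apply: filterS (T_add u0' ku h2) => x ->; ring.
(* The error of one step is [o(u)], since [h] is in the domain of the generator. *)
have small (e : R) : 0 < e -> exists2 d, 0 < d & forall u, 0 < u -> u < d -> rho u <= e * u.
  move=> e0; case: TP => _ _ _ _ gen.
  have mh2 : (fun x => - l * h x) \in L2 by exact: L2Z.
  have [/(_ Dh) cv _] := gen h _ h2 mh2.
  have e20 : 0 < e / 2 by rewrite divr_gt0.
  have e2 : 0 < (e / 2) ^+ 2 by rewrite exprn_gt0.
  move/cvgrPdist_lt : cv => /(_ _ e2)[d /= d0 Hd].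
  have K0 : 0 < l ^+ 2 * nrm h + 1 by rewrite ltr_wpDl// mulr_ge0 ?sqr_ge0 ?nrm_ge0.
  exists (Num.min d (e / 2 / (l ^+ 2 * nrm h + 1))); first by rewrite lt_min d0 divr_gt0.
  move=> u u0; rewrite lt_min => /andP[ud]; rewrite ltr_pdivlMr// => uK.
  have /(_ _ u0) := Hd u; rewrite /ball_/= !sub0r !normrN gtr0_norm// => /(_ ud).
  rewrite ger0_norm ?sqnorm_ge0// -sqr_nrm.
  have u0' := ltW u0; have Th2 := T_L2 u0' h2.
  set q := (fun x => _ - _); have q2 : q \in L2.
    by apply: L2B => //; apply: L2Z; exact: L2B.
  rewrite ltr_sqr ?nnegrE ?nrm_ge0 ?(ltW e20)// => Hq.
  have D2 : (fun x => (1 - u * l - expR (- (u * l))) * h x) \in L2 by exact: L2Z.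
  rewrite /rho (_ : (fun x => _) = (fun x => u * q x + (1 - u * l - expR (- (u * l))) * h x)).
    apply: le_trans (nrmD (L2Z u q2) D2) _.
    rewrite !nrmZ// gtr0_norm// [leRHS](_ : _ = u * (e / 2) + e / 2 * u); last by field.
    apply: lerD; first by rewrite ler_wpM2l// ltW.
    have ul0 : 0 <= u * l by rewrite mulr_ge0.
    have := exp_second_order ul0; rewrite distrC => H.
    apply: (@le_trans _ _ ((u * l) ^+ 2 * nrm h)); first by rewrite ler_wpM2r ?nrm_ge0.
    by move: (nrm_ge0 mu h) uK u0; rewrite exprMn; nra.
  by apply/funext => x; rewrite /q; field; rewrite gt_eqF.
apply/le_anti; rewrite nrm_ge0 andbT; apply/ler_addgt0Pr => e e0; rewrite add0r.
have et0 : 0 < e / t by rewrite divr_gt0.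
have [d d0 Hd] := small _ et0.
have [k tk] : exists k : nat, t / k.+1%:R < d.
  exists (Num.truncn (t / d)); rewrite ltr_pdivrMr// mulrC -ltr_pdivrMr//.
  exact: truncnS_gt.
have k0 : 0 < k.+1%:R :> R by rewrite ltr0n.
have tk0 : 0 < t / k.+1%:R by rewrite divr_gt0.
have := steps (t / k.+1%:R) k.+1 tk0.
have -> : k.+1%:R * (t / k.+1%:R) = t by rewrite mulrC divfK// gt_eqF.
move=> /le_trans; apply.
have := ler_wpM2l (ltW k0) (Hd _ tk0 tk).
have -> : k.+1%:R * (e / t * (t / k.+1%:R)) = e by field; rewrite !gt_eqF.
by [].
Qed.

(** Both sides act on the constant part and on the increments of [f] by the same exponentials. *)
Lemma T_lev t N f : 0 < t -> lev N f -> {ae mu, forall x, T t f x = heat s mu t f x}.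
Proof.
move=> t0 fN; have t0' := ltW t0; have fi := lev_intg mu fN.
have f0l : lev 0 (E mu 0 f) by exact: lev_E.
have i2 n : increment mu n f \in L2 by apply: lev_L2 (@lev_increment _ mu n f).
have const : {ae mu, forall x, T t (E mu 0 f) x = E mu 0 f x}.
  have D0 : Delta mu nu s (E mu 0 f) (fun x => - 0 * E mu 0 f x).
    by apply: (Delta_eigen f0l) => M g gM; rewrite (Q_const muP nuP s f0l gM) mul0r.
  apply: filterS (T_eigen (lev_L2 mu f0l) (lexx 0) D0 t0) => x ->.
  by rewrite mulr0 oppr0 expR0 mul1r.
have inc n : {ae mu, forall x, T t (increment mu n f) x = edecay s t n.+1 * increment mu n f x}.
  have ln := @lev_increment _ mu n f; have E0 := E_increment muP n fi.
  have D0 : Delta mu nu s (increment mu n f) (fun x => - lambda s n.+1 * increment mu n f x).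
    by apply: (Delta_eigen ln) => M g gM; exact: (Q_eigen muP nuP s ln E0 gM).
  exact: (T_eigen (i2 n) (lambda_ge0 sP _) D0 t0).
rewrite (heat_decomposition sP muP t0 fN).
have := T_sum N t0' (lev_L2 mu f0l) i2; rewrite -(lev_decomposition muP fN).
have incs : {ae mu, forall x, forall n, T t (increment mu n f) x = edecay s t n.+1 * increment mu n f x}.
  exact/ae_foralln.
move: const incs; apply: filterS3 => x H1 H2 ->; rewrite H1; congr (_ + _).
by apply: eq_bigr => n _.
Qed.

End semigroup.

(** * The heat kernel is the kernel of the semigroup *)

Section product.
Variables (R : realType) (mu : probability C3 R).
Implicit Types f g h : C3 -> R.

Definition mu2 : probability (C3 * C3)%type R := (mu \x mu)%E.

Lemma intg_tensor f g : intg mu f -> intg mu g -> intg mu2 (fun z => f z.1 * g z.2).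
Proof.
move=> fi gi; have mf := intg_measurable fi; have mg := intg_measurable gi.
have mfg : measurable_fun setT (fun z : C3 * C3 => f z.1 * g z.2).
  by apply: measurable_funM; apply: measurableT_comp.
apply/(integrable12ltyP mu mu _).2; first exact/measurable_EFinP.
have nfi : intg mu (fun x => `|f x|) by exact: integrable_norm.
have ngi : intg mu (fun x => `|g x|) by exact: integrable_norm.
rewrite (eq_integral (fun x => (`|f x| * \int[mu]_y `|g y|)%:E)).
  by apply: integrable_lty => //; apply: (eq_intg _ (intgZ (\int[mu]_y `|g y|) nfi)) => x; rewrite mulrC.
move=> x _ /=; under eq_integral do rewrite normrM.
by rewrite (EFin_mean (intgZ _ ngi)) meanZ.
Qed.

Lemma fubini_mean (F : C3 * C3 -> R) : intg mu2 F ->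
  (forall x, intg mu (fun y => F (x, y))) ->
  intg mu (fun x => \int[mu]_y F (x, y)) /\
  \int[mu]_x \int[mu]_y F (x, y) = \int[mu2]_z F z.
Proof.
move=> Fi Fx.
have e : (EFin \o (fun x => \int[mu]_y F (x, y))) = fubini_F mu (EFin \o F).
  by apply/funext => x; rewrite /fubini_F /= -EFin_mean.
split; first by rewrite /intg e; exact: integrable_fubini_F.
have := integral12_prod_meas1 Fi; rewrite -e => H.
by rewrite /Rintegral -H.
Qed.

Lemma mean_tensor f g : bm f -> bm g ->
  \int[mu2]_z (f z.1 * g z.2) = (\int[mu]_x f x) * (\int[mu]_y g y).
Proof.
move=> bf bg; have [fi gi] := (bm_intg mu bf, bm_intg mu bg).
have [_ <-] := fubini_mean (intg_tensor fi gi) (fun x => intgZ (f x) gi).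
under eq_Rintegral do rewrite /= meanZ//.
by under eq_Rintegral do rewrite mulrC; rewrite meanZ// mulrC.
Qed.

End product.

Section heat_kernel.
Variables (R : realType) (mu : probability C3 R) (nu : probability choice_space R).
Variables (s : R) (T : R -> (C3 -> R) -> (C3 -> R)).
Hypotheses (muP : is_mu mu) (nuP : is_nu mu nu) (sP : s < s0 + 2).
Hypothesis TP : is_heat_semigroup mu nu s T.
Implicit Types f g h : C3 -> R.
Local Notation L2 := (Lfun mu 2%:E).
Local Notation nrm := (nrm mu).
Local Notation mu2 := (mu2 mu).
Local Notation kern := (kern s).
Local Notation heat := (heat s mu).

Section fixed_time.
Variable t : R.
Hypothesis t0 : 0 < t.

Lemma intg_pairing f g : intg mu f -> intg mu g -> intg mu2 (fun z => f z.1 * kern t z * g z.2).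
Proof.
move=> fi gi; apply: (eq_intg _ (bm_intgM (bm_kern sP t0) (intg_tensor fi gi))) => z.
by rewrite /=; ring.
Qed.

Lemma heat_le : exists2 C, 0 <= C & forall g, intg mu g -> forall x,
  `|heat t g x| <= C * \int[mu]_y `|g y|.
Proof.
have [_ [C kC]] := bm_kern sP t0; exists C; first by apply: le_trans (kC (point, point)).
move=> g gi x; have ng : intg mu (fun y => `|g y|) by exact: integrable_norm.
rewrite -meanZ//; apply: ler_norm_mean; [exact: kern_intg|exact: intgZ|].
by move=> y; rewrite normrM ler_wpM2r.
Qed.

Lemma heat_bm g : intg mu g -> bm (heat t g).
Proof.
move=> gi; have [C _ kC] := heat_le; split; last by eexists; exact: kC.
have k1 : intg mu (cst 1) by apply: bm_intg; exact: bm_cst.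
have Fi : intg mu2 (fun z => kern t z * g z.2).
  by apply: (eq_intg _ (intg_pairing k1 gi)) => z; rewrite /= mul1r.
have [hi _] := fubini_mean Fi (fun x => kern_intg sP t0 x gi).
exact: intg_measurable hi.
Qed.

Lemma heat_nrm : exists2 C, 0 <= C & forall g, g \in L2 -> nrm (heat t g) <= C * nrm g.
Proof.
have [C C0 kC] := heat_le; exists C => // g g2; have gi := L2_intg g2.
apply: nrm_bound; [exact: heat_bm|by rewrite mulr_ge0 ?nrm_ge0|move=> x].
apply: le_trans (kC g gi x) _; rewrite ler_wpM2l//.
have a2 : (fun y => `|g y|) \in L2.
  apply/L2P; split; first by apply: measurableT_comp => //; exact: L2_measurable g2.
  by apply: (eq_intg _ (L2M g2 g2)) => y; rewrite /= real_normK ?num_real// expr2.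
have an : nrm (fun y => `|g y|) = nrm g.
  by congr Num.sqrt; apply: eq_Rintegral => y _; rewrite -!expr2 real_normK ?num_real.
have o2 : (cst 1 : C3 -> R) \in L2 by exact/bm_L2/bm_cst.
have n1 : nrm (cst 1) <= 1.
  by apply: nrm_bound => //; [exact: bm_cst|move=> y; rewrite /= normr1].
have := ler_inner o2 a2; rewrite an => /(le_trans (ler_norm _)) H.
rewrite -[leRHS]mul1r; apply: (le_trans (le_trans _ H)); last by rewrite ler_wpM2r ?nrm_ge0.
by rewrite le_eqVlt; apply/orP; left; apply/eqP/eq_Rintegral => y _; rewrite mul1r.
Qed.

(** Both operators are continuous on L^2 and they agree on a dense subspace. *)
Lemma T_heat g : g \in L2 -> {ae mu, forall x, T t g x = heat t g x}.
Proof.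
move=> g2; have gi := L2_intg g2; have t0' := ltW t0.
have h2 f : intg mu f -> heat t f \in L2 by move=> fi; apply: bm_L2; exact: heat_bm.
have [C C0 HC] := heat_nrm.
apply: ae_of_nrm; [exact: (T_L2 TP)|exact: h2|].
apply/le_anti; rewrite nrm_ge0 andbT; apply/ler_addgt0Pr => e e0; rewrite add0r.
have C1 : 0 < C + 1 by rewrite ltr_wpDl.
have [_ /(_ (e / (C + 1)) (divr_gt0 e0 C1))[N [f [fN fe]]]] := L2_approximable g2.
have f2 := lev_L2 mu fN; have fi := lev_intg mu fN.
apply: (le_trans (nrm_dist (T_L2 TP t0' g2) (T_L2 TP t0' f2) (h2 _ gi))).
have -> : nrm (fun x => T t f x - heat t g x) = nrm (heat t (fun x => f x - g x)).
  apply: ae_nrm; [by apply: L2B; [exact: (T_L2 TP)|exact: h2]|by apply/h2/intgB|].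
  apply: filterS (T_lev muP nuP sP TP t0 fN) => x ->.
  rewrite -meanB; [|exact: kern_intg..].
  by apply: eq_Rintegral => y _; rewrite mulrBr.
apply: (@le_trans _ _ ((C + 1) * nrm (fun x => g x - f x))).
  rewrite mulrDl mul1r addrC; apply: lerD; last exact: (T_dist TP).
  by rewrite (nrm_distC mu g f); apply: HC; exact: L2B.
by rewrite -ler_pdivlMl// mulrC ltW.
Qed.

Lemma kern_is_heat_kernel : is_heat_kernel mu T t (kern t).
Proof.
split; first exact: measurable_kern.
move=> f g f2 g2; have [fi gi] := (L2_intg f2, L2_intg g2).
have i := intg_pairing fi gi; split; first exact: i.
have gx x : intg mu (fun y => f x * kern t (x, y) * g y).
  by apply: (eq_intg _ (intgZ (f x) (kern_intg sP t0 x gi))) => y; rewrite mulrA.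
have [_ <-] := fubini_mean i gx.
have hg2 : heat t g \in L2 by apply: bm_L2; exact: heat_bm.
rewrite (ae_inner (T_L2 TP (ltW t0) g2) hg2 f2 (T_heat g2)).
apply: eq_Rintegral => x _; rewrite -meanZ; last exact: kern_intg.
by apply: eq_Rintegral => y _; rewrite mulrA.
Qed.

(** A kernel is determined by its integrals over measurable rectangles. *)
Lemma heat_kernel_unique K : is_heat_kernel mu T t K -> {ae mu2, forall z, K z = kern t z}.
Proof.
move=> KP; have kP := kern_is_heat_kernel.
have o2 : (cst 1 : C3 -> R) \in L2 by exact/bm_L2/bm_cst.
have intK J : is_heat_kernel mu T t J -> intg mu2 J.
  by move=> [_ /(_ _ _ o2 o2)[i _]]; apply: (eq_intg _ i) => z; rewrite /= mul1r mulr1.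
have [Ki ki] := (intK _ KP, intK _ kP).
have Di := intgB Ki ki.
have rect A B : measurable A -> measurable B ->
    (\int[mu2]_(z in A `*` B) (K z - kern t z)%:E = 0)%E.
  move=> mA mB; have mAB : measurable (A `*` B) by exact: measurableX.
  have i2 A' : measurable A' -> (\1_A' : C3 -> R) \in L2.
    by move=> mA'; apply: bm_L2; exact: bm_indic.
  have [[_ /(_ _ _ (i2 _ mA) (i2 _ mB))[i1 e1]] [_ /(_ _ _ (i2 _ mA) (i2 _ mB))[i3 e3]]] := (KP, kP).
  have DAB : intg mu2 (fun z => \1_(A `*` B) z * (K z - kern t z)).
    by apply: bm_intgM => //; exact: bm_indic.
  rewrite integral_mkcond (eq_integral (fun z => (\1_(A `*` B) z * (K z - kern t z))%:E)); last first.
    by move=> z _; rewrite restrict_EFin/= patchE indicE; case: ifP => _; rewrite ?mul1r ?mul0r.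
  rewrite (EFin_mean DAB); congr (_%:E).
  transitivity (\int[mu2]_z (\1_A z.1 * K z * \1_B z.2) - \int[mu2]_z (\1_A z.1 * kern t z * \1_B z.2)).
    rewrite -meanB; [|exact: i1|exact: i3].
    apply: eq_Rintegral => -[x y] _ /=; rewrite (_ : \1_(A `*` B) (x, y) = \1_A x * \1_B y); first by ring.
    rewrite !indicE -natrM mulnb; congr (_%:R); congr nat_of_bool.
    by apply/idP/andP => [/set_mem[? ?]|[/set_mem ? /set_mem ?]]; [split; exact/mem_set|exact/mem_set].
  by move: e1 e3 => <- <-; rewrite subrr.
have all0 S : measurable S -> (\int[mu2]_(z in S) (K z - kern t z)%:E = 0)%E.
  move=> mS; rewrite -[LHS]fineK; last first.
    by apply: integrable_fin_num => //; exact: integrableS Di.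
  congr (_%:E); move: S mS; rewrite measurable_prod_measurableType.
  apply: (integral_eq0_sigma_algebra Di).
  - move=> _ _ [A1 mA1 [B1 mB1 <-]] [A2 mA2 [B2 mB2 <-]].
    exists (A1 `&` A2); first exact: measurableI.
    by exists (B1 `&` B2); [exact: measurableI|rewrite setXI].
  - by exists setT => //; exists setT => //; rewrite setXTT.
  - by move=> _ [A mA [B mB <-]]; exact: measurableX.
  - by move=> _ [A mA [B mB <-]]; rewrite /Rintegral rect.
have := @integral_ae_eq _ _ _ mu2 setT measurableT (cst 0%E) _ Di (measurable_cst _).
move=> /(_ _)[|N [mN N0 sN]].
  by move=> S _ mS; rewrite [RHS]integral0; exact: all0.
exists N; split => // z; rewrite /= => H; apply: sN => /(_ I)[] /eqP.
by rewrite subr_eq0 => /eqP.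
Qed.

(** The pairs that share their first [n] bits have measure [2^-n]. *)
Lemma ae_offdiag : {ae mu2, forall z, z.1 <> z.2}.
Proof.
pose D n := [set z : C3 * C3 | pre n z.1 = pre n z.2].
have DE n : (\1_(D n) : C3 * C3 -> R) = (fun z => same R n z.1 z.2).
  apply/funext => z; rewrite indicE /same; congr (_%:R); congr nat_of_bool.
  by apply/idP/eqP => [/set_mem//|?]; exact/mem_set.
have mD n : measurable (D n).
  rewrite (_ : D n = \bigcup_(w in [set: n.-tuple bool]) (cylinder w `*` cylinder w)).
    apply: fin_bigcup_measurable => // w _.
    by apply: measurableX; exact: measurable_cylinder.
  apply/seteqP; split=> [z zn|z [w _ [/= /cylinderE]]]; last by rewrite size_tuple => e1 /cylinderE; rewrite size_tuple /D/= e1 => ->.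
  have sx : size (pre n z.1) == n by rewrite size_pre.
  by exists (Tuple sx) => //; split; apply/cylinder_pre.
have D1 n : fine (mu2 (D n)) = 2 ^- n.
  rewrite -mean_indic// DE.
  under eq_Rintegral do rewrite same_sum.
  have bc (w : vertex) := bm_cyl R w.
  rewrite mean_sum; last by move=> w _; apply: (intg_tensor (bm_intg mu (bc w)) (bm_intg mu (bc w))).
  transitivity (\sum_(w : n.-tuple bool) (2 ^- n * 2 ^- n : R)).
    apply: eq_bigr => w _; rewrite (mean_tensor mu (bc w) (bc w)) mean_indic; last exact: measurable_cylinder.
    by rewrite (muE muP) size_tuple.
  rewrite sumr_const card_tuple card_bool -(mulr_natl _ (2 ^ n)) natrX mulrA mulfV ?mul1r//.
have mcap : measurable (\bigcap_n D n) by exact: bigcap_measurableType.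
have fin := fin_num_measure mu2.
exists (\bigcap_n D n); split => //.
  have H : fine (mu2 (\bigcap_n D n)) = 0.
    apply: (@geometric_eq0 _ _ 1 0%N) => M _; rewrite mul1r ger0_norm ?fine_ge0//.
    rewrite -D1; apply: fine_le; [exact: fin|exact: fin|].
    by apply: le_measure; rewrite ?inE// => z; apply.
  by rewrite -[LHS]fineK ?H//; exact: fin.
move=> z /= /contrapT e n _; rewrite /D /=.
by rewrite e.
Qed.

End fixed_time.

Lemma heat_kernel_theorem t : 0 < t ->
  let S (z : C3 * C3) : R :=
    limn (series (fun n => kappa R n z.1 z.2 * heat_coef t s n)) in
  (forall K : C3 * C3 -> R, is_heat_kernel mu T t K ->
     {ae (mu \x mu)%E, forall z, K z = S z} /\
     {ae (mu \x mu)%E, forall z, 0 < K z} /\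
     K \in Lfun (mu \x mu)%E +oo%E) /\
  (exists K : C3 * C3 -> R,
     [/\ is_heat_kernel mu T t K, continuous K,
         forall x y, x <> y -> K (x, y) = S (x, y) &
         forall x y, 0 < K (x, y)]).
Proof.
move=> t0 S.
have SE x y : x <> y -> kern t (x, y) = S (x, y).
  move=> xy; have [[//]|[n [_ _ d]]] := distP R x y.
  by rewrite /S (kern_series s t d) (kern_offdiag s t d).
split; last first.
  exists (kern t); split; [exact: kern_is_heat_kernel|exact: continuous_kern|exact: SE|].
  by move=> x y; exact: kern_gt0.
move=> K KP; have KE := heat_kernel_unique t0 KP; split.
  by move: KE ae_offdiag; apply: filterS2 => -[x y] -> /= /SE.
split; first by apply: filterS KE => z ->; exact: kern_gt0.
have [_ [C kC]] := bm_kern sP t0.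
rewrite inE; apply/andP; split; rewrite inE/=; first by case: KP.
rewrite /finite_norm unlock; case: ifP => // _.
apply: (@le_lt_trans _ _ C%:E); last exact: ltry.
apply/ess_supP; apply: filterS KE => z /= ->.
by rewrite lee_fin.
Qed.

End heat_kernel.

(** * Finite-dimensional distributions *)

Section chains.
Variables (R : realType) (mu : probability C3 R) (s : R).
Hypotheses (muP : is_mu mu) (sP : s < s0 + 2).
Implicit Types (ts : seq R) (f : R -> C3 -> R).
Local Notation heat := (heat s mu).

(** For [u > t_n > ... > t_1] this is the conditional mean of [f t_n (X t_n) ... f t_1 (X t_1)] given
the position at time [u]: the process is reversible, so the semigroup also describes its past. *)
Fixpoint backward (f : R -> C3 -> R) (u : R) (ts : seq R) : C3 -> R :=
  if ts is t :: ts' then heat (u - t) (fun x => f t x * backward f t ts' x) else cst 1.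

(** The operators [f_n e^((t_n - t_(n-1)) Delta) ... f_1] applied to the constant one, the times
being listed in decreasing order. *)
Definition chain f ts : C3 -> R :=
  if ts is t :: ts' then fun x => f t x * backward f t ts' x else cst 1.

Lemma lev_backward N f u ts : path >%R u ts -> (forall t, t \in ts -> lev N (f t)) ->
  lev N (backward f u ts).
Proof.
elim: ts u => [//|t ts IH] u /= /andP[tu pts] fN; apply: lev_heat => //; first by rewrite subr_gt0.
apply: (lev_op2 *%R); first by apply: fN; rewrite inE eqxx.
by apply: IH => // t' t'ts; apply: fN; rewrite inE t'ts orbT.
Qed.

Lemma lev_chain N f ts : sorted >%R ts -> (forall t, t \in ts -> lev N (f t)) ->
  lev N (chain f ts).
Proof.
case: ts => [//|t ts] /= pts fN; apply: (lev_op2 *%R); first by apply: fN; rewrite inE eqxx.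
by apply: lev_backward => // t' t'ts; apply: fN; rewrite inE t'ts orbT.
Qed.

Lemma eq_backward f g u ts : (forall t, t \in ts -> f t = g t) ->
  backward f u ts = backward g u ts.
Proof.
elim: ts u => [//|t ts IH] u fg /=; rewrite (fg t) ?inE ?eqxx// IH// => t' t'ts.
by apply: fg; rewrite inE t'ts orbT.
Qed.

Lemma eq_chain f g ts : (forall t, t \in ts -> f t = g t) -> chain f ts = chain g ts.
Proof.
case: ts => [//|t ts] fg /=; rewrite (fg t) ?inE ?eqxx// (eq_backward (g := g))// => t' t'ts.
by apply: fg; rewrite inE t'ts orbT.
Qed.

Lemma backward_shift f u h ts :
  backward (fun t => f (t - h)) (u + h) [seq t + h | t <- ts] = backward f u ts.
Proof.
elim: ts u => [//|t ts IH] u /=; rewrite IH addrK.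
by rewrite (_ : u + h - (t + h) = u - t)//; ring.
Qed.

Lemma chain_shift f h ts : chain (fun t => f (t - h)) [seq t + h | t <- ts] = chain f ts.
Proof. by case: ts => [//|t ts] /=; rewrite backward_shift addrK. Qed.

Lemma path_gt_all u ts : path >%R u ts -> forall t, t \in ts -> t < u.
Proof.
move=> p t tts; have := order_path_min (rev_trans (@lt_trans _ R)) p.
by move=> /allP/(_ t tts).
Qed.

(** The semigroup property across the time [t], at which nothing is observed. *)
Lemma heat_backward N f u t ts : path >%R u (t :: ts) -> (forall t, t \in ts -> lev N (f t)) ->
  heat (u - t) (backward f t ts) = backward f u ts.
Proof.
move=> /= /andP[tu pts] fN; have ut0 : 0 < u - t by rewrite subr_gt0.
case: ts pts fN => [|t' ts] /= pts fN; first exact: heat_lev0.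
move/andP: pts => [t't pts]; have tt0 : 0 < t - t' by rewrite subr_gt0.
have l : lev N (fun x => f t' x * backward f t' ts x).
  apply: (lev_chain (ts := t' :: ts)); first by [].
  exact: fN.
have := heat_semigroup sP muP ut0 tt0 l.
by rewrite (_ : u - t + (t - t') = u - t') => [->//|]; ring.
Qed.

(** Consistency of the finite-dimensional laws: by the semigroup property, a time at which nothing is
observed can be dropped. *)
Lemma backward_filter N f (p : pred R) u ts : path >%R u ts ->
  (forall t, t \in ts -> lev N (f t)) -> (forall t, ~~ p t -> f t = cst 1) ->
  backward f u (seq.filter p ts) = backward f u ts.
Proof.
elim: ts u => [//|t ts IH] u /= /andP[tu pts] fN fp.
have fN' t' : t' \in ts -> lev N (f t') by move=> h; apply: fN; rewrite inE h orbT.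
case: ifPn => [pt|npt] /=; first by rewrite IH.
have put : path >%R u ts.
  case: ts pts {IH fN fN'} => [//|t' ts] /= /andP[tt' ->]; rewrite andbT.
  exact: lt_trans tt' tu.
rewrite IH// (fp t npt) -(heat_backward (N := N) (t := t) (ts := ts))//=; last by rewrite tu.
by rewrite (_ : (fun x => cst 1 x * backward f t ts x) = backward f t ts)//;
  apply/funext => x; rewrite mul1r.
Qed.

Lemma mean_heat N t h : 0 < t -> lev N h -> \int[mu]_x heat t h x = \int[mu]_x h x.
Proof.
move=> t0 hN; have o : lev N (cst 1 : C3 -> R) by [].
have := heat_sym sP muP t0 o hN; rewrite (heat_lev0 sP muP t0 (_ : lev 0 (cst 1)))//.
by under eq_Rintegral do rewrite mul1r; under [in RHS]eq_Rintegral do rewrite mul1r.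
Qed.

(** The heat operator preserves the mean. *)
Lemma mean_backward N f u ts : path >%R u ts -> (forall t, t \in ts -> lev N (f t)) ->
  \int[mu]_x backward f u ts x = \int[mu]_x chain f ts x.
Proof.
case: ts => [//|t ts] /= /andP[tu pts] fN; apply: (mean_heat (N := N)).
  by rewrite subr_gt0.
exact: (lev_chain (ts := t :: ts)).
Qed.

Lemma mean_chain_filter N f (p : pred R) ts : sorted >%R ts ->
  (forall t, t \in ts -> lev N (f t)) -> (forall t, ~~ p t -> f t = cst 1) ->
  \int[mu]_x chain f (seq.filter p ts) x = \int[mu]_x chain f ts x.
Proof.
move=> sts fN fp; have [u put] : exists u, path >%R u ts.
  case: ts sts {fN} => [|t ts] /= sts; first by exists 0.
  by exists (t + 1); rewrite sts andbT ltrDl.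
rewrite -(mean_backward put fN) -(backward_filter put fN fp).
rewrite (mean_backward (N := N) (u := u))//.
  by apply: path_filter put; exact: (rev_trans (@lt_trans _ R)).
by move=> t; rewrite mem_filter => /andP[_]; exact: fN.
Qed.

End chains.

Section grid.
Variable R : realType.

Definition grid (G : seq R) : seq R := sort >=%R (undup G).

Lemma grid_sorted G : sorted >%R (grid G).
Proof.
rewrite -rev_sorted; have H : sorted <=%R (rev (grid G)).
  by rewrite rev_sorted; apply: sort_sorted => x y; exact: le_total.
by rewrite lt_sorted_uniq_le H rev_uniq sort_uniq undup_uniq.
Qed.

Lemma mem_grid G : grid G =i G.
Proof. by move=> u; rewrite mem_sort mem_undup. Qed.

End grid.

Section fdd.
Variables (R : realType) (mu : probability C3 R) (s : R).
Hypotheses (muP : is_mu mu) (sP : s < s0 + 2).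
Variables (d : measure_display) (Omega : measurableType d).
Variables (P : probability Omega R) (X : R -> Omega -> C3) (I : set R).
Local Notation heat := (heat s mu).
Local Notation chain := (chain mu s).
Local Notation backward := (backward mu s).

(** The finite-dimensional laws at the times in [I], tested on locally constant functions. *)
Definition has_fdd := (forall t, I t -> measurable_fun setT (X t)) /\
  forall N (f : R -> C3 -> R) ts, sorted >%R ts -> (forall t, t \in ts -> I t) ->
    (forall t, lev N (f t)) ->
    \int[P]_w (\prod_(t <- ts) f t (X t w)) = \int[mu]_x chain f ts x.

Hypothesis fddP : has_fdd.

Definition collect (n : nat) (t : nat -> R) (g : nat -> C3 -> R) (u : R) : C3 -> R :=
  fun x => \prod_(i < n | t i == u) g i x.

Definition times (n : nat) (t : nat -> R) : seq R := grid (mkseq t n).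

Lemma mem_times n t u : (u \in times n t) = [exists i : 'I_n, t i == u].
Proof.
rewrite mem_grid; apply/mapP/existsP => [[j]|[i /eqP <-]].
  by rewrite mem_iota/= add0n => j_n ->; exists (Ordinal j_n).
by exists (i : nat) => //; rewrite mem_iota/= add0n ltn_ord.
Qed.

(** The times of a family need not be ordered nor distinct: group the factors by time. *)
Lemma prod_collect n (t : nat -> R) (g : nat -> C3 -> R) (us : seq R) (y : R -> C3) : uniq us ->
  (forall i, (i < n)%N -> t i \in us) ->
  \prod_(i < n) g i (y (t i)) = \prod_(u <- us) collect n t g u (y u).
Proof.
move=> uus tus; rewrite (exchange_big_dep xpredT)//=.
apply: eq_bigr => i _; rewrite (big_rem (t i)) ?tus//= eqxx.
rewrite big_seq_cond big1 ?mulr1// => u /andP[]; rewrite mem_rem_uniq// inE => /andP[/negP ut _] /eqP e.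
by case: ut; rewrite e.
Qed.

Lemma lev_collect N n (t : nat -> R) (g : nat -> C3 -> R) : (forall i, lev N (g i)) -> forall u, lev N (collect n t g u).
Proof. by move=> gN u x y e; apply: eq_bigr => i _; exact: gN. Qed.

Lemma mean_fdd N n (t : nat -> R) (g : nat -> C3 -> R) : (forall i, (i < n)%N -> I (t i)) -> (forall i, lev N (g i)) ->
  \int[P]_w (\prod_(i < n) g i (X (t i) w)) =
  \int[mu]_x chain (collect n t g) (times n t) x.
Proof.
move=> tI gN; have [_ fd] := fddP.
rewrite -(fd N)//; last first.
- exact: lev_collect.
- by move=> u; rewrite mem_times => /existsP[i /eqP <-]; exact: tI.
- exact: grid_sorted.
apply: eq_Rintegral => w _; apply: prod_collect.
  by apply: (sorted_uniq (rev_trans (@lt_trans _ R))); [move=> x; exact: ltxx|exact: grid_sorted].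
by move=> i i_n; rewrite mem_times; apply/existsP; exists (Ordinal i_n).
Qed.

(** The chain of heat operators involves the differences of the times only. *)
Lemma mean_fdd_shift N n (t : nat -> R) (g : nat -> C3 -> R) h : 0 <= h -> (forall u, I u -> I (u + h)) ->
  (forall i, (i < n)%N -> I (t i)) -> (forall i, lev N (g i)) ->
  \int[P]_w (\prod_(i < n) g i (X (t i + h) w)) = \int[P]_w (\prod_(i < n) g i (X (t i) w)).
Proof.
move=> h0 Ih tI gN; rewrite (mean_fdd tI gN) -(chain_shift mu s _ h).
have [_ fd] := fddP; rewrite -(fd N); last first.
- by move=> u; exact: lev_collect.
- move=> _ /mapP[u + ->]; rewrite mem_times => /existsP[i /eqP <-].
  exact/Ih/tI.
- rewrite (homo_sorted (e := >%R))//; last exact: grid_sorted.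
  by move=> x y /=; rewrite ltrD2r.
apply: eq_Rintegral => w _; rewrite big_map.
under [RHS]eq_bigr do rewrite addrK.
rewrite (prod_collect g (fun u => X (u + h) w) (us := times n t))//.
  by apply: (sorted_uniq (rev_trans (@lt_trans _ R))); [move=> x; exact: ltxx|exact: grid_sorted].
by move=> i i_n; rewrite mem_times; apply/existsP; exists (Ordinal i_n).
Qed.

End fdd.

(** * Stationarity and the Markov property *)

(** One coordinate of an event can be replaced by an arbitrary Borel set: both sides are finite
measures in [A]. *)
Lemma prob_event_ext (R : realType) d1 d2 (O1 : measurableType d1) (O2 : measurableType d2)
    (P1 : probability O1 R) (P2 : probability O2 R) (E1 : set O1) (E2 : set O2)
    (Y1 : O1 -> C3) (Y2 : O2 -> C3) :
  measurable E1 -> measurable E2 -> measurable_fun setT Y1 -> measurable_fun setT Y2 ->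
  (forall v, P1 (E1 `&` Y1 @^-1` cylinder v) = P2 (E2 `&` Y2 @^-1` cylinder v)) ->
  forall A, measurable A -> P1 (E1 `&` Y1 @^-1` A) = P2 (E2 `&` Y2 @^-1` A).
Proof.
move=> mE1 mE2 mY1 mY2 Hv; have e0 := Hv [::]; rewrite cylinder_nil !preimage_setT !setIT in e0.
have m1 A : measurable A -> measurable (Y1 @^-1` A).
  by move=> mA; rewrite -[X in measurable X]setTI; exact: mY1.
have m2 A : measurable A -> measurable (Y2 @^-1` A).
  by move=> mA; rewrite -[X in measurable X]setTI; exact: mY2.
apply: C3_induction.
- by rewrite !preimage_set0 !setI0 !measure0.
- exact: Hv.
- move=> A mA HA; rewrite -!preimage_setC -!setDE.
  have f1 : (P1 E1 < +oo)%E by rewrite ltey_eq (fin_num_measure P1).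
  have f2 : (P2 E2 < +oo)%E by rewrite ltey_eq (fin_num_measure P2).
  have D1 := measureD mE1 (m1 A mA) f1; have D2 := measureD mE2 (m2 A mA) f2.
  by rewrite [LHS]D1 [RHS]D2; congr (_ - _)%E; [exact: e0|exact: HA].
- move=> F mF tF HF; rewrite !preimage_bigcup !setI_bigcupr !measure_bigcup//.
  + by apply: eq_eseriesr => n _; exact: HF.
  + by move=> n _; apply: measurableI => //; exact: m2.
  + by move=> i j _ _ [w [[_ Fi] [_ Fj]]]; apply: (tF i j) => //; eexists; split; [exact: Fi|exact: Fj].
  + by move=> n _; apply: measurableI => //; exact: m1.
  + by move=> i j _ _ [w [[_ Fi] [_ Fj]]]; apply: (tF i j) => //; eexists; split; [exact: Fi|exact: Fj].
Qed.

Section consequences.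
Variables (R : realType) (mu : probability C3 R) (s : R).
Hypotheses (muP : is_mu mu) (sP : s < s0 + 2).
Variables (d : measure_display) (Omega : measurableType d).
Variables (P : probability Omega R) (X : R -> Omega -> C3) (I : set R).
Local Notation heat := (heat s mu).
Local Notation chain := (chain mu s).
Local Notation backward := (backward mu s).
Hypothesis fddP : has_fdd mu s P X I.

Definition joint (n : nat) (t : nat -> R) (A : nat -> set C3) : set Omega :=
  [set w | forall i, (i < n)%N -> A i (X (t i) w)].

Lemma measurable_joint n t A : (forall i, (i < n)%N -> I (t i)) ->
  (forall i, (i < n)%N -> measurable (A i)) -> measurable (joint n t A).
Proof.
move=> tI mA; rewrite (_ : joint n t A = \bigcap_i (if (i < n)%N then X (t i) @^-1` A i else setT)).
  apply: bigcap_measurableType => i _; case: ifPn => // i_n.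
  by rewrite -[X in measurable X]setTI; apply: (fddP.1 _ (tI _ i_n)) => //; exact: mA.
apply/seteqP; split=> [w wA i _|w wA i i_n]; first by case: ifPn => // i_n; exact: wA.
by have := wA i Logic.I; rewrite i_n.
Qed.

Lemma indic_joint n t A w :
  (\1_(joint n t A) w : R) = \prod_(i < n) \1_(A i) (X (t i) w).
Proof.
rewrite indicE; have [/set_mem H|H] := boolP (w \in joint n t A).
  by rewrite big1// => i _; rewrite indicE mem_set//; exact: H.
have [i Ai] : exists i : 'I_n, ~ A i (X (t i) w).
  apply: contrapT => /forallNP K; move/negP: H; apply; apply/mem_set => i i_n.
  by apply: contrapT; exact: (K (Ordinal i_n)).
by rewrite (bigD1 i)//= indicE memNset// mul0r.
Qed.

(** Finitely many cylinders have a common level; the default [cst 1] makes it uniform in [i]. *)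
Lemma lev_cylinders n (v : nat -> vertex) :
  exists N, forall i, lev N (if (i < n)%N then \1_(cylinder (v i)) else cst 1 : C3 -> R).
Proof.
exists (\sum_(i < n) size (v i))%N => i; case: ifPn => // i_n.
apply: lev_le (@lev_indic R (v i)).
by rewrite (bigD1 (Ordinal i_n))//= leq_addr.
Qed.

Lemma joint_cylinders n t (v : nat -> vertex) :
  (forall i, (i < n)%N -> I (t i)) ->
  fine (P (joint n t (fun i => cylinder (v i)))) =
  \int[P]_w \prod_(i < n) (if (i < n)%N then \1_(cylinder (v i)) else cst 1) (X (t i) w).
Proof.
move=> tI; rewrite -mean_indic; last first.
  by apply: measurable_joint => // i _; exact: measurable_cylinder.
by apply: eq_Rintegral => w _; rewrite indic_joint; apply: eq_bigr => i _; rewrite ltn_ord.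
Qed.

(** The cylinders are replaced by Borel sets one coordinate at a time. *)
Lemma stationary_of_fdd : (forall u h, 0 <= h -> I u -> I (u + h)) -> is_stationary P X I.
Proof.
move=> Ih n t A h h0 tA.
have tI i : (i < n)%N -> I (t i) by move=> /tA[].
have thI i : (i < n)%N -> I (t i + h) by move=> /tI; exact: Ih.
have mA i : (i < n)%N -> measurable (A i) by move=> /tA[].
change (P (joint n (fun i => t i + h) A) = P (joint n t A)).
have Pfin E : measurable E -> P E \is a fin_num by exact: (fin_num_measure P).
(* The coordinates from [k] on are still cylinders. *)
suff : forall k, forall A, (forall i, (i < n)%N -> measurable (A i)) ->
    (forall i, (k <= i < n)%N -> exists v, A i = cylinder v) ->
    P (joint n (fun i => t i + h) A) = P (joint n t A).
  by move=> /(_ n A mA); apply=> i /andP[ni]; rewrite ltnNge ni.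
elim=> [|k IH] {tA mA}A mA kA.
  have [v vE] : exists v : nat -> vertex, forall i, (i < n)%N -> A i = cylinder (v i).
    have [i|v vE] := @choice nat vertex (fun i v => (i < n)%N -> A i = cylinder v); last by exists v.
    have [i_n|ni] := boolP (i < n)%N; last by exists [::].
    by have [v ->] := kA i i_n; exists v.
  have jE t' : joint n t' A = joint n t' (fun i => cylinder (v i)).
    by apply/seteqP; split=> w H i i_n; have := H i i_n; rewrite vE.
  rewrite !jE -[LHS]fineK; last by apply/Pfin/measurable_joint => // i _; exact: measurable_cylinder.
  rewrite -[RHS]fineK; last by apply/Pfin/measurable_joint => // i _; exact: measurable_cylinder.
  congr (_%:E); rewrite (joint_cylinders _ thI) (joint_cylinders _ tI).
  have [N lN] := lev_cylinders n v.
  exact: (mean_fdd_shift fddP h0 (fun u => Ih u h h0) tI lN).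
have [kn|nk] := ltnP k n; last first.
  by apply: IH => // i /andP[ki i_n]; have := leq_trans i_n (leq_trans nk ki); rewrite ltnn.
pose upd B i := if i == k then B else A i.
pose rest i := if i == k then setT else A i.
have mrest i : (i < n)%N -> measurable (rest i) by rewrite /rest; case: eqP => // _; exact: mA.
have split_k t' B : joint n t' (upd B) = joint n t' rest `&` X (t' k) @^-1` B.
  apply/seteqP; split=> [w H|w [H Bk] i i_n].
    split; last by have := H k kn; rewrite /upd eqxx.
    by move=> i i_n; have := H i i_n; rewrite /upd /rest; case: eqP.
  by have := H i i_n; rewrite /upd /rest; case: eqP => [->|].
have AE : A = upd (A k) by apply/funext => i; rewrite /upd; case: eqP => [->|].
have ext := @prob_event_ext R _ _ _ _ P P (joint n (fun i => t i + h) rest) (joint n t rest)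
  (X (t k + h)) (X (t k)) (measurable_joint thI mrest) (measurable_joint tI mrest)
  (fddP.1 _ (thI _ kn)) (fddP.1 _ (tI _ kn)).
rewrite AE (split_k (fun i => t i + h) (A k)) (split_k t (A k)); apply: (ext) (mA k kn) => v.
rewrite -(split_k (fun i => t i + h) (cylinder v)) -(split_k t (cylinder v)); apply: IH => i.
  by rewrite /upd; case: eqP => [_ _|_]; [exact: measurable_cylinder|exact: mA].
rewrite /upd; case: eqP => [_ _|/eqP ik /andP[ki i_n]]; first by exists v.
by apply: kA; rewrite ltn_neqAle eq_sym ik ki.
Qed.

Lemma fdd_law t A : I t -> measurable A -> P (X t @^-1` A) = mu A.
Proof.
move=> tI mA; have := @prob_event_ext R _ _ _ _ P mu setT setT (X t) id measurableT measurableT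
  (fddP.1 _ tI) (@measurable_id _ _ _) _ A mA.
rewrite !setTI preimage_id; apply => v; rewrite !setTI preimage_id.
have mv := measurable_cylinder v.
have mXv : measurable (X t @^-1` cylinder v).
  by rewrite -[X in measurable X]setTI; exact: (fddP.1 _ tI).
rewrite -[LHS]fineK ?(fin_num_measure P)// -[RHS]fineK ?(fin_num_measure mu)//; congr (_%:E).
rewrite -!mean_indic//.
have := fddP.2 (size v) (fun=> \1_(cylinder v)) [:: t] isT _ (fun=> @lev_indic R v).
rewrite /= => H.
have -> : \int[mu]_x \1_(cylinder v) x = \int[mu]_x (\1_(cylinder v) x * 1).
  by apply: eq_Rintegral => x _; rewrite mulr1.
rewrite -H; last by move=> u; rewrite inE => /eqP ->.
by apply: eq_Rintegral => w _; rewrite big_seq1 !indicE.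
Qed.

Section markov.
Variables (u t : R).
Hypotheses (uI : I u) (tI : I t) (ut : u < t).

(** The candidate for the conditional probability of [X t] in [A], minus the indicator of the event;
its integrals over the events of the past have to vanish. *)
Definition markov_gap (A : set C3) (w : Omega) : R :=
  heat (t - u) (\1_A) (X u w) - \1_A (X t w).

Let tu0 : 0 < t - u. Proof. by rewrite subr_gt0. Qed.

Lemma indic_intg A : measurable A -> intg mu (\1_A).
Proof. by move=> mA; exact/bm_intg/bm_indic. Qed.

Lemma markov_gap_bm A : measurable A -> bm (markov_gap A).
Proof.
move=> mA; apply: bmB.
  by apply: (bm_comp (fddP.1 _ uI)); apply: heat_bm => //; exact: indic_intg.
by apply: (bm_comp (fddP.1 _ tI)); exact: bm_indic.
Qed.

(** Events at finitely many times of the past, for which the Markov property is the symmetry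
of the heat operator. *)
Definition past_joint : set (set Omega) :=
  [set S | exists n (r : nat -> R) (v : nat -> vertex),
    (forall i, (i < n)%N -> I (r i) /\ r i <= u) /\
    S = joint n r (fun i => cylinder (v i))].

Lemma past_joint_setI : setI_closed past_joint.
Proof.
move=> _ _ [n [r [v [H ->]]]] [n' [r' [v' [H' ->]]]].
exists (n + n')%N, (fun i => if (i < n)%N then r i else r' (i - n)%N),
  (fun i => if (i < n)%N then v i else v' (i - n)%N); split.
  move=> i i_n; case: ifPn => [/H//|]; rewrite -leqNgt => ni.
  by apply: H'; rewrite ltn_subLR.
apply/seteqP; split=> [w [K K'] i i_n|w K].
  case: ifPn => [/K//|]; rewrite -leqNgt => ni.
  by apply: K'; rewrite ltn_subLR.
split=> i i_n; first by have := K i (ltn_addr _ i_n); rewrite i_n.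
by have := K (n + i)%N; rewrite ltn_add2l i_n ltnNge leq_addr/= addKn => /(_ isT).
Qed.

Lemma past_joint_setT : past_joint setT.
Proof.
exists 0%N, (fun=> u), (fun=> [::]); split => //.
by apply/seteqP; split => // w _ i.
Qed.

Lemma past_joint_measurable : past_joint `<=` measurable.
Proof.
move=> _ [n [r [v [H ->]]]]; apply: measurable_joint => [i /H[]//|i _].
exact: measurable_cylinder.
Qed.

Lemma past_sub : past X I u `<=` <<s past_joint >>.
Proof.
apply: smallest_sub; first exact: smallest_sigma_algebra.
move=> S [r [rI ru]] [A mA <-]; rewrite setTI; move: A mA; apply: C3_induction.
- by rewrite preimage_set0; exact: sigma_algebra0.
- move=> v; apply: sub_sigma_algebra; exists 1%N, (fun=> r), (fun=> v); split => //.
  by apply/seteqP; split => [w wv [|i]//|w /(_ 0%N isT)].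
- by move=> A _ HA; rewrite -preimage_setC -setTD; exact: sigma_algebraCD.
- by move=> F _ _ HF; rewrite preimage_bigcup; exact: sigma_algebra_bigcup.
Qed.

(** With [c] the chain of the past event, the two terms are the integrals of [heat 1_v * c] and of
[1_v * heat c], which are equal since the heat operator is symmetric. *)
Lemma markov_gap_cylinder v S : past_joint S -> \int[P]_(w in S) markov_gap (cylinder v) w = 0.
Proof.
move=> [n [r [v' [H ->]]]].
have rI i : (i < n)%N -> I (r i) by move=> /H[].
have mS : measurable (joint n r (fun i => cylinder (v' i))).
  by apply: measurable_joint => // i _; exact: measurable_cylinder.
have [N0 lN0] := lev_cylinders n v'.
pose N := maxn N0 (size v).
pose g i : C3 -> R := if (i < n)%N then \1_(cylinder (v' i)) else cst 1.
have gN i : lev N (g i) by apply: lev_le (lN0 i); exact: leq_maxl.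
have aN : lev N (\1_(cylinder v) : C3 -> R) by apply: lev_le (@lev_indic R v); exact: leq_maxr.
have hN : lev N (heat (t - u) (\1_(cylinder v))) by exact: lev_heat.
pose ts := seq.filter (fun x => x < u) (times n r).
pose f := collect n r g.
have fN w : lev N (f w) by exact: lev_collect.
have pts : path >%R u ts.
  rewrite path_min_sorted; last by apply/allP => x; rewrite mem_filter => /andP[].
  by apply: sorted_filter; [exact: (rev_trans (@lt_trans _ R))|exact: grid_sorted].
have tsI x : x \in ts -> I x.
  rewrite mem_filter mem_times => /andP[_ /existsP[i /eqP <-]]; exact: rI.
have uts : uniq (u :: ts).
  by apply: (sorted_uniq (leT := >%R)) => //; [exact: (rev_trans (@lt_trans _ R))|move=> x; exact: ltxx].
have uts' : uniq (t :: u :: ts).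
  apply: (sorted_uniq (leT := >%R)); [exact: (rev_trans (@lt_trans _ R))|move=> x; exact: ltxx|].
  by rewrite /= ut.
have rts i : (i < n)%N -> r i \in u :: ts.
  move=> i_n; rewrite inE mem_filter mem_times; have [_] := H i i_n; rewrite le_eqVlt.
  case/orP => [->//|->]; rewrite /= orbC; apply/orP; left; apply/existsP.
  by exists (Ordinal i_n).
have fpast w : \1_(joint n r (fun i => cylinder (v' i))) w = \prod_(x <- u :: ts) f x (X x w).
  rewrite indic_joint -(prod_collect g (X ^~ w) uts rts).
  by apply: eq_bigr => i _; rewrite /g ltn_ord.
have ft : f t = cst 1.
  apply/funext => x; rewrite /f /collect big1// => i /eqP rt.
  by have [_] := H i (ltn_ord i); rewrite rt leNgt ut.
(* The observables of the two sides at the times [u :: ts] and [t :: u :: ts]. *)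
pose fL x : C3 -> R := if x == u then fun y => f u y * heat (t - u) (\1_(cylinder v)) y else f x.
pose fR x : C3 -> R := if x == t then \1_(cylinder v) else f x.
have uNts x : x \in ts -> x == u = false.
  by move=> xts; move: uts => /=/andP[uts _]; apply/eqP => xu; rewrite -xu xts in uts.
have tNts x : x \in u :: ts -> x == t = false.
  by move=> xts; move: uts' => /=/andP[+ _] => nt; apply/eqP => xt; rewrite -xt xts in nt.
have eL w : \prod_(x <- u :: ts) fL x (X x w) =
    \1_(joint n r (fun i => cylinder (v' i))) w * heat (t - u) (\1_(cylinder v)) (X u w).
  rewrite fpast !big_cons {1}/fL eqxx -!mulrA; congr (_ * _); rewrite mulrC; congr (_ * _).
  by rewrite big_seq [RHS]big_seq; apply: eq_bigr => x xts; rewrite /fL uNts.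
have eR w : \prod_(x <- t :: u :: ts) fR x (X x w) =
    \1_(joint n r (fun i => cylinder (v' i))) w * \1_(cylinder v) (X t w).
  rewrite big_cons {1}/fR eqxx mulrC fpast; congr (_ * _).
  by rewrite big_seq [RHS]big_seq; apply: eq_bigr => x xts; rewrite /fR tNts.
have fLN x : lev N (fL x) by rewrite /fL; case: eqP => // _; exact: (lev_op2 *%R).
have fRN x : lev N (fR x) by rewrite /fR; case: eqP.
have bE : backward f u ts = backward fL u ts.
  by apply: eq_backward => x xts; rewrite /fL uNts.
have bE' : backward f u ts = backward fR u ts.
  by apply: eq_backward => x xts; rewrite /fR tNts// inE xts orbT.
have cN : lev N (chain f (u :: ts)) by apply: lev_chain.
have ind A : measurable A -> bm (\1_A : C3 -> R) by move=> mA; exact: bm_indic.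
have b1 : bm (fun w => \1_(joint n r (fun i => cylinder (v' i))) w * heat (t - u) (\1_(cylinder v)) (X u w)).
  exact: (bmM (bm_indic R mS) (bm_comp (fddP.1 _ uI) (lev_bm hN))).
have b2 : bm (fun w => \1_(joint n r (fun i => cylinder (v' i))) w * \1_(cylinder v) (X t w) : R).
  exact: (bmM (bm_indic R mS) (bm_comp (fddP.1 _ tI) (lev_bm aN))).
rewrite -mean_indicl// /markov_gap; under eq_Rintegral do rewrite mulrBr.
rewrite meanB; [|exact: bm_intg..].
under eq_Rintegral do rewrite -eL; under [X in _ - X]eq_Rintegral do rewrite -eR.
rewrite (fddP.2 N fL) //=; last by move=> x; rewrite inE => /predU1P[->//|]; exact: tsI.
rewrite (fddP.2 N fR) //=; last 2 first.
- by rewrite ut.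
- by move=> x; rewrite !inE => /predU1P[->//|/predU1P[->//|]]; exact: tsI.
apply/eqP; rewrite subr_eq0; apply/eqP.
rewrite -bE -bE' {1}/fL eqxx {1}/fR eqxx {1}/fR lt_eqF//.
rewrite [RHS](heat_sym sP muP tu0 aN cN).
by apply: eq_Rintegral => x _ /=; ring.
Qed.

Lemma markov_gap_sigma v S : past X I u S -> \int[P]_(w in S) markov_gap (cylinder v) w = 0.
Proof.
move=> /past_sub; apply: integral_eq0_sigma_algebra.
- by apply: bm_intg; apply: markov_gap_bm; exact: measurable_cylinder.
- exact: past_joint_setI.
- exact: past_joint_setT.
- exact: past_joint_measurable.
- by move=> S'; exact: markov_gap_cylinder.
Qed.

Lemma past_measurable : past X I u `<=` measurable.
Proof.
apply: subset_trans past_sub _; apply: smallest_sub; last exact: past_joint_measurable.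
exact: sigma_algebra_measurable.
Qed.

(** Induction on the Borel set [A]. For a countable union, a tail [D] contributes at most
[(C + 1) * mu D]: the heat operator maps L^1 to bounded functions, and [mu] is the law of [X t]. *)
Lemma markov_gap0 A S : measurable A -> past X I u S -> \int[P]_(w in S) markov_gap A w = 0.
Proof.
move=> + pS; have mS := past_measurable pS; move: A; apply: C3_induction.
- rewrite -[RHS](Rintegral_set0 P (fun=> 0)) /markov_gap !indic0.
  rewrite (heat_lev0 sP muP tu0 (_ : lev 0 (cst 0)))//.
  by under eq_Rintegral do rewrite subr0; rewrite Rintegral_set0 Rintegral_cst// mul0r.
- by move=> v; exact: markov_gap_sigma.
- move=> A mA HA.
  have i1 : intg mu (cst 1) by apply: bm_intg; exact: bm_cst.
  have e : markov_gap (~` A) = (fun w => -1 * markov_gap A w).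
    have iE : \1_(~` A) = (fun x => 1 + (-1) * \1_A x) :> (C3 -> R).
      by apply/funext => x; rewrite !indicE in_setC; case: (_ \in _) => /=; ring.
    apply/funext => w; rewrite /markov_gap iE.
    rewrite (heatD sP tu0 i1 (intgZ (-1) (indic_intg mA))) (heatZ sP tu0 (-1) (indic_intg mA)).
    by rewrite (heat_lev0 sP muP tu0 (_ : lev 0 (fun=> 1)))//; ring.
  rewrite e RintegralZl//; first by rewrite HA mulr0.
  apply: integrableS (bm_intg P (markov_gap_bm mA)) => //.
move=> F mF tF HF; have [C C0 HC] := heat_le mu sP tu0.
have mU : measurable (\bigcup_k F k) by exact: bigcup_measurable.
apply/eqP; rewrite -normr_eq0; apply/eqP/le_anti; rewrite normr_ge0 andbT.
apply/ler_addgt0Pr => e e0; rewrite add0r.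
have C1 : 0 < C + 1 by rewrite ltr_wpDl.
have [n Hn] := bigcup_tail mu mF (divr_gt0 e0 C1).
set Sn := \bigcup_(k < n) F k in Hn; set D := _ `\` _ in Hn.
have mSn : measurable Sn by exact: bigcup_measurable.
have mD : measurable D by exact: measurableD.
have SU : Sn `<=` \bigcup_k F k by move=> x [k _ Fx]; exists k.
have ik k : intg mu (\1_(F k)) by exact: indic_intg.
have igk k : intg P (fun w => \1_S w * markov_gap (F k) w).
  exact: (bm_intgM (bm_indic R mS) (bm_intg P (markov_gap_bm (mF k)))).
have iD : intg P (fun w => \1_S w * markov_gap D w).
  exact: (bm_intgM (bm_indic R mS) (bm_intg P (markov_gap_bm mD))).
have gE w : markov_gap (\bigcup_k F k) w = markov_gap D w + \sum_(k < n) markov_gap (F k) w.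
  have iU : \1_(\bigcup_k F k) = (fun x => \1_D x + \sum_(k < n) \1_(F k) x) :> (C3 -> R).
    apply/funext => x; rewrite (indic_setDl R SU) /Sn (indic_bigcup_ord R n tF).
    by rewrite subrK.
  rewrite /markov_gap sumrB iU heatD//; [|exact: indic_intg|by apply: intg_sum].
  by rewrite heat_sum//; ring.
rewrite -mean_indicl//.
rewrite (_ : \int[P]_x _ = \int[P]_w (\1_S w * markov_gap D w)); last first.
  under eq_Rintegral do rewrite gE mulrDr mulr_sumr.
  rewrite meanD//; last by apply: intg_sum.
  rewrite mean_sum// big1 ?addr0// => k _; rewrite mean_indicl//; exact: HF.
have mXD : measurable (X t @^-1` D).
  by rewrite -[X in measurable X]setTI; exact: (fddP.1 _ tI).
have bXD : bm (fun w => \1_D (X t w) : R).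
  by apply: (bm_comp (fddP.1 _ tI)); exact: bm_indic.
apply: (@le_trans _ _ (\int[P]_w (C * fine (mu D) + \1_D (X t w)))).
  apply: ler_norm_mean => //; first by apply: intgD; apply: bm_intg => //; exact: bm_cst.
  move=> w; rewrite normrM /markov_gap.
  apply: (@le_trans _ _ (1 * (C * fine (mu D) + \1_D (X t w)))); last by rewrite mul1r.
  apply: ler_pM => //; first by rewrite indicE; case: (_ \in _); rewrite ?normr0 ?normr1.
  apply: (le_trans (ler_normB _ _)); apply: lerD; last by rewrite ger0_norm.
  apply: (le_trans (HC _ (indic_intg mD) _)); rewrite ler_wpM2l//.
  rewrite le_eqVlt; apply/orP; left; apply/eqP; rewrite -mean_indic//.
  by apply: eq_Rintegral => y _; rewrite ger0_norm.
rewrite meanD; [|by apply: bm_intg; exact: bm_cst|exact: bm_intg].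
rewrite mean_cst (_ : \int[P]_x \1_D (X t x) = fine (mu D)); last first.
  by rewrite -(fdd_law tI mD) -mean_indic//; apply: eq_Rintegral => w _; rewrite !indicE.
by rewrite (_ : _ + _ = (C + 1) * fine (mu D)); [rewrite mulrC -ler_pdivlMr// ltW|ring].
Qed.

End markov.

Lemma markov_of_fdd : is_markov P X I.
Proof.
move=> u t A uI tI ut mA; have tu0 : 0 < t - u by rewrite subr_gt0.
have hb : bm (heat (t - u) (\1_A)).
  by apply: heat_bm => //; exact/bm_intg/bm_indic.
have iZ : intg P (fun w => heat (t - u) (\1_A) (X u w)).
  by apply: bm_intg; exact: (bm_comp (fddP.1 _ uI) hb).
have iA : intg P (fun w => \1_A (X t w)).
  by apply: bm_intg; exact: (bm_comp (fddP.1 _ tI) (bm_indic R mA)).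
have sub : preimage_set_system [set: Omega] (X u) measurable `<=` past X I u.
  by move=> S HS; apply: sub_sigma_algebra; exists u => //; split => /=.
have main F : past X I u F -> \int[P]_(w in F) heat (t - u) (\1_A) (X u w) =
    \int[P]_(w in F) \1_A (X t w).
  move=> pF; have mF := past_measurable pF.
  have := markov_gap0 uI tI ut mA pF; rewrite /markov_gap RintegralB//.
  - by move=> /eqP; rewrite subr_eq0 => /eqP.
  - exact: integrableS iZ.
  - exact: integrableS iA.
have pre B : measurable B -> preimage_set_system [set: Omega] (X u) measurable
    ((fun w => heat (t - u) (\1_A) (X u w)) @^-1` B).
  move=> mB; exists (heat (t - u) (\1_A) @^-1` B); last by rewrite setTI.
  by rewrite -[X in measurable X]setTI; apply: hb.1.
exists (fun w => heat (t - u) (\1_A) (X u w)); split; split.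
- exact: pre.
- exact: iZ.
- by move=> F /sub; exact: main.
- by move=> B mB; exact: (sub _ (pre B mB)).
- exact: iZ.
- exact: main.
Qed.

End consequences.

(** * Asymptotics of the series of the moments *)

Section nonnegative_series.
Variable R : realType.
Implicit Types (g u : nat -> R) (b C : R).

Lemma series_nneg_nd u : (forall n, 0 <= u n) -> nondecreasing_seq (series u).
Proof. by move=> u0; apply: nondecreasing_series => n _ _. Qed.

Lemma series_nneg_bounded u C : (forall n, 0 <= u n) -> (forall n, series u n <= C) ->
  cvgn (series u) /\ limn (series u) <= C.
Proof.
move=> u0 uC; have cu : cvgn (series u).
  apply: nondecreasing_is_cvgn; first exact: series_nneg_nd.
  by exists C => _ [n _ <-].
by split => //; apply: limr_le => //; exact: nearW.
Qed.

Lemma series_nneg_le_lim u n : (forall n, 0 <= u n) -> cvgn (series u) ->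
  series u n <= limn (series u).
Proof. by move=> u0 cu; apply: nondecreasing_cvgn_le => //; exact: series_nneg_nd. Qed.

(** Weight of [n] when a level [m] is drawn with weight [g m], the bits before [m] agree, and each of
the others agrees with probability one half: [n] is the first bit that does not agree. *)
Definition smear g (n : nat) : R := (\sum_(0 <= m < n.+1) 2 ^+ m * g m) / 2 ^+ n.+1.

Lemma smearS g n : smear g n.+1 = 2^-1 * (smear g n + g n.+1).
Proof.
rewrite /smear big_nat_recr//= !exprS; have : 2 ^+ n != 0 :> R by rewrite expf_neq0.
by move: (2 ^+ n) (\sum_(0 <= m < n.+1) _) => k S k0; field.
Qed.

Lemma smear_ge0 g n : (forall n, 0 <= g n) -> 0 <= smear g n.
Proof.
move=> g0; rewrite /smear divr_ge0 ?exprn_ge0//; apply: sumr_ge0 => m _.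
by rewrite mulr_ge0 ?exprn_ge0.
Qed.

Lemma smear_partial g b N :
  (2 - b) * \sum_(0 <= n < N.+1) b ^+ n * smear g n =
  \sum_(0 <= n < N.+1) b ^+ n * g n - b ^+ N.+1 * smear g N.
Proof.
elim: N => [|N IH].
  by rewrite !big_nat1 /smear big_nat1 !expr0 !expr1; field.
rewrite big_nat_recr//= mulrDr IH [in RHS]big_nat_recr//= smearS !exprS.
by move: (\sum_(0 <= n < N.+1) b ^+ n * g n) => S; field.
Qed.

(** The generating function of the geometric law [2^-(k+1)] at [b] is [(2 - b)^-1]; the identity is
obtained from the partial sums, whose boundary term tends to zero. *)
Lemma smear_series g b : 0 < b -> b < 2 -> (forall n, 0 <= g n) ->
  cvgn (series (fun n => b ^+ n * g n)) ->
  cvgn (series (fun n => b ^+ n * smear g n)) /\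
  limn (series (fun n => b ^+ n * smear g n)) =
    (2 - b)^-1 * limn (series (fun n => b ^+ n * g n)).
Proof.
move=> b0 b2 g0 cB; have b2' : 0 < 2 - b by rewrite subr_gt0.
have bX n : 0 <= b ^+ n by rewrite exprn_ge0// ltW.
have u0 n : 0 <= b ^+ n * smear g n by rewrite mulr_ge0// smear_ge0.
have v0 n : 0 <= b ^+ n * g n by rewrite mulr_ge0.
have [cA _] : cvgn (series (fun n => b ^+ n * smear g n)) /\
    limn (series (fun n => b ^+ n * smear g n)) <=
    (2 - b)^-1 * limn (series (fun n => b ^+ n * g n)).
  apply: series_nneg_bounded => // -[|N].
    rewrite /series/= big_geq// mulr_ge0 ?invr_ge0 ?(ltW b2')//.
    by have := series_nneg_le_lim 0 v0 cB; rewrite /series/= big_geq.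
  rewrite mulrC ler_pdivlMr// mulrC /series/= smear_partial.
  apply: le_trans (series_nneg_le_lim N.+1 v0 cB).
  by rewrite lerBlDr lerDl mulr_ge0// smear_ge0.
split => //; have c0 := cvg_series_cvg_0 cA.
pose SA := series (fun n => b ^+ n * smear g n).
pose SB := series (fun n => b ^+ n * g n).
have cSB : (fun N => SB N.+1) @ \oo --> limn SB by rewrite (cvg_shiftS SB).
have cSA : (fun N => SA N.+1) @ \oo --> (2 - b)^-1 * (limn SB - b * 0).
  rewrite (_ : (fun N => SA N.+1) = (fun N => (2 - b)^-1 * (SB N.+1 - b * (b ^+ N * smear g N)))).
    apply: cvgM; first exact: cvg_cst.
    by apply: cvgB => //; apply: cvgM => //; exact: cvg_cst.
  apply/funext => N; rewrite mulrA -exprS /SB /SA /series/= -smear_partial mulKf//.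
  by rewrite gt_eqF.
rewrite mulr0 subr0 (cvg_shiftS SA) in cSA.
exact: cvg_lim cSA.
Qed.

Lemma sum_geometric_le (q : R) N : 1 < q -> \sum_(0 <= k < N) q ^+ k <= q ^+ N / (q - 1).
Proof.
move=> q1; have q0 : 0 < q - 1 by rewrite subr_gt0.
rewrite ler_pdivlMr//; elim: N => [|N IH]; first by rewrite big_geq// mul0r expr0 ler01.
by rewrite big_nat_recr//= mulrDl exprS; lra.
Qed.

End nonnegative_series.

Section regimes.
Variables (R : realType) (s beta : R).
Hypotheses (sP : s < s0 + 2) (betaP : - s0 < beta).
Local Notation r := (ratio s).
Local Notation gap := (gap s).
Local Notation delta := (delta s).

(** The moment of order [beta] weighs the points that first differ at the bit [n] by [base ^+ n]. *)
Definition base : R := 3 `^ (- beta).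
Local Notation b := base.

(** The moment, up to the factor [(2 - b)^-1]. *)
Definition profile (t : R) : R := limn (series (fun n => b ^+ n * delta t n)).

Lemma base_gt0 : 0 < b. Proof. by rewrite powR_gt0. Qed.

Lemma base_lt2 : b < 2.
Proof. by rewrite -powR3_s0; apply: powR3_lt; rewrite ltrNl. Qed.

Lemma baseX_ge0 n : 0 <= b ^+ n. Proof. by rewrite exprn_ge0// ltW// base_gt0. Qed.

Lemma base_ratio : b * r = 3 `^ (s0 + 2 - s - beta).
Proof.
rewrite /base /ratio -powRD; last by rewrite pnatr_eq0 implybT.
by congr (_ `^ _); ring.
Qed.

Lemma profile_term_ge0 t n : 0 < t -> 0 <= b ^+ n * delta t n.
Proof. by move=> t0; rewrite mulr_ge0 ?baseX_ge0// ltW// delta_gt0. Qed.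

Lemma profile_cvg t : 0 < t -> cvgn (series (fun n => b ^+ n * delta t n)).
Proof.
move=> t0; have [C C0 HC] := edecay_geometric sP t0 (ltW base_gt0).
have [] // := @geometric_series R (fun n => b ^+ n * delta t n) C.
move=> n; rewrite ger0_norm ?profile_term_ge0//; apply: le_trans (HC n).
by rewrite ler_wpM2l ?baseX_ge0// lerBlDr lerDl ltW// edecay_gt0.
Qed.

Lemma profile_le t C : 0 < t -> (forall N, \sum_(0 <= n < N) b ^+ n * delta t n <= C) ->
  profile t <= C.
Proof.
by move=> t0 H; have [] := series_nneg_bounded (fun n => profile_term_ge0 n t0) H.
Qed.

Lemma profile_ge t N : 0 < t -> \sum_(0 <= n < N) b ^+ n * delta t n <= profile t.
Proof.
by move=> t0; apply: series_nneg_le_lim (profile_cvg t0) => n; exact: profile_term_ge0.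
Qed.

Lemma gap_term_ge0 n : 0 <= b ^+ n * gap n.
Proof. by rewrite mulr_ge0 ?baseX_ge0// ltW// gap_gt0. Qed.

Lemma gap_series_cvg : s0 + 2 - s < beta -> cvgn (series (fun n => b ^+ n * gap n)).
Proof.
move=> sb; have br1 : b * r < 1.
  by rewrite base_ratio -[ltRHS](powRr0 3); apply: powR3_lt; rewrite subr_lt0.
have br0 : 0 < b * r by rewrite mulr_gt0 ?base_gt0 ?ratio_gt0.
apply: (@series_le_cvg _ _ (geometric 4 (b * r))); last first.
- by apply: is_cvg_geometric_series; rewrite gtr0_norm.
- move=> n; rewrite /geometric/= exprMn mulrCA ler_wpM2l ?baseX_ge0//; exact: gap_le.
- by move=> n; rewrite /geometric/= mulr_ge0// exprn_ge0// ltW.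
- exact: gap_term_ge0.
Qed.

(** The upper bound is termwise; for the lower bound, finitely many terms carry almost all of the sum
and are linear in [t] up to [t ^+ 2]. *)
Lemma profile_supercritical (e : R) : s0 + 2 - s < beta -> 0 < e ->
  exists2 d, 0 < d & forall t, 0 < t -> t < d ->
    `|profile t - limn (series (fun n => b ^+ n * gap n)) * t| <= e * t.
Proof.
move=> sb e0; have cG := gap_series_cvg sb.
set G := limn _; have e2 : 0 < e / 2 by rewrite divr_gt0.
have [N _ HN] : \forall n \near \oo, `|G - series (fun n => b ^+ n * gap n) n| < e / 2.
  by move/cvgrPdist_lt : cG; apply.
have {HN} := HN N (leqnn N); set S := series _ N => HN.
pose K := \sum_(0 <= n < N) b ^+ n * gap n * lambda s n.+1.
have K0 : 0 <= K.
  by apply: sumr_ge0 => n _; rewrite mulr_ge0 ?gap_term_ge0// lambda_ge0.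
have K1 : 0 < K + 1 by rewrite ltr_wpDl.
exists (e / 2 / (K + 1)); first by rewrite divr_gt0.
move=> t t0; rewrite ltr_pdivlMr// => tK.
have up : profile t <= G * t.
  apply: profile_le => // M; apply: (@le_trans _ _ ((\sum_(0 <= n < M) b ^+ n * gap n) * t)).
    rewrite mulr_suml; apply: ler_sum => n _; rewrite -mulrA ler_wpM2l ?baseX_ge0// mulrC.
    exact: delta_le.
  by rewrite ler_wpM2r ?(ltW t0)//; apply: (series_nneg_le_lim M gap_term_ge0 cG).
have lo : S * t - t ^+ 2 * K <= profile t.
  apply: le_trans (profile_ge N t0); rewrite /S /series/= /K mulr_suml mulr_sumr -sumrB.
  apply: ler_sum => n _; apply: (@le_trans _ _ (b ^+ n * (t * gap n * (1 - t * lambda s n.+1)))).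
    by rewrite le_eqVlt; apply/orP; left; apply/eqP; ring.
  by rewrite ler_wpM2l ?baseX_ge0//; exact: delta_ge.
have SG : S <= G by exact: (series_nneg_le_lim N gap_term_ge0 cG).
move: HN; rewrite ger0_norm ?subr_ge0// => HN.
rewrite ler0_norm ?subr_le0// opprB; nra.
Qed.

(** The level at which [t * r ^+ n] is of order one: the coarser levels have hardly started to relax
at time [t], the finer ones are in equilibrium. *)
Definition cutoff (t : R) : nat := (Num.truncn (ln t^-1 / ln r)).+1.

Lemma ln_ratio_gt0 : 0 < ln r. Proof. by rewrite ln_gt0// ratio_gt1. Qed.

Lemma cutoff_bounds t : 0 < t -> t < 1 ->
  [/\ ln t^-1 / ln r < (cutoff t)%:R, (cutoff t)%:R <= ln t^-1 / ln r + 1,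
      1 <= t * r ^+ cutoff t & t * r ^+ cutoff t <= r].
Proof.
move=> t0 t1; have ti0 : 0 < t^-1 by rewrite invr_gt0.
have L0 : 0 <= ln t^-1 / ln r.
  by rewrite divr_ge0 ?(ltW ln_ratio_gt0)// ln_ge0// invf_ge1// ltW.
have c1 : ln t^-1 / ln r < (cutoff t)%:R by exact: truncnS_gt.
have c2 : (cutoff t)%:R <= ln t^-1 / ln r + 1.
  by rewrite /cutoff -natr1 lerD2r; rewrite truncn_le.
have rX n : r ^+ n = expR (n%:R * ln r) by rewrite expRM_natl lnK// posrE ratio_gt0.
have tE : t = expR (- ln t^-1) by rewrite lnV ?posrE// opprK lnK.
split => //.
  rewrite rX {1}tE -expRD -[leLHS]expR0 ler_expR addrC subr_ge0.
  by rewrite -ler_pdivrMr ?ln_ratio_gt0// ltW.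
rewrite rX {1}tE -expRD -[leRHS](lnK (_ : r \in Num.pos)) ?posrE ?ratio_gt0//.
rewrite ler_expR addrC lerBlDr -ler_pdivlMr ?ln_ratio_gt0// mulrDl mulfV ?gt_eqF ?ln_ratio_gt0//.
by rewrite addrC.
Qed.

(** For [1 <= n < cutoff t] every term is about [t] times the same constant [2 (2 - b)], with a total
error [O(t)]; beyond the cutoff the weights [delta] add up to at most one and [b^n <= t]. *)
Lemma profile_critical : beta = s0 + 2 - s ->
  exists2 K, 0 <= K & forall t, 0 < t -> t < 1 ->
    `|profile t - 2 * (2 - b) * (t * (ln t^-1 / ln r))| <= K * t.
Proof.
move=> bE; have r1 := ratio_gt1 sP; have r0 := ratio_gt0 sP.
have br : b * r = 1 by rewrite base_ratio bE subrr powRr0.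
have bV : b = r^-1 by apply: (mulIf (lt0r_neq0 r0)); rewrite br mulVf// gt_eqF.
have b1 : b < 1 by rewrite bV invf_lt1.
set D : R := 2 * (2 - b).
have D0 : 0 < D by rewrite mulr_gt0// subr_gt0 base_lt2.
have DE n : b ^+ n.+1 * gap n.+1 = D.
  rewrite gapS bV exprS exprVn /D bV.
  have : r ^+ n != 0 by rewrite expf_neq0// gt_eqF.
  by move=> rn; field; rewrite rn gt_eqF.
pose K1 := 4 * r / (r - 1).
have rm1 : 0 < r - 1 by rewrite subr_gt0.
have K10 : 0 <= K1 by apply: divr_ge0; [apply: mulr_ge0 => //|]; exact: ltW.
pose K2 := K1 * (r / (r - 1)).
have K20 : 0 <= K2 by apply: mulr_ge0 => //; apply: divr_ge0; exact: ltW.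
have K1E n : lambda s n.+1 <= K1 * r ^+ n by exact: lambdaS_le.
have K2E : K2 = K1 * (r / (r - 1)) by [].
clearbody D K1 K2.
have D0' := ltW D0; have DK0 : 0 <= D * K2 by exact: mulr_ge0.
exists (D + 5 + D * K2); first by apply: addr_ge0 => //; apply: addr_ge0.
move=> t t0 t1; have [c1 c2 c3 c4] := cutoff_bounds t0 t1.
set L := ln t^-1 / ln r in c1 c2 *; set N := cutoff t in c1 c2 c3 c4.
have [N' NE] : exists N', N = N'.+1 by rewrite /N /cutoff; eexists.
have L0 : 0 <= L by rewrite divr_ge0 ?(ltW ln_ratio_gt0)// ln_ge0// invf_ge1// ltW.
clearbody L N.
(* The levels below the cutoff; the level zero has the exceptional gap 4. *)
have first_ub : \sum_(0 <= n < N) b ^+ n * delta t n <= t * (4 + D * N%:R).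
  rewrite NE big_nat_recl//= expr0 mul1r mulrDr; apply: lerD.
    by have := delta_le sP t0 0%N; rewrite gap0.
  apply: (@le_trans _ _ (\sum_(0 <= n < N') t * D)).
    apply: ler_sum => n _; rewrite -(DE n) mulrCA ler_wpM2l ?baseX_ge0//; exact: delta_le.
  rewrite big_const_nat subn0 iter_addr_0 -(mulr_natr (t * D) N') -mulrA ler_wpM2l ?(ltW t0)//.
  by rewrite ler_wpM2l ?(ltW D0)// ler_nat.
have up : profile t <= t * (D * L + (D + 5)).
  apply: profile_le => // M.
  have tail : \sum_(N <= n < maxn N M) b ^+ n * delta t n <= t.
    apply: (@le_trans _ _ (\sum_(N <= n < maxn N M) b ^+ N * delta t n)).
      rewrite big_nat [leRHS]big_nat; apply: ler_sum => n /andP[Nn _].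
      rewrite ler_wpM2r ?(ltW (delta_gt0 sP t0 n))//.
      by apply: ler_wiXn2l => //; [exact/ltW/base_gt0|exact: ltW].
    rewrite -mulr_sumr sum_delta ?leq_maxl//.
    apply: (@le_trans _ _ (b ^+ N * 1)).
      rewrite ler_wpM2l ?baseX_ge0// lerBlDr (le_trans (edecay_le1 sP N (ltW t0)))//.
      by rewrite lerDl ltW// edecay_gt0.
    rewrite mulr1 bV exprVn -[leLHS]mul1r ler_pdivrMr ?exprn_gt0//.
  have mono : \sum_(0 <= n < M) b ^+ n * delta t n <= \sum_(0 <= n < maxn N M) b ^+ n * delta t n.
    by apply: (series_nneg_nd (fun n => profile_term_ge0 n t0)); exact: leq_maxr.
  apply: (le_trans mono); rewrite (big_cat_nat (n := N) (leq0n _) (leq_maxl _ _))/=.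
  by have := ler_wpM2l (ltW t0) (ler_wpM2l (ltW D0) c2); lra.
have lo : t * (D * L) - t * (D + D * K2) <= profile t.
  apply: le_trans (profile_ge N t0).
  have H : t * D * (N%:R - 1) - t ^+ 2 * D * \sum_(0 <= n < N) lambda s n.+1 <=
      \sum_(0 <= n < N) b ^+ n * delta t n.
    have SE : \sum_(0 <= n < N'.+1) lambda s n.+1 = lambda s 1 + \sum_(0 <= i < N') lambda s i.+2.
      exact: big_nat_recl.
    rewrite NE [leRHS]big_nat_recl//= SE expr0 mul1r -natr1 addrK.
    have d0 : 0 <= delta t 0 by exact/ltW/delta_gt0.
    have l0 : 0 <= t ^+ 2 * D * lambda s 1.
      by apply: mulr_ge0; [apply: mulr_ge0 => //; exact: sqr_ge0|exact: lambda_ge0].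
    suff : t * D * N'%:R - t ^+ 2 * D * \sum_(0 <= i < N') lambda s i.+2 <=
        \sum_(0 <= i < N') b ^+ i.+1 * delta t i.+1 by lra.
    have -> : t * D * N'%:R = \sum_(0 <= i < N') t * D.
      by rewrite big_const_nat subn0 iter_addr_0 mulr_natr.
    rewrite mulr_sumr -sumrB; apply: ler_sum => n _.
    apply: (@le_trans _ _ (b ^+ n.+1 * (t * gap n.+1 * (1 - t * lambda s n.+2)))).
      by rewrite -(DE n) le_eqVlt; apply/orP; left; apply/eqP; ring.
    by rewrite ler_wpM2l ?baseX_ge0//; exact: delta_ge.
  have S1 : t * \sum_(0 <= n < N) lambda s n.+1 <= K2.
    apply: (@le_trans _ _ (t * (K1 * (r ^+ N / (r - 1))))).
      rewrite ler_wpM2l ?(ltW t0)//; apply: (@le_trans _ _ (K1 * \sum_(0 <= n < N) r ^+ n)).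
        by rewrite mulr_sumr; apply: ler_sum => n _; exact: K1E.
      by rewrite ler_wpM2l//; exact: sum_geometric_le.
    rewrite mulrCA K2E ler_wpM2l// mulrA ler_wpM2r// invr_ge0 (ltW rm1)//.
  refine (le_trans _ H).
  have : t * D * (t * \sum_(0 <= n < N) lambda s n.+1) <= t * D * K2.
    apply: ler_wpM2l => //; exact: (mulr_ge0 (ltW t0) D0').
  have : t * D * L <= t * D * N%:R by exact: (ler_wpM2l (mulr_ge0 (ltW t0) D0') (ltW c1)).
  by rewrite expr2; lra.
rewrite mulrCA ler_norml; apply/andP; split.
  by lra.
by have := mulr_ge0 DK0 (ltW t0); lra.
Qed.

(** [b] is the power of [r] with exponent [- beta / (s0 + 2 - s)], and [t * r ^+ N] lies in [[1, r]]; the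
factor 2 bounds [b], for negative [beta]. *)
Lemma baseX_cutoff t : 0 < t -> t < 1 ->
  b ^+ cutoff t <= 2 * t `^ (beta / (s0 + 2 - s)).
Proof.
move=> t0 t1; have [_ _ c3 c4] := cutoff_bounds t0 t1.
have g0 : 0 < s0 + 2 - s by rewrite subr_gt0.
have l3 : 0 < ln 3 :> R by rewrite ln_gt0// ltr1n.
have lr : ln r = (s0 + 2 - s) * ln 3 by rewrite /ratio ln_powR.
have lb : ln b = - beta / (s0 + 2 - s) * ln r.
  by rewrite /base ln_powR lr; field; rewrite gt_eqF.
set N := cutoff t in c3 c4 *.
have trN0 : 0 < t * r ^+ N by rewrite mulr_gt0// exprn_gt0// ratio_gt0.
have bN : b ^+ N = expR (- beta / (s0 + 2 - s) * ln (t * r ^+ N)) * t `^ (beta / (s0 + 2 - s)).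
  rewrite /powR gt_eqF// -expRD lnM ?posrE// ?exprn_gt0 ?ratio_gt0//.
  rewrite lnXn ?ratio_gt0// -mulr_natl -[in LHS](lnK (_ : b \in Num.pos)) ?posrE ?base_gt0//.
  by rewrite -expRM_natl; congr expR; rewrite lb; field; rewrite gt_eqF.
rewrite bN ler_wpM2r ?powR_ge0//.
have ltr0 : 0 <= ln (t * r ^+ N) by rewrite ln_ge0.
have [b0|b0] := leP 0 beta.
  apply: (@le_trans _ _ 1); last by rewrite ler1n.
  by rewrite expR_le1 mulNr mulNr oppr_le0 mulr_ge0// divr_ge0// ltW.
apply: le_trans (ltW base_lt2); rewrite -[leRHS]lnK ?posrE ?base_gt0// ler_expR lb.
rewrite ler_wpM2l//; first by rewrite divr_ge0 ?(ltW g0)// oppr_ge0 ltW.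
by rewrite ler_ln ?posrE ?ratio_gt0.
Qed.

(** Below the cutoff the terms grow geometrically with ratio [b r > 1]; beyond it they decrease
super-exponentially. Both parts are of the order of the term at the cutoff. *)
Lemma profile_subcritical : beta < s0 + 2 - s ->
  exists2 K, 0 <= K & forall t, 0 < t -> t < 1 ->
    profile t <= K * t `^ (beta / (s0 + 2 - s)).
Proof.
move=> bs; have r1 := ratio_gt1 sP; have r0 := ratio_gt0 sP; have b0 := base_gt0.
have br1 : 1 < b * r.
  by rewrite base_ratio -[ltLHS](powRr0 3); apply: powR3_lt; rewrite subr_gt0.
have q0 : 0 < b * r - 1 by rewrite subr_gt0.
have c0 : 0 < 4 / r by rewrite divr_gt0.
have [C C0 HC] := expRN_geometric r1 c0 (ltW b0).
pose K := 4 * r / (b * r - 1) + 2 * C.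
have K0 : 0 <= K by rewrite addr_ge0 ?mulr_ge0 ?invr_ge0 ?(ltW r0) ?(ltW q0)//.
exists (K * 2); first by rewrite mulr_ge0.
move=> t t0 t1; have [_ _ c3 c4] := cutoff_bounds t0 t1.
apply: (@le_trans _ _ (K * b ^+ cutoff t)); last first.
  by rewrite -mulrA ler_wpM2l//; exact: baseX_cutoff.
set N := cutoff t in c3 c4 *.
apply: profile_le => // M.
have mono : \sum_(0 <= n < M) b ^+ n * delta t n <= \sum_(0 <= n < maxn N M) b ^+ n * delta t n.
  by apply: (series_nneg_nd (fun n => profile_term_ge0 n t0)); exact: leq_maxr.
apply: (le_trans mono); rewrite (big_cat_nat (n := N) (leq0n _) (leq_maxl _ _))/=.
rewrite /K mulrDl; apply: lerD.
  apply: (@le_trans _ _ (t * 4 * \sum_(0 <= n < N) (b * r) ^+ n)).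
    rewrite mulr_sumr; apply: ler_sum => n _; rewrite exprMn.
    apply: (@le_trans _ _ (b ^+ n * (t * gap n))).
      by rewrite ler_wpM2l ?baseX_ge0//; exact: delta_le.
    rewrite mulrCA -[leRHS]mulrA ler_wpM2l ?(ltW t0)// mulrCA ler_wpM2l ?baseX_ge0//.
    exact: gap_le.
  apply: (@le_trans _ _ (t * 4 * ((b * r) ^+ N / (b * r - 1)))).
    by rewrite ler_wpM2l ?mulr_ge0 ?(ltW t0)//; exact: sum_geometric_le.
  have bN0 := baseX_ge0 N; rewrite exprMn.
  move: (b ^+ N) (r ^+ N) bN0 c4 q0 => x y x0; move: (b * r - 1) => q c4 q0.
  have -> : t * 4 * (x * y / q) = (t * y) * (4 / q * x) by ring.
  have -> : 4 * r / q * x = r * (4 / q * x) by ring.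
  by rewrite ler_wpM2r// mulr_ge0// divr_ge0// ltW.
rewrite -{1}(add0n N) big_addn.
apply: (@le_trans _ _ (\sum_(0 <= j < maxn N M - N) b ^+ N * (C * 2 ^- j))).
  apply: ler_sum => j _; rewrite exprD -mulrA mulrCA ler_wpM2l ?baseX_ge0//.
  apply: le_trans (HC j); rewrite ler_wpM2l ?baseX_ge0//.
  apply: (@le_trans _ _ (edecay s t (j + N))).
    by rewrite lerBlDr lerDl ltW// edecay_gt0.
  rewrite /edecay ler_expR lerN2.
  have [N' NE] : exists N', N = N'.+1 by rewrite /N /cutoff; eexists.
  have := ler_wpM2l (ltW t0) (lambdaS_ge sP (j + N')); rewrite -addnS -NE; apply: le_trans.
  have -> : t * (4 * r ^+ (j + N')) = 4 / r * (t * r ^+ N) * r ^+ j.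
    by rewrite NE exprD exprS; field; rewrite gt_eqF.
  by rewrite ler_wpM2r ?exprn_ge0 ?(ltW r0)// ler_peMr// (ltW c0).
rewrite -!mulr_sumr mulrC ler_wpM2r ?baseX_ge0// mulrC ler_wpM2r//.
by have := @sum_geometric2 R 0 _ (leq0n (maxn N M - N)); rewrite expr0 invr1 mulr1.
Qed.

(** The coefficients are [2 b^n] times the smeared gaps; the index zero gives [lambda s 1]. *)
Lemma supercritical_constant : s0 + 2 - s < beta ->
  cvgn (series (fun n => displacement_coef s beta n.+1)) /\
  lambda s 1 / 2 + 2^-1 * limn (series (fun n => displacement_coef s beta n.+1)) =
  (2 - b)^-1 * limn (series (fun n => b ^+ n * gap n)).
Proof.
move=> sb; have cG := gap_series_cvg sb.
have [cS eS] := smear_series base_gt0 base_lt2 (fun n => ltW (gap_gt0 sP n)) cG.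
have b0 := base_gt0.
have dE n : displacement_coef s beta n = 2 * (b ^+ n * smear gap n).
  have this : 2 ^+ n * lambda s n.+1 - \sum_(1 <= m < n.+1) 2 ^+ m.-1 * lambda s m =
     \sum_(0 <= m < n.+1) 2 ^+ m * gap m.
    elim: n => [|n IH]; first by rewrite big_geq// big_nat1 /gap lambda0 expr0; ring.
    rewrite [in RHS]big_nat_recr// -IH [X in _ - X]big_nat_recr// /gap exprS.
    move: (\sum_(1 <= m < n.+1) _) (lambda s n.+1) (lambda s n.+2) => S l1 l2 /=.
    by ring.
  have X0 : 2 ^+ n != 0 :> R by rewrite expf_neq0.
  have bE : 3 `^ beta = b^-1 by rewrite /base powRN invrK.
  have b1 : b ^+ n != 0 by rewrite expf_neq0// gt_eqF.
  rewrite /displacement_coef this /smear bE exprMn exprVn exprS.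
  by move: (b ^+ n) (2 ^+ n) b1 X0 (\sum_(_ <= m < _) _) => x y x0 y0 z; field; rewrite x0 y0.
pose v n := b ^+ n * smear gap n.
have cS' : cvgn (series v) by exact: cS.
have uE : series (fun n => displacement_coef s beta n.+1) = (fun N => 2 * (series v N.+1 - v 0%N)).
  apply/funext => N; rewrite /series/= big_nat_recl// addrAC subrr add0r mulr_sumr.
  by apply: eq_bigr => n _; rewrite dE.
have cu : (fun N => 2 * (series v N.+1 - v 0%N)) @ \oo --> 2 * (limn (series v) - v 0%N).
  apply: cvgM; first exact: cvg_cst.
  by apply: cvgB; [rewrite (cvg_shiftS (series v))|exact: cvg_cst].
have v0 : 2 * v 0%N = lambda s 1.
  by rewrite -dE /displacement_coef big_geq// !expr0 subr0 invr1 !mul1r.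
rewrite uE; split; first by apply/cvg_ex; eexists; exact: cu.
rewrite (cvg_lim _ cu)// -[in RHS]eS -v0; rewrite -/v; move: (limn _) (v 0%N) => l w.
by field.
Qed.

(** [ln r] is [beta * ln 3] at the critical exponent, and [3 `^ (beta + s0)] is [2 / b]. *)
Lemma critical_constant : beta = s0 + 2 - s ->
  (beta * ln 3)^-1 * ((1 - 3 `^ (- beta))^-1 + 1) * (1 - (3 `^ (beta + s0) - 1)^-1) =
  (2 - b)^-1 * (2 * (2 - b) / ln r).
Proof.
move=> bE; have beta0 : 0 < beta by rewrite bE subr_gt0.
have l3 : 0 < ln 3 :> R by rewrite ln_gt0// ltr1n.
have -> : ln r = beta * ln 3 by rewrite /ratio ln_powR bE.
have -> : 3 `^ (beta + s0) = 2 / b.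
  rewrite powRD; last by rewrite pnatr_eq0 implybT.
  by rewrite powR3_s0 /base powRN invrK mulrC.
rewrite -/b; have b0 := base_gt0; have b2 := base_lt2.
have b1 : b < 1 by rewrite /base -[ltRHS](powRr0 3); apply: powR3_lt; rewrite oppr_lt0.
have b1' : 1 - b != 0 by rewrite gt_eqF// subr_gt0.
have b2' : 2 - b != 0 by rewrite gt_eqF// subr_gt0.
have b0' : b != 0 by rewrite gt_eqF.
have l3' : ln 3 != 0 :> R by rewrite gt_eqF.
have beta0' : beta != 0 by rewrite gt_eqF.
by field; rewrite b1' b2' b0' l3' beta0'.
Qed.

Lemma equiv_right (f g : R -> R) :
  (forall e, 0 < e -> exists2 d, 0 < d &
     forall t, 0 < t -> t < d -> `|f t - g t| <= e * `|g t|) ->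
  f ~_(0^'+) g.
Proof.
move=> H; apply/eqaddoP => e e0; have [d d0 Hd] := H e e0.
by near=> t; apply: Hd; near: t; [exact: nbhs_right_gt|exact: nbhs_right_lt].
Unshelve. all: end_near. Qed.

Lemma moment_of_profile (M : R -> R) :
  (forall t, 0 < t -> M t = (2 - b)^-1 * profile t) ->
  [/\ s0 + 2 - s < beta ->
        let u n := displacement_coef s beta n.+1 in
        cvgn (series u) /\
        M ~_(0^'+) (fun t => (lambda s 1 / 2 + 2^-1 * limn (series u)) * t),
      beta = s0 + 2 - s ->
        M ~_(0^'+)
          (fun t => (beta * ln 3)^-1 * ((1 - 3 `^ (- beta))^-1 + 1)
                    * (1 - (3 `^ (beta + s0) - 1)^-1) * (t * ln t^-1)) &
      beta < s0 + 2 - s ->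
        M =O_ (0^'+) (fun t => t `^ (beta / (s0 + 2 - s)) * ln t^-1)].
Proof.
move=> ME; have b20 : 0 < 2 - b by rewrite subr_gt0 base_lt2.
have bi0 : 0 < (2 - b)^-1 by rewrite invr_gt0.
split => [sb|sb|sb].
- have [cu cE] := supercritical_constant sb; cbv zeta; rewrite cE; split => //; apply: equiv_right => e e0.
  set G := limn _; have G0 : 0 < G.
    apply: lt_le_trans (series_nneg_le_lim 1 gap_term_ge0 (gap_series_cvg sb)).
    by rewrite /series/= big_nat1 expr0 mul1r gap_gt0.
  have [d d0 Hd] := profile_supercritical sb (mulr_gt0 e0 G0).
  exists d => // t t0 td; rewrite ME// -mulrA -mulrBr normrM gtr0_norm//.
  rewrite normrM [`|_^-1|]gtr0_norm// mulrCA ler_wpM2l ?(ltW bi0)//.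
  by apply: (le_trans (Hd t t0 td)); rewrite gtr0_norm ?mulr_gt0// mulrA.
- have [K K0 HK] := profile_critical sb; rewrite critical_constant//.
  apply: equiv_right => e e0; pose K' := K * ln r / (2 * (2 - b) * e).
  exists (Num.min 1 (expR (- K'))); first by rewrite lt_min ltr01 expR_gt0.
  move=> t t0; rewrite lt_min => /andP[t1 tK].
  have KL : K' <= ln t^-1.
    by rewrite lnV ?posrE// lerNr -ler_expR lnK ?posrE// ltW.
  rewrite ME// -mulrA -mulrBr normrM (gtr0_norm bi0) [X in _ <= e * X]normrM (gtr0_norm bi0) [e * _]mulrCA ler_wpM2l ?(ltW bi0)//.
  have := HK t t0 t1; rewrite [X in _ - X](_ : _ = 2 * (2 - b) / ln r * (t * ln t^-1)).
    move=> h; apply: (le_trans h).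
    have lr0 := ln_ratio_gt0.
    have D0 : 0 < 2 * (2 - b) / ln r by rewrite divr_gt0// mulr_gt0.
    have L0 : 0 <= ln t^-1 by rewrite ln_ge0// invf_ge1// ltW.
    rewrite (ger0_norm (mulr_ge0 (ltW D0) (mulr_ge0 (ltW t0) L0))).
    have -> : e * (2 * (2 - b) / ln r * (t * ln t^-1)) =
        ln t^-1 * (2 * (2 - b) * e / ln r) * t by ring.
    rewrite ler_wpM2r ?(ltW t0)//; apply: le_trans (_ : K' * (2 * (2 - b) * e / ln r) <= _).
      rewrite le_eqVlt; apply/orP; left; apply/eqP; rewrite /K'.
      by field; rewrite !gt_eqF.
    by rewrite ler_wpM2r// ltW// divr_gt0// !mulr_gt0.
  by ring.
- have [K K0 HK] := profile_subcritical sb; apply/eqO_exP.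
  exists ((2 - b)^-1 * K + 1); first by rewrite ltr_wpDl// mulr_ge0// ltW.
  near=> t.
  have t0 : 0 < t by near: t; exact: nbhs_right_gt.
  have te : t < expR (- 1) by near: t; apply: nbhs_right_lt; exact: expR_gt0.
  have t1 : t < 1 by apply: lt_trans te _; rewrite -[ltRHS]expR0 ltr_expR oppr_lt0.
  have L1 : 1 <= ln t^-1.
    by rewrite lnV ?posrE// lerNr -ler_expR lnK ?posrE// ltW.
  have p0 : 0 <= profile t.
    by apply: le_trans (profile_ge 0 t0); rewrite big_geq.
  have x0 := powR_ge0 t (beta / (s0 + 2 - s)).
  rewrite ME// ger0_norm; last by rewrite mulr_ge0// ltW.
  rewrite ger0_norm; last by rewrite mulr_ge0// (le_trans ler01).
  apply: le_trans (_ : ((2 - b)^-1 * K + 1) * t `^ (beta / (s0 + 2 - s)) <= _); last first.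
    by rewrite ler_wpM2l ?ler_peMr// addr_ge0// mulr_ge0// ltW.
  rewrite mulrDl mul1r; apply: ler_wpDr => //; rewrite -mulrA ler_wpM2l ?(ltW bi0)//.
  exact: HK.
Unshelve. all: end_near. Qed.

End regimes.

(** * Moments of the displacement *)

Section separation.
Variable R : realType.
Implicit Types (x y : C3) (c : nat -> R).

Lemma nneseries_EFin (u : nat -> R) : cvgn (series u) ->
  (\sum_(0 <= m <oo) (u m)%:E = (limn (series u))%:E)%E.
Proof.
by move=> cu; rewrite -EFin_lim//; congr (limn _); apply/funext => n; rewrite /= sumEFin.
Qed.

(** Indicator of the pairs that first differ at the bit [n]. *)
Definition sep n x y : R := same R n x y - same R n.+1 x y.

Lemma sep_refl n x : sep n x x = 0.
Proof. by rewrite /sep /same !eqxx subrr. Qed.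

Lemma sepE n m x y : pre n x = pre n y -> x n != y n -> sep m x y = (m == n)%:R.
Proof.
move=> e ne; rewrite /sep /same; have [mn|nm|->] := ltngtP m n.
- by rewrite (pre_le (ltnW mn) e) (pre_le mn e) !eqxx subrr.
- have H k : (n < k)%N -> (pre k x == pre k y) = false.
    by move=> nk; apply/eqP => /pre_eqP/(_ n nk)/eqP; apply/negP.
  by rewrite !H ?subrr// ltnS ltnW.
- rewrite e eqxx; case: (pre n.+1 x =P pre n.+1 y) => [/pre_eqP/(_ n (leqnn _))/eqP|_].
    by rewrite (negbTE ne).
  by rewrite subr0.
Qed.

Lemma sep_ge0 n x y : 0 <= sep n x y.
Proof.
have [[-> _]|[m [e ne _]]] := distP R x y; first by rewrite sep_refl.
by rewrite (sepE _ e ne).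
Qed.

Lemma sep_series c n x y : dist R x y = 3 ^- n ->
  series (fun m => c m * sep m x y) @ \oo --> c n.
Proof.
move=> /dist_eqP[e /eqP ne]; apply: cvg_near_cst; exists n.+1 => // N /= nN.
rewrite /series/= (big_cat_nat (n := n.+1) (leq0n _) nN)/= big_nat_recr//=.
rewrite (sepE _ e ne) eqxx mulr1 big_nat big1 ?add0r => [|m /= mn]; last first.
  by rewrite (sepE _ e ne) (ltn_eqF mn) mulr0.
rewrite big_nat big1 ?addr0// => m /andP[nm _].
by rewrite (sepE _ e ne) (gtn_eqF nm) mulr0.
Qed.

Lemma dist_series x y : series (fun m => 3 ^- m * sep m x y) @ \oo --> dist R x y.
Proof.
have [[-> ->]|[n [e ne d]]] := distP R x y; last by rewrite d; exact: sep_series d.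
apply: cvg_near_cst; exists 0%N => // N _; rewrite /series/= big1// => m _.
by rewrite sep_refl mulr0.
Qed.

Lemma bm_sep n : bm (fun z : C3 * C3 => sep n z.1 z.2).
Proof. by apply: bmB; exact: bm_same. Qed.

Lemma measurable_dist : measurable_fun setT (fun z : C3 * C3 => dist R z.1 z.2).
Proof.
apply: (measurable_fun_cvg (h := fun N z => series (fun m => 3 ^- m * sep m z.1 z.2) N)).
  move=> N; have [] : bm (fun z : C3 * C3 => series (fun m => 3 ^- m * sep m z.1 z.2) N) => //.
  by apply: bm_sum => m _; apply: bmZ; exact: bm_sep.
by move=> z _; exact: dist_series.
Qed.

End separation.

Section moments.
Variables (R : realType) (mu : probability C3 R) (s : R).
Hypotheses (muP : is_mu mu) (sP : s < s0 + 2).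
Variables (d : measure_display) (Omega : measurableType d).
Variables (P : probability Omega R) (X : R -> Omega -> C3) (I : set R).
Hypothesis fddP : has_fdd mu s P X I.
Local Notation heat := (heat s mu).
Local Notation delta := (delta s).
Local Notation edecay := (edecay s).

(** Probability that the first [n] bits agree at two times at distance [t]. *)
Definition agreement (t : R) n : R := 2 ^- n * \sum_(0 <= k < n) 2 ^+ k * delta t k + edecay t n.

Lemma heat_indic_pre t n x : 0 < t -> heat t (\1_(cylinder (pre n x))) x = agreement t n.
Proof.
move=> t0; have l : lev n (\1_(cylinder (pre n x)) : C3 -> R).
  by have := @lev_indic R (pre n x); rewrite size_pre.
rewrite (heat_lev sP muP t0 l) /agreement; congr (_ + _); last first.
  by rewrite indicE mem_set ?mulr1//; exact/cylinder_pre.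
rewrite mulr_sumr big_nat [RHS]big_nat; apply: eq_bigr => k /andP[_ kn].
rewrite /E /cint; under eq_Rintegral do rewrite mulrC.
rewrite -[X in _ * (_ * X)]/(cint mu (pre n x) (\1_(cylinder (pre k x)))).
rewrite (cint_const muP (c := 1)); first by rewrite size_pre mul1r; ring.
move=> y /cylinder_pre e; rewrite indicE mem_set//; apply/cylinder_pre.
exact: pre_le (ltnW kn) e.
Qed.

Lemma agreement_sep t n : agreement t n - agreement t n.+1 = smear (delta t) n.
Proof.
rewrite /agreement /smear big_nat_recr//= exprS.
have -> : edecay t n.+1 = edecay t n - delta t n by rewrite /delta; ring.
have : 2 ^+ n != 0 :> R by rewrite expf_neq0.
by move: (2 ^+ n) (\sum_(_ <= k < _) _) => x S x0; field.
Qed.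

Lemma agreement_le t : 0 < t -> exists2 C, 0 <= C & forall n, agreement t n <= C * 2 ^- n.
Proof.
move=> t0; have [C C0 HC] := kernel_summable sP t0.
have [D D0 HD] := edecay_geometric sP t0 (ler01 : 0 <= 1 :> R).
exists (2 * C + D); first by rewrite addr_ge0// mulr_ge0.
move=> n; rewrite /agreement mulrDl; apply: lerD; last first.
  by have := HD n; rewrite expr1n mul1r.
rewrite mulrC ler_wpM2r ?invr_ge0 ?exprn_ge0//.
apply: (@le_trans _ _ (\sum_(0 <= k < n) C * 2 ^- k)); first by apply: ler_sum => k _; exact: HC.
rewrite -mulr_sumr mulrC ler_wpM2r//.
by have := @sum_geometric2 R 0 n (leq0n n); rewrite expr0 invr1 mulr1.
Qed.

Variables t0 t : R.
Hypotheses (t_gt0 : 0 < t) (It0 : I t0) (It : I (t0 + t)).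
Local Notation Y := (X t0).
Local Notation Z := (X (t0 + t)).

Lemma measurable_couple : measurable_fun setT (fun w => (Y w, Z w)).
Proof. by apply: measurable_fun_pair; apply: fddP.1. Qed.

Lemma bm_same_couple n : bm (fun w => same R n (Y w) (Z w)).
Proof. by apply: (bm_comp measurable_couple (f := fun z => same R n z.1 z.2)); exact: bm_same. Qed.

Lemma mean_same n : \int[P]_w same R n (Y w) (Z w) = agreement t n.
Proof.
under eq_Rintegral do rewrite same_sum.
have bX u v : I u -> bm (fun w => \1_(cylinder v) (X u w) : R).
  by move=> Iu; apply: (bm_comp (fddP.1 _ Iu)); exact: bm_cyl.
rewrite mean_sum; last by move=> v _; apply: bm_intg; apply: bmM; exact: bX.
have H (v : n.-tuple bool) : \int[P]_w (\1_(cylinder v) (Y w) * \1_(cylinder v) (Z w)) =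
    \int[mu]_x (\1_(cylinder v) x * agreement t n).
  have [_ /(_ n (fun=> \1_(cylinder v)) [:: t0 + t; t0])] := fddP.
  rewrite /= ltrDl t_gt0 => /(_ isT); set Q := \int[mu]_x _.
  move=> fd; transitivity Q.
    rewrite -fd; first by apply: eq_Rintegral => w _; rewrite !big_cons big_nil mulr1 mulrC.
      by move=> u; rewrite !inE => /orP[/eqP ->|/eqP ->].
    by move=> _; have := @lev_indic R v; rewrite size_tuple.
  apply: eq_Rintegral => x _; rewrite addrAC subrr add0r.
  rewrite (_ : (fun y => _) = \1_(cylinder v)); last by apply/funext => y; rewrite mulr1.
  rewrite [in LHS]indicE [in RHS]indicE; have [/set_mem/cylinderE|] := boolP (x \in cylinder v).
    by rewrite size_tuple => <-; rewrite heat_indic_pre.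
  by rewrite !mul0r.
under eq_bigr do rewrite H.
rewrite -mean_sum; last first.
  by move=> v _; apply: bm_intg; apply: bmM; [exact: bm_cyl|exact: bm_cst].
rewrite -[RHS](mean_cst mu); apply: eq_Rintegral => x _.
by rewrite -mulr_suml sum_indic_cylinder mul1r.
Qed.

(** A mixture of level [m <= n] makes the bits from [m] on independent and uniform. *)
Lemma mean_sep n : \int[P]_w sep R n (Y w) (Z w) = smear (delta t) n.
Proof. by rewrite -agreement_sep -!mean_same -meanB//; apply: bm_intg; exact: bm_same_couple. Qed.

(** The probability that the first [n] bits agree tends to zero. *)
Lemma moving_ae : {ae P, forall w, Y w <> Z w}.
Proof.
pose S := [set w | Y w = Z w].
have SE : S = (fun w => dist R (Y w) (Z w)) @^-1` [set 0].
  apply/seteqP; split=> w; rewrite /S /=; first by move=> ->; have [[]|[n []]] := distP R (Z w) (Z w) => //; rewrite eqxx.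
  have [[->//]|[n [_ _ ->]]] := distP R (Y w) (Z w).
  by move/eqP; rewrite invr_eq0 expf_eq0 pnatr_eq0 andbF.
have mS : measurable S.
  have md := measurableT_comp (@measurable_dist R) measurable_couple.
  by rewrite SE -[X in measurable X]setTI; apply: md.
have PS : fine (P S) = 0.
  have [C C0 HC] := agreement_le t_gt0; apply: (@geometric_eq0 R _ C 0) => M _.
  rewrite ger0_norm ?fine_ge0// -mean_indic//; apply: le_trans (HC M); rewrite -mean_same.
  apply: le_mean; [exact/bm_intg/bm_indic|exact/bm_intg/bm_same_couple|move=> w].
  rewrite indicE; case: (boolP (w \in S)) => [/set_mem e|_]; last by rewrite /same ler0n.
  by rewrite /same e eqxx.
exists S; split => //.
  by rewrite -[LHS]fineK ?PS// fin_num_measure.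
by move=> w /= /contrapT.
Qed.

Section exponent.
Variable beta : R.
Hypothesis betaP : - s0 < beta.
Local Notation b := (base beta).
Local Notation f := (fun w => dist R (Y w) (Z w) `^ beta).

Lemma measurable_displacement : measurable_fun setT f.
Proof.
apply: (measurableT_comp (measurable_powR _)).
exact: (measurableT_comp (@measurable_dist R) measurable_couple).
Qed.

(** The power of the distance is almost surely the sum of [b ^+ n] times the indicator of a first
difference at [n]; the terms are nonnegative and can be integrated one by one. *)
Lemma integral_displacement :
  (\int[P]_w (f w)%:E = ((2 - b)^-1 * profile s beta t)%:E)%E.
Proof.
have d0 n : 0 <= delta t n by exact/ltW/delta_gt0.
have [cS <-] := smear_series (base_gt0 beta) (base_lt2 betaP) d0 (profile_cvg sP t_gt0 (beta := beta)).
rewrite -nneseries_EFin//.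
have bs n : bm (fun w => b ^+ n * sep R n (Y w) (Z w)).
  apply: bmZ; apply: bmB; exact: bm_same_couple.
have sE n : (b ^+ n * smear (delta t) n)%:E =
    (\int[P]_w (b ^+ n * sep R n (Y w) (Z w))%:E)%E.
  rewrite EFin_mean; last exact: bm_intg.
  by rewrite meanZ ?mean_sep//; apply: bm_intg; apply: bmB; exact: bm_same_couple.
have mbs n : measurable_fun setT (fun w => (b ^+ n * sep R n (Y w) (Z w))%:E).
  by apply/measurable_EFinP; case: (bs n).
rewrite (eq_eseriesr (fun n _ => sE n)) -integral_nneseries//; last first.
  by move=> n w _; rewrite lee_fin mulr_ge0 ?sep_ge0 ?baseX_ge0.
apply: ae_eq_integral => //.
- exact/measurable_EFinP/measurable_displacement.
- by apply: ge0_emeasurable_sum => // n w _ _; rewrite lee_fin mulr_ge0 ?sep_ge0 ?baseX_ge0.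
apply: filterS moving_ae => w ne _.
have [[//]|[n [e ne' dE]]] := distP R (Y w) (Z w).
have c := @sep_series R (fun n => b ^+ n) n _ _ dE.
rewrite nneseries_EFin; last by apply/cvg_ex; eexists; exact: c.
rewrite (cvg_lim _ c)// dE; congr (_%:E).
rewrite -(powR_mulrn n (ler0n R 3)) -powRN -powRrM.
by rewrite /base -powR_mulrn ?powR_ge0// -powRrM; congr (_ `^ _); ring.
Qed.

Lemma displacement_integrable : P.-integrable setT (EFin \o f).
Proof.
apply/integrableP; split; first exact/measurable_EFinP/measurable_displacement.
rewrite (eq_integral (fun w => (f w)%:E)) ?integral_displacement ?ltey// => w _.
by rewrite gee0_abs// lee_fin powR_ge0.
Qed.

Lemma moment_profile : moment P X beta t0 t = (2 - b)^-1 * profile s beta t.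
Proof. by rewrite /moment unlock integral_displacement. Qed.

End exponent.
End moments.

Lemma moments_of_fdd (R : realType) (mu : probability C3 R) (s : R) (d : measure_display)
    (Omega : measurableType d) (P : probability Omega R) (X : R -> Omega -> C3) (I : set R) :
  is_mu mu -> s < s0 + 2 -> has_fdd mu s P X I ->
  (forall u h, 0 <= h -> I u -> I (u + h)) -> moment_asymptotics P X s I.
Proof.
move=> muP sP fddP Ih beta t0 betaP It0.
have [] := @moment_of_profile R s beta sP betaP (moment P X beta t0).
  by move=> t tp; apply: (moment_profile muP sP fddP) => //; apply: Ih => //; exact: ltW.
move=> A B C; split => // t tp.
by apply: (displacement_integrable muP sP fddP) => //; apply: Ih => //; exact: ltW.
Qed.

(** * Probabilities on compact spaces *)

(** A copy of the space, to carry the algebra of its clopen sets. *)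
Definition clopen_space (T : ptopologicalType) : Type := T.
HB.instance Definition _ (T : ptopologicalType) := Pointed.on (clopen_space T).
HB.instance Definition _ (T : ptopologicalType) :=
  @isAlgebraOfSets.Build default_measure_display (clopen_space T) (@clopen T)
    clopen0 clopenU (fun A => @clopenC T A A).

Section clopen_extension.
Variables (R : realType) (T : ptopologicalType).

Definition clopen_additive (m : set T -> R) :=
  [/\ forall A, 0 <= m A,
      forall A B, clopen A -> clopen B -> A `&` B = set0 -> m (A `|` B) = m A + m B &
      m setT = 1].

Section content.
Variable m : set T -> R.
Hypotheses (cT : compact [set: T]) (mP : clopen_additive m).

Lemma clopen_additive0 : m set0 = 0.
Proof.
have [_ mU _] := mP; have := mU set0 set0 clopen0 clopen0 (set0I _).
by rewrite setU0; lra.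
Qed.

(** By compactness a partition of a clopen set into clopen sets is finite, so that additivity is
already countable additivity. *)
Lemma clopen_bigcup_finite (F : (set T)^nat) : (forall i, clopen (F i)) ->
  trivIset setT F -> clopen (\bigcup_i F i) -> exists N, forall n, (N <= n)%N -> F n = set0.
Proof.
move=> cF tF [_ clU].
have : compact (\bigcup_i F i) by apply: subclosed_compact clU cT _.
rewrite compact_cover => /(_ nat setT F)[|//|D _ FD]; first by move=> i _; case: (cF i).
exists (\max_(i <- finmap.enum_fset D) i).+1 => n Dn; rewrite -subset0 => x Fx.
have [i /= iD Fi] := FD x (ex_intro2 _ _ n I Fx).
have ni : n = i by apply: (tF n i) => //; exists x.
by move: Dn; rewrite ltnNge ni (big_rem i)//= leq_maxl.
Qed.

Lemma clopen_additive_bigsetU (F : (set T)^nat) n : (forall i, clopen (F i)) ->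
  trivIset setT F ->
  clopen (\big[setU/set0]_(i < n) F i) /\
  m (\big[setU/set0]_(i < n) F i) = \sum_(i < n) m (F i).
Proof.
move=> cF tF; have [_ mU _] := mP; elim: n => [|n [IHc IH]].
  by rewrite !big_ord0; split; [exact: clopen0|exact: clopen_additive0].
rewrite !big_ord_recr/=; split; first exact: clopenU.
rewrite mU ?IH//; rewrite -subset0 -bigcup_mkord => x [[i /= i_n Fi] Fn].
by have := tF i n I I (ex_intro _ x (conj Fi Fn)); move/eqP; rewrite (ltn_eqF i_n).
Qed.

(** The additivity is an argument in order that the measure structure below can depend on it. *)
Definition clopen_content (H : clopen_additive m) : set (clopen_space T) -> \bar R :=
  fun A => (m A)%:E.

Let content := clopen_content mP.

Let content0 : content set0 = 0%E.
Proof. by rewrite /content /clopen_content clopen_additive0. Qed.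

Let content_ge0 A : (0 <= content A)%E.
Proof. by rewrite lee_fin; case: mP. Qed.

Let content_sigma : semi_sigma_additive content.
Proof.
move=> F cF tF cU; have [N HN] := clopen_bigcup_finite cF tF cU.
have e n : (N <= n)%N -> \bigcup_i F i = \big[setU/set0]_(i < n) F i.
  move=> Nn; rewrite -bigcup_mkord; apply/seteqP; split=> x [i _ Fi]; exists i => //=.
  by rewrite ltnNge; apply/negP => ni; move: Fi; rewrite HN// (leq_trans Nn).
apply: cvg_near_cst; exists N => // n /= /e ->; rewrite /content /clopen_content.
by rewrite (clopen_additive_bigsetU n cF tF).2 sumEFin big_mkord.
Qed.

HB.instance Definition _ := isMeasure.Build _ _ _ content content0 content_ge0 content_sigma.

Lemma clopen_extension : exists P : probability (g_sigma_algebraType (@clopen T)) R,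
  forall A, clopen A -> P A = (m A)%:E.
Proof.
pose mu := measure_extension content.
have muE A : clopen A -> mu A = (m A)%:E by move=> cA; exact: (measurable_mu_extE content cA).
have mu1 : mu setT = 1%E by have := muE setT clopenT; have [_ _ ->] := mP.
pose p := Measure_isProbability.Build _ _ _ mu mu1.
pose P := HB.pack_for (probability (g_sigma_algebraType (@clopen T)) R) mu p.
by exists P.
Qed.

End content.

Definition is_mean (L : (T -> R) -> R) :=
  [/\ forall a f g, L (fun w => a * f w + g w) = a * L f + L g,
      forall f, (forall w, 0 <= f w) -> 0 <= L f & L (cst 1) = 1].

(** The algebra spanned by the indicator functions of the clopen sets. *)
Inductive clopen_simple : (T -> R) -> Prop :=
| clopen_simple_indic A : clopen A -> clopen_simple (\1_A)
| clopen_simple_lin a f g : clopen_simple f -> clopen_simple g ->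
    clopen_simple (fun w => a * f w + g w).

Lemma clopen_simple_cst c : clopen_simple (cst c).
Proof.
have [s1 s0] := (clopen_simple_indic (@clopenT T), clopen_simple_indic (@clopen0 T)).
have := clopen_simple_lin c s1 s0.
by congr clopen_simple; apply/funext => w; rewrite indicE indicE in_setT in_set0 mulr1 addr0.
Qed.

Lemma clopen_simpleM f g : clopen_simple f -> clopen_simple g -> clopen_simple (fun w => f w * g w).
Proof.
elim=> [A cA|a f1 f2 _ IH1 _ IH2] sg; last first.
  have := clopen_simple_lin a (IH1 sg) (IH2 sg).
  by congr clopen_simple; apply/funext => w; ring.
elim: sg => [B cB|a g1 g2 _ IH1 _ IH2]; last first.
  have := clopen_simple_lin a IH1 IH2.
  by congr clopen_simple; apply/funext => w; ring.
have := clopen_simple_indic (clopenI cA cB); rewrite indicI.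
by congr clopen_simple.
Qed.

Lemma clopen_simple_prod (I : Type) (r : seq I) (f : I -> T -> R) :
  (forall i, clopen_simple (f i)) -> clopen_simple (fun w => \prod_(i <- r) f i w).
Proof.
move=> sf; elim: r => [|i r IH].
  have := clopen_simple_cst 1.
  by congr clopen_simple; apply/funext => w; rewrite big_nil.
have := clopen_simpleM (sf i) IH.
by congr clopen_simple; apply/funext => w; rewrite big_cons.
Qed.

Lemma clopen_simple_sum (I : Type) (r : seq I) (a : I -> R) (f : I -> T -> R) :
  (forall i, clopen_simple (f i)) -> clopen_simple (fun w => \sum_(i <- r) a i * f i w).
Proof.
move=> sf; elim: r => [|i r IH].
  have := clopen_simple_cst 0.
  by congr clopen_simple; apply/funext => w; rewrite big_nil.
have := clopen_simple_lin (a i) (sf i) IH.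
by congr clopen_simple; apply/funext => w; rewrite big_cons.
Qed.

Lemma clopen_simple_bound f : clopen_simple f -> exists M, forall w, `|f w| <= M.
Proof.
elim=> [A _|a f1 f2 _ [M1 H1] _ [M2 H2]].
  by exists 1 => w; rewrite indicE; case: (_ \in _); rewrite ?normr0 ?normr1.
exists (`|a| * M1 + M2) => w; rewrite (le_trans (ler_normD _ _))// lerD// normrM.
by rewrite ler_wpM2l.
Qed.

(** A mean is monotone and preserves the constants. *)
Lemma mean_bound L f M : is_mean L -> (forall w, `|f w| <= M) -> `|L f| <= M.
Proof.
move=> [lin pos L1] fM.
have L0 : L (fun=> 0) = 0.
  have := lin (-1) (fun=> 0) (fun=> 0).
  by rewrite (_ : (fun w : T => _) = (fun=> 0)); [lra|apply/funext => w; rewrite mulr0 addr0].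
have LM : L (fun=> M) = M.
  have := lin M (cst 1) (fun=> 0); rewrite L0 L1 mulr1 addr0 => h; rewrite -[RHS]h.
  by congr L; apply/funext => w; rewrite /cst mulr1 addr0.
have LB a : (forall w, a * f w <= M) -> a * L f <= M.
  move=> aM; have := lin (- a) f (fun=> M); rewrite LM.
  have : 0 <= L (fun w => - a * f w + M) by apply: pos => w; have := aM w; lra.
  by lra.
have fB w : - M <= f w <= M by rewrite -ler_norml.
have h1 : -1 * L f <= M by apply: LB => w; have /andP[] := fB w; lra.
have h2 : 1 * L f <= M by apply: LB => w; have /andP[] := fB w; lra.
by rewrite ler_norml; apply/andP; split; lra.
Qed.

(** A cluster point of an ultrafilter is a limit, and a segment is compact. *)
Lemma ultra_bounded_cvg (J : Type) (U : set_system J) (f : J -> R) M :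
  UltraFilter U -> (forall j, `|f j| <= M) -> cvg (f @ U).
Proof.
move=> UU fM; have PU : ProperFilter U by exact: ultra_proper.
have [|p [_ clp]] := @segment_compact R (- M) M (f @ U) (fmap_proper_filter f PU).
  rewrite -[(f @ U) _]/(U (f @^-1` `[- M, M]%classic)); apply: filterE => j.
  by rewrite /= in_itv/=; have := fM j; rewrite ler_norml.
apply/cvg_ex; exists p => V pV; have [//|UV] := in_ultra_setVsetC (f @^-1` V) UU.
have [|y [Vy yV]] := clp (~` V) V _ pV; last by [].
exact: UV.
Qed.

(** A net of means has a limit point among the probabilities: the means of the clopen sets
converge along an ultrafilter, and compactness turns additivity into countable additivity. *)
Lemma mean_limit (J : Type) (F : set_system J) (L : J -> (T -> R) -> R) :
  compact [set: T] -> ProperFilter F -> (forall j, is_mean (L j)) ->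
  exists P : probability (g_sigma_algebraType (@clopen T)) R,
    forall f c, clopen_simple f -> (\forall j \near F, L j f = c) ->
      bm (f : g_sigma_algebraType (@clopen T) -> R) /\ \int[P]_w f w = c.
Proof.
move=> cT PF mL; have [U [UU FU]] := ultraFilterLemma PF.
have PU : ProperFilter U by exact: ultra_proper.
pose La f := lim ((fun j => L j f) @ U).
have cL f : (exists M, forall w, `|f w| <= M) -> cvg ((fun j => L j f) @ U).
  by move=> [M fM]; apply: ultra_bounded_cvg UU _ => j; exact: mean_bound (mL j) fM.
have LaE f c : (\forall j \near U, L j f = c) -> La f = c.
  by move=> e; apply: cvg_lim => //; apply: cvg_near_cst.
have Lalin a f g : (exists M, forall w, `|f w| <= M) -> (exists M, forall w, `|g w| <= M) ->
    La (fun w => a * f w + g w) = a * La f + La g.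
  move=> bf bg; apply: cvg_lim => //.
  rewrite (_ : (fun j => _) = (fun j => a * L j f + L j g)).
    by apply: cvgD; [apply: cvgM; [exact: cvg_cst|exact: cL]|exact: cL].
  by apply/funext => j; have [-> _ _] := mL j.
have bi (A : set T) : exists M, forall w, `|(\1_A w : R)| <= M.
  by exists 1 => w; rewrite indicE; case: (_ \in _); rewrite ?normr0 ?normr1.
have mP : clopen_additive (fun A => La (\1_A)).
  split => [A|A B _ _ AB|].
  - apply: limr_ge; first exact: cL.
    by apply: nearW => j; have [_ + _] := mL j; apply => w; rewrite indicE ler0n.
  - rewrite (_ : \1_(A `|` B) = (fun w => 1 * \1_A w + \1_B w)).
      by rewrite Lalin// mul1r.
    apply/funext => w; rewrite mul1r !indicE in_setU.
    have [wA|wA] := boolP (w \in A); last by rewrite add0r.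
    have [wB|wB] := boolP (w \in B); last by rewrite addr0.
    by have : (A `&` B) w; [split; exact: set_mem|rewrite AB].
  - apply: LaE; apply: nearW => j; have [_ _ L1] := mL j; rewrite -[RHS]L1.
    by congr (L j _); apply/funext => w; rewrite indicE in_setT.
have [P HP] := clopen_extension cT mP; exists P => f c sf e.
have e' : La f = c by apply: LaE; exact: FU.
suff : bm (f : g_sigma_algebraType (@clopen T) -> R) /\ \int[P]_w f w = La f by rewrite e'.
elim: sf {e e'} => [A cA|a f1 f2 s1 [b1 i1] s2 [b2 i2]].
  have mA : measurable (A : set (g_sigma_algebraType (@clopen T))).
    exact: sub_sigma_algebra.
  by split; [exact: bm_indic|rewrite mean_indic// HP].
have b1' : bm (fun w : g_sigma_algebraType (@clopen T) => a * f1 w) by exact: bmZ.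
split; first exact: (bmD b1' b2).
rewrite (meanD (bm_intg P b1') (bm_intg P b2)) (meanZ _ (bm_intg P b1)) i1 i2 Lalin//.
- exact: clopen_simple_bound.
- exact: clopen_simple_bound.
Qed.

End clopen_extension.

(** * Existence of the process *)

Definition paths (R : realType) := prod_topology (fun _ : R => C3).
HB.instance Definition _ R := Topological.on (paths R).
HB.instance Definition _ R := Pointed.on (paths R).

Lemma compact_paths (R : realType) : compact [set: paths R].
Proof.
have cC : compact [set: C3] by exact: cantor_space_compact.
have := @tychonoff R (fun=> C3) (fun=> setT) (fun=> cC).
by rewrite (_ : [set f | _] = setT)//; apply/seteqP; split.
Qed.

Lemma clopen_evaluation (R : realType) (t : R) v : clopen [set w : paths R | cylinder v (w t)].
Proof.
apply: (@preimage_clopen (paths R) C3 (fun w => w t)); first exact: clopen_cylinder.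
exact: (@proj_continuous R (fun=> C3)).
Qed.

Lemma simple_evaluation (R : realType) N (t : R) (f : C3 -> R) : lev N f ->
  clopen_simple (fun w : paths R => f (w t)).
Proof.
move=> fN; rewrite (_ : (fun w => _) =
  (fun w => \sum_(v : N.-tuple bool) f (pt v) * \1_[set w : paths R | cylinder v (w t)] w)).
  apply: clopen_simple_sum => v; apply: clopen_simple_indic; exact: clopen_evaluation.
apply/funext => w; rewrite [LHS](lev_expand fN); apply: eq_bigr => v _.
by rewrite !indicE; congr (_ * (_%:R)); congr nat_of_bool; apply/idP/idP; rewrite !inE.
Qed.

(** Finer and finer grids of points, of level [j.1], and of times, [j.2]. *)
Definition refine_filter (R : realType) : set_system (nat * seq R) :=
  [set S | exists j0 : nat * seq R, forall j : nat * seq R,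
     (j0.1 <= j.1)%N -> {subset j0.2 <= j.2} -> S j].

Lemma refine_filter_proper R : ProperFilter (@refine_filter R).
Proof.
split; first by move=> [j0 H]; exact: (H j0).
split; first by exists (0%N, [::]).
- move=> A B [[a1 a2] HA] [[b1 b2] HB]; exists (maxn a1 b1, a2 ++ b2) => j /=.
  rewrite geq_max => /andP[aj bj] sj; split; [apply: HA|apply: HB] => //= x xa; apply: sj.
    by rewrite mem_cat xa.
  by rewrite mem_cat xa orbT.
- by move=> A B AB [j0 H]; exists j0 => j h1 h2; apply: AB; exact: H.
Qed.

Section walk.
Variables (R : realType) (mu : probability C3 R) (s : R).
Hypotheses (muP : is_mu mu) (sP : s < s0 + 2).
Local Notation heat := (heat s mu).
Local Notation chain := (chain mu s).
Local Notation backward := (backward mu s).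
Implicit Types (ts : seq R) (w : paths R) (phi g : paths R -> R) (f : R -> C3 -> R).

Definition update w (t : R) (z : C3) : paths R := fun u => if u == t then z else w u.

(** Expectation of [phi] over the paths that start at time [u] in [x], visit at the times [ts]
points of the grid of level [N], and follow [w] at all other times. *)
Fixpoint walk N u x ts w phi : R :=
  if ts is t :: ts' then
    \sum_(v : N.-tuple bool) heat (u - t) (\1_(cylinder v)) x *
      walk N t (pt v) ts' (update w t (pt v)) phi
  else phi w.

(** The same, started from the uniform law on the grid of points. *)
Definition stationary_walk N ts phi : R :=
  if ts is t :: ts' then
    \sum_(v : N.-tuple bool) 2 ^- N * walk N t (pt v) ts' (update point t (pt v)) phi
  else phi point.

Lemma walk_lin N u x ts w a phi g :
  walk N u x ts w (fun w => a * phi w + g w) = a * walk N u x ts w phi + walk N u x ts w g.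
Proof.
elim: ts u x w => [//|t ts IH] u x w /=; rewrite mulr_sumr -big_split/=.
by apply: eq_bigr => v _; rewrite IH; ring.
Qed.

Lemma walk_ge0 N u x ts w phi : path >%R u ts -> (forall w, 0 <= phi w) ->
  0 <= walk N u x ts w phi.
Proof.
move=> + phi0; elim: ts u x w => [|t ts IH] u x w; first by move=> _ /=.
move=> /= /andP[tu pts].
apply: sumr_ge0 => v _; rewrite mulr_ge0 ?IH//; apply: heat_ge0 => //.
by rewrite subr_gt0.
Qed.

(** On functions of level [N] the sum over the grid of points is exact. *)
Lemma heat_expand N t (h : C3 -> R) x : 0 < t -> lev N h ->
  heat t h x = \sum_(v : N.-tuple bool) heat t (\1_(cylinder v)) x * h (pt v).
Proof.
move=> t0 fN; rewrite [in LHS](funext (lev_expand fN)).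
rewrite heat_sum//; last by move=> v _; apply: intgZ; exact/bm_intg/bm_cyl.
by apply: eq_bigr => v _; rewrite heatZ//; [rewrite mulrC|exact/bm_intg/bm_cyl].
Qed.

(** The walk reproduces the chain of heat operators: at each step the sum over the grid of points is
the heat operator. The factor [g], which does not see the times to come, collects the past. *)
Lemma walk_prod N u x ts w f g : path >%R u ts -> (forall t, lev N (f t)) ->
  (forall w t z, t \in ts -> g (update w t z) = g w) ->
  walk N u x ts w (fun w => g w * \prod_(t <- ts) f t (w t)) = g w * backward f u ts x.
Proof.
move=> + fN; elim: ts u x w g => [|t ts IH] u x w g; first by rewrite /= big_nil.
move=> /[dup] pu /= /andP[tu pts] gts.
have lb : lev N (fun x => f t x * backward f t ts x).
  by apply: (lev_chain muP sP (f := f) (ts := t :: ts)) => //.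
rewrite (heat_expand _ _ lb) ?subr_gt0// mulr_sumr; apply: eq_bigr => v _.
rewrite (_ : (fun w => _) = (fun w => (g w * f t (w t)) * \prod_(t <- ts) f t (w t))); last first.
  by apply/funext => w'; rewrite big_cons mulrA.
rewrite (IH t (pt v) (update w t (pt v)) (fun w => g w * f t (w t)))//.
  by rewrite gts ?mem_head// /update eqxx; ring.
move=> w' t' z t'ts; rewrite gts ?inE ?t'ts ?orbT//; congr (_ * f t _).
by rewrite /update (gt_eqF (path_gt_all pts t'ts)).
Qed.

Lemma walk1 N u x ts w : path >%R u ts -> walk N u x ts w (cst 1) = 1.
Proof.
move=> pts; have one (t : R) : lev N (cst 1 : C3 -> R) by [].
have := @walk_prod N u x ts w (fun=> cst 1) (fun=> 1) pts one (fun _ _ _ _ => erefl).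
rewrite (_ : (fun w => _) = cst 1); last first.
  by apply/funext => w'; rewrite mul1r big1_eq.
move=> ->; rewrite mul1r; elim: ts u x {w} pts => [//|t ts IH] u x /= /andP[tu pts].
rewrite (_ : (fun x => _) = cst 1); last by apply/funext => y; rewrite mul1r IH.
by rewrite heat_lev0// subr_gt0.
Qed.

Lemma stationary_walk_mean N ts : sorted >%R ts -> is_mean (stationary_walk N ts).
Proof.
case: ts => [|t ts] sts; first by split => [a f g|f f0|] /=.
move: sts => /= sts.
split => [a phi g|phi phi0|].
- by rewrite mulr_sumr -big_split/=; apply: eq_bigr => v _; rewrite walk_lin; ring.
- apply: sumr_ge0 => v _; apply: mulr_ge0; last exact: walk_ge0.
  by rewrite invr_ge0 exprn_ge0.
- rewrite /stationary_walk; under eq_bigr do rewrite walk1// mulr1.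
  by rewrite sumr_const card_tuple card_bool -[LHS]mulr_natr natrX mulVf// expf_neq0.
Qed.

Lemma stationary_walk_prod N ts f : sorted >%R ts -> (forall t, lev N (f t)) ->
  stationary_walk N ts (fun w => \prod_(t <- ts) f t (w t)) = \int[mu]_x chain f ts x.
Proof.
case: ts => [|t ts] sts fN; first by rewrite /= big_nil mean_cst.
have lc := lev_chain muP sP sts (fun t _ => fN t).
rewrite [in RHS](funext (lev_expand lc)) mean_sum; last first.
  by move=> v _; apply: intgZ; exact/bm_intg/bm_cyl.
apply: eq_bigr => v _; rewrite meanZ; last exact/bm_intg/bm_cyl.
rewrite mean_indic; last exact: measurable_cylinder.
rewrite muE// size_tuple mulrC; congr (_ * _).
rewrite (_ : (fun w => _) = (fun w => f t (w t) * \prod_(t <- ts) f t (w t))); last first.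
  by apply/funext => w; rewrite big_cons.
rewrite walk_prod//=; first by rewrite /update eqxx.
move=> w t' z t'ts; rewrite /update.
by rewrite (gt_eqF (path_gt_all sts t'ts)).
Qed.

(** Grid times that carry no observation drop out of the mean, and functions
    of a given level are integrated exactly on every finer partition. *)
Lemma stationary_walk_refine N ts f : sorted >%R ts -> (forall t, lev N (f t)) ->
  \forall j \near @refine_filter R,
    stationary_walk j.1 (grid j.2) (fun w => \prod_(t <- ts) f t (w t)) =
    \int[mu]_x chain f ts x.
Proof.
move=> sts fN; exists (N, ts) => -[M G] /= NM tsG.
pose f' t := if t \in ts then f t else cst 1.
have f'M t : lev M (f' t).
  by rewrite /f'; case: ifP => // _; exact: lev_le NM (fN t).
have gt_irr : irreflexive (>%R : rel R) by move=> x; exact: ltxx.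
have gt_trans : transitive (>%R : rel R) by exact: (rev_trans (@lt_trans _ R)).
have fE : seq.filter (mem ts) (grid G) = ts.
  apply: (irr_sorted_eq gt_trans gt_irr) => //.
    by apply: sorted_filter => //; exact: grid_sorted.
  move=> t; rewrite mem_filter mem_grid /=; case: (boolP (t \in ts)) => //= tts.
  exact: tsG.
rewrite (_ : (fun w => _) = (fun w => \prod_(t <- grid G) f' t (w t))); last first.
  apply/funext => w; rewrite -[in LHS]fE big_filter/= big_mkcond/=; apply: eq_bigr => t _.
  by rewrite /f'; case: ifP.
rewrite (stationary_walk_prod (grid_sorted G) f'M).
rewrite -(mean_chain_filter muP sP (p := mem ts) (grid_sorted G) (fun t _ => f'M t)).
  rewrite fE (@eq_chain _ mu s f' f)// => t tts; by rewrite /f' tts.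
by move=> t nt; rewrite /f' ifN.
Qed.

Lemma process_exists : exists P : probability (g_sigma_algebraType (@clopen (paths R))) R,
  has_fdd mu s P (fun t (w : g_sigma_algebraType (@clopen (paths R))) => (w : paths R) t) setT.
Proof.
have [P HP] := mean_limit (@compact_paths R) (refine_filter_proper R)
  (fun j => stationary_walk_mean j.1 (grid_sorted j.2)).
exists P; split.
  move=> t _; apply: (measurability cylinders) => //; first exact: measurable_cylinders.
  move=> _ [A cA <-]; rewrite setTI; apply: sub_sigma_algebra.
  case: cA => [->|[v ->]]; first by rewrite preimage_set0; exact: clopen0.
  exact: clopen_evaluation.
move=> N f ts sts _ fN.
have sf : clopen_simple (fun w : paths R => \prod_(t <- ts) f t (w t)).
  by apply: clopen_simple_prod => t; exact: simple_evaluation (fN t).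
by have [_ ->] := HP _ _ sf (stationary_walk_refine sts fN).
Qed.

End walk.

(** * Continuous observables *)

Section continuous_functions.
Variable R : realType.
Implicit Types f : C3 -> R.

Lemma lev_continuous N f : lev N f -> continuous f.
Proof.
move=> fN x; apply: cvg_near_cst; apply/nbhs_cylinder; exists N => y /cylinder_pre e.
exact: fN.
Qed.

Lemma lev_truncation N f : lev N (fun x => f (pt (pre N x))).
Proof. by move=> x y ->. Qed.

(** Uniform continuity, by compactness. *)
Lemma continuous_approx f (e : R) : continuous f -> 0 < e ->
  exists N, forall M, (N <= M)%N -> forall x, `|f x - f (pt (pre M x))| <= e.
Proof.
move=> cf e0.
have [||N HN] := @lev_nbhs_uniform
  (fun N x => forall M, (N <= M)%N -> `|f x - f (pt (pre M x))| <= e).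
- by move=> m n x mn H M nM; apply: H; exact: leq_trans mn nM.
- move=> x; have e2 : 0 < e / 2 by rewrite divr_gt0.
  have /nbhs_cylinder[n Hn] : nbhs x (fun y => `|f x - f y| < e / 2).
    by have /cvgrPdist_lt := cf x; apply.
  exists n => y yx M nM; have y1 := Hn y (proj2 (cylinder_pre n x y) yx).
  have y2 : `|f x - f (pt (pre M y))| < e / 2.
    apply: Hn; apply/cylinder_pre; rewrite -yx; apply: (pre_le nM).
    by have := pre_pt (pre M y); rewrite size_pre.
  rewrite (_ : f y - f (pt (pre M y)) = (f x - f (pt (pre M y))) - (f x - f y)); last by ring.
  by rewrite (le_trans (ler_normB _ _))// (splitr e) lerD// ltW.
by exists N => M NM x; exact: HN.
Qed.

Lemma continuous_bm f : continuous f -> bm f.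
Proof.
move=> cf; split.
  apply: (measurable_fun_cvg (h := fun M x => f (pt (pre M x)))).
    by move=> M; have [] := lev_bm (@lev_truncation M f).
  move=> x _; apply/(@cvgrPdist_le _ R^o) => e e0.
  by have [N HN] := continuous_approx cf e0; exists N => // M /= NM; exact: HN.
have [N HN] := continuous_approx cf ltr01.
have [_ [M fM]] := lev_bm (@lev_truncation N f).
exists (1 + M) => x; have := HN N (leqnn N) x; have := fM x.
rewrite -{2}[f x](subrK (f (pt (pre N x)))) => h1 h2.
by rewrite (le_trans (ler_normD _ _))// lerD.
Qed.

Lemma continuous_approx_family n (f : nat -> C3 -> R) (e : R) :
  (forall i, (i < n)%N -> continuous (f i)) -> 0 < e ->
  exists N, forall i, (i < n)%N -> forall x, `|f i x - f i (pt (pre N x))| <= e.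
Proof.
move=> cf e0.
suff [N HN] : exists N, forall M, (N <= M)%N -> forall i, (i < n)%N ->
    forall x, `|f i x - f i (pt (pre M x))| <= e by exists N; exact: HN.
elim: n cf => [|n IH] cf; first by exists 0%N.
have [N1 H1] := IH (fun i i_n => cf i (leqW i_n)).
have [N2 H2] := continuous_approx (cf n (ltnSn n)) e0.
exists (maxn N1 N2) => M; rewrite geq_max => /andP[M1 M2] i.
by rewrite ltnS leq_eqVlt => /orP[/eqP ->|]; [exact: H2|exact: H1].
Qed.

Lemma bounded_family n (f : nat -> C3 -> R) : (forall i, (i < n)%N -> bm (f i)) ->
  exists2 M, 1 <= M & forall i, (i < n)%N -> forall x, `|f i x| <= M.
Proof.
elim: n => [_|n IH cf]; first by exists 1.
have [M1 M10 H1] := IH (fun i i_n => cf i (leqW i_n)).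
have [_ [M2 H2]] := cf n (ltnSn n).
exists (Num.max M1 M2) => [|i]; first by rewrite le_max M10.
rewrite ltnS leq_eqVlt => /orP[/eqP ->|i_n] x.
  by rewrite le_max H2 orbT.
by rewrite le_max H1.
Qed.

End continuous_functions.

Section transition.
Variables (R : realType) (mu : probability C3 R) (nu : probability choice_space R).
Variables (s : R) (T : R -> (C3 -> R) -> (C3 -> R)).
Hypotheses (muP : is_mu mu) (nuP : is_nu mu nu) (sP : s < s0 + 2).
Hypothesis TP : is_heat_semigroup mu nu s T.
Local Notation L2 := (Lfun mu 2%:E).
Local Notation nrm := (nrm mu).
Local Notation chain := (chain mu s).

Definition increasing_times n (t : nat -> R) :=
  0 < t 0%N /\ forall i, (i.+1 < n)%N -> t i < t i.+1.

Let step (t : nat -> R) m := t m - (if m is k.+1 then t k else 0).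

Lemma step_gt0 n t m : increasing_times n t -> (m < n)%N -> 0 < step t m.
Proof. by move=> [t0 ti]; case: m => [|m] mn; rewrite /step subr_gt0//; exact: ti. Qed.

Lemma increasing_times_gt0 n t m : increasing_times n t -> (m < n)%N -> 0 < t m.
Proof.
move=> [t0 ti]; elim: m => [//|m IH] mn; apply: lt_trans (ti m mn); apply: IH.
exact: ltnW.
Qed.

Lemma transition_L2 n t f m : increasing_times n t -> (forall i, (i < n)%N -> bm (f i)) ->
  (m <= n)%N -> transition_chain T t f m \in L2.
Proof.
move=> tn bf; elim: m => [_|m IH mn]; first exact/bm_L2/bm_cst.
apply: bm_L2M; first exact: bf.
by apply: (T_L2 TP); [exact/ltW/(step_gt0 tn)|exact/IH/ltnW].
Qed.

Lemma transition_sorted n t m : increasing_times n t -> (m <= n)%N ->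
  sorted >%R (rev (mkseq t m)).
Proof.
move=> [_ ti]; elim: m => [//|m IH] mn; rewrite mkseqS rev_rcons.
have := IH (ltnW mn); case: m mn {IH} => [//|m] mn.
by rewrite mkseqS rev_rcons /= => ->; rewrite ti.
Qed.

(** On locally constant observables every step of the semigroup is a heat operator, almost
everywhere. *)
Lemma transition_chainE N n t g (F : R -> C3 -> R) m : increasing_times n t ->
  (forall i, lev N (g i)) -> (forall i, (i < n)%N -> F (t i) = g i) -> (m <= n)%N ->
  {ae mu, forall x, transition_chain T t g m x = chain F (rev (mkseq t m)) x}.
Proof.
move=> tn gN Fg; elim: m => [_|m IH mn]; first exact: aeW.
have FL u : u \in rev (mkseq t m) -> lev N (F u).
  rewrite mem_rev => /mapP[j]; rewrite mem_iota add0n => /andP[_ im] ->.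
  by rewrite Fg//; exact: ltn_trans im mn.
have lc : lev N (chain F (rev (mkseq t m))).
  by apply: (lev_chain muP sP) => //; exact: transition_sorted tn (ltnW mn).
have bg i : (i < n)%N -> bm (g i) by move=> _; exact: lev_bm (gN i).
have h0 := step_gt0 tn mn.
have := T_ae TP (ltW h0) (transition_L2 tn bg (ltnW mn)) (lev_L2 mu lc) (IH (ltnW mn)).
have := T_lev muP nuP sP TP h0 lc.
apply: filterS2 => x e1 e2; rewrite mkseqS rev_rcons /= Fg//.
congr (_ * _); rewrite -[X in T X _]/(step t m) e2 e1.
case: m {IH FL e1 e2} mn lc h0 => [|k] mn lc h0; first by rewrite (heat_lev0 sP muP h0).
by rewrite /step mkseqS rev_rcons.
Qed.

Lemma inner_transition N n t g (F : R -> C3 -> R) : increasing_times n t ->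
  (forall i, lev N (g i)) -> (forall i, (i < n)%N -> F (t i) = g i) ->
  inner mu (cst 1) (transition_chain T t g n) = \int[mu]_x chain F (rev (mkseq t n)) x.
Proof.
move=> tn gN Fg; have bg i : (i < n)%N -> bm (g i) by move=> _; exact: lev_bm (gN i).
have m1 := L2_measurable (transition_L2 tn bg (leqnn n)).
have lc : lev N (chain F (rev (mkseq t n))).
  apply: (lev_chain muP sP); first exact: transition_sorted tn (leqnn n).
  move=> u; rewrite mem_rev => /mapP[j]; rewrite mem_iota add0n => /andP[_ im] ->.
  by rewrite Fg.
rewrite -(ae_mean m1 (intg_measurable (lev_intg mu lc)) (transition_chainE tn gN Fg (leqnn n))).
by apply: eq_Rintegral => x _; rewrite mul1r.
Qed.

Lemma transition_nrm n t g (M : R) m : increasing_times n t -> 0 <= M ->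
  (forall i, (i < n)%N -> bm (g i)) -> (forall i, (i < n)%N -> forall x, `|g i x| <= M) ->
  (m <= n)%N -> nrm (transition_chain T t g m) <= M ^+ m.
Proof.
move=> tn M0 bg gM; elim: m => [_|m IH mn].
  apply: nrm_bound => //; first exact: bm_cst.
  by move=> x; rewrite normr1 expr0.
have h0 := ltW (step_gt0 tn mn); have L := transition_L2 tn bg (ltnW mn).
apply: le_trans (nrm_bmM (bg m mn) (T_L2 TP h0 L) M0 (gM m mn)) _.
rewrite exprS ler_wpM2l//; apply: le_trans (T_nrm TP h0 L) _; exact/IH/ltnW.
Qed.

(** The observables are replaced one at a time; the semigroup is contractive. *)
Lemma transition_dist n t f g (M e : R) m : increasing_times n t -> 1 <= M -> 0 <= e ->
  (forall i, (i < n)%N -> bm (f i)) -> (forall i, (i < n)%N -> bm (g i)) ->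
  (forall i, (i < n)%N -> forall x, `|f i x| <= M) ->
  (forall i, (i < n)%N -> forall x, `|g i x| <= M) ->
  (forall i, (i < n)%N -> forall x, `|f i x - g i x| <= e) -> (m <= n)%N ->
  nrm (fun x => transition_chain T t f m x - transition_chain T t g m x) <= m%:R * M ^+ m * e.
Proof.
move=> tn M1 e0 bf bg fM gM fg; have M0 : 0 <= M by exact: le_trans ler01 M1.
elim: m => [_|m IH mn].
  rewrite (ae_nrm_sub (f := cst 1) (g := cst 1)) ?mul0r//; try exact/bm_L2/bm_cst.
  exact: aeW.
have h0 := ltW (step_gt0 tn mn).
have Lf := transition_L2 tn bf (ltnW mn); have Lg := transition_L2 tn bg (ltnW mn).
have Tf := T_L2 TP h0 Lf; have Tg := T_L2 TP h0 Lg.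
pose A x := f m x * (T (step t m) (transition_chain T t f m) x -
                     T (step t m) (transition_chain T t g m) x).
pose B x := (f m x - g m x) * T (step t m) (transition_chain T t g m) x.
have bfg : bm (fun x => f m x - g m x) by apply: bmB; [exact: bf|exact: bg].
rewrite (_ : (fun x => _) = (fun x => A x + B x)); last first.
  by apply/funext => x; rewrite /A /B /= -/(step t m); ring.
have LA : A \in L2 by apply: bm_L2M; [exact: bf|exact: L2B].
have LB : B \in L2 by exact: bm_L2M.
apply: le_trans (nrmD LA LB) _.
have nA : nrm A <= M * (m%:R * M ^+ m * e).
  apply: le_trans (nrm_bmM (bf m mn) (L2B Tf Tg) M0 (fM m mn)) _.
  by rewrite ler_wpM2l//; apply: le_trans (T_dist TP h0 Lf Lg) _; exact/IH/ltnW.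
have nB : nrm B <= e * M ^+ m.
  apply: le_trans (nrm_bmM bfg Tg e0 (fg m mn)) _.
  rewrite ler_wpM2l//; apply: le_trans (T_nrm TP h0 Lg) _.
  exact: transition_nrm tn M0 bg gM (ltnW mn).
apply: le_trans (lerD nA nB) _; rewrite -natr1 exprS.
have : e * M ^+ m <= e * (M * M ^+ m) by rewrite ler_wpM2l// ler_peMl ?exprn_ge0.
by move: (M ^+ m) => x; lra.
Qed.

End transition.

(** The same estimate for the numbers [f i (X (t i) w)]. *)
Lemma prod_dist (R : realType) n (a b : nat -> R) (M e : R) m : 1 <= M -> 0 <= e ->
  (forall i, (i < n)%N -> `|a i| <= M) -> (forall i, (i < n)%N -> `|b i| <= M) ->
  (forall i, (i < n)%N -> `|a i - b i| <= e) -> (m <= n)%N ->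
  `|\prod_(i < m) a i - \prod_(i < m) b i| <= m%:R * M ^+ m * e.
Proof.
move=> M1 e0 aM bM ab; have M0 : 0 <= M by exact: le_trans ler01 M1.
elim: m => [_|m IH mn]; first by rewrite !big_ord0 subrr normr0 !mul0r.
rewrite !big_ord_recr/=.
have pb : `|\prod_(i < m) b i| <= M ^+ m.
  rewrite normr_prod -[m in M ^+ m]card_ord -prodr_const; apply: ler_prod => i _.
  by rewrite normr_ge0 bM//; exact: ltn_trans (ltn_ord i) mn.
have := IH (ltnW mn); move: (\prod_(i < m) a i) (\prod_(i < m) b i) pb => A B pB AB.
rewrite (_ : A * a m - B * b m = (A - B) * a m + B * (a m - b m)); last by ring.
apply: le_trans (ler_normD _ _) _; rewrite !normrM.
have h1 : `|A - B| * `|a m| <= m%:R * M ^+ m * e * M by apply: ler_pM => //; exact: aM.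
have h2 : `|B| * `|a m - b m| <= M ^+ m * e by apply: ler_pM => //; exact: ab.
apply: le_trans (lerD h1 h2) _; rewrite -natr1 exprS.
have : e * M ^+ m <= e * (M * M ^+ m) by rewrite ler_wpM2l// ler_peMl ?exprn_ge0.
by move: (M ^+ m) => x; lra.
Qed.

(** * The process and its finite-dimensional laws *)

Section process.
Variables (R : realType) (mu : probability C3 R) (nu : probability choice_space R).
Variables (s : R) (T : R -> (C3 -> R) -> (C3 -> R)).
Hypotheses (muP : is_mu mu) (nuP : is_nu mu nu) (sP : s < s0 + 2).
Hypothesis TP : is_heat_semigroup mu nu s T.
Variables (d : measure_display) (Omega : measurableType d).
Variables (P : probability Omega R) (X : R -> Omega -> C3).
Local Notation nrm := (nrm mu).
Local Notation chain := (chain mu s).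

Lemma expectation_prod n t (f : nat -> C3 -> R) :
  (forall i, (i < n)%N -> measurable_fun setT (X (t i))) -> (forall i, (i < n)%N -> bm (f i)) ->
  bm (fun w => \prod_(i < n) f i (X (t i) w)) /\
  'E_P[fun w => (\prod_(i < n) f i (X (t i) w))%R]%E =
    (\int[P]_w \prod_(i < n) f i (X (t i) w))%:E.
Proof.
move=> mX bf; have b : bm (fun w => \prod_(i < n) f i (X (t i) w)).
  by apply: bm_prod => i _; apply: (bm_comp (mX i _) (bf i _)).
by split => //; rewrite unlock EFin_mean//; exact: bm_intg.
Qed.

(** Locally constant functions are continuous. *)
Lemma fdd_of_process : (forall t, 0 < t -> measurable_fun setT (X t)) ->
  is_process_of P X mu T -> has_fdd mu s P X [set t | 0 < t].
Proof.
move=> mX XP; split => // N f ts sts ts0 fN.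
have [->|ts_n0] := eqVneq ts [::].
  by rewrite /= mean_cst; under eq_Rintegral do rewrite big_nil; rewrite mean_cst.
pose n := size ts; pose t i := nth 0 (rev ts) i.
have tsE : rev (mkseq t n) = ts.
  by rewrite -[RHS]revK -[rev ts in RHS](mkseq_nth 0) size_rev.
have n0 : (0 < n)%N by rewrite lt0n size_eq0.
have tin i : (i < n)%N -> t i \in ts.
  by move=> i_n; rewrite -mem_rev mem_nth// size_rev.
have st : sorted <%R (rev ts) by rewrite rev_sorted.
have tn : increasing_times n t.
  split; first exact/ts0/tin.
  move=> i i_n; apply: (sorted_ltn_nth (@lt_trans _ R) 0 st) => //; rewrite inE size_rev//.
  exact: ltnW.
have := XP n t (fun i => f (t i)) tn.1 tn.2 (fun i _ => lev_continuous (fN (t i))).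
have [_ ->] := expectation_prod (n := n) (t := t) (f := fun i => f (t i))
  (fun i i_n => mX _ (increasing_times_gt0 tn i_n)) (fun i _ => lev_bm (fN (t i))).
rewrite (inner_transition muP nuP sP TP (F := f) tn (fun i => fN (t i)))// tsE => -[<-].
apply: eq_Rintegral => w _; rewrite -[in LHS]tsE (perm_big (mkseq t n)); last first.
  by rewrite perm_rev.
by rewrite /mkseq big_map -[X in iota 0 X]subn0 -/(index_iota 0 n) big_mkord.
Qed.

(** Both sides are continuous in the observables for the uniform norm, and the locally constant
functions are dense among the continuous ones. *)
Lemma process_of_fdd : has_fdd mu s P X setT -> is_process_of P X mu T.
Proof.
move=> [mX fdd] n t f t0 ti cf; have tn : increasing_times n t by [].
have mXt i : (i < n)%N -> measurable_fun setT (X (t i)) by move=> _; exact: mX.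
have bf i : (i < n)%N -> bm (f i) by move=> /cf; exact: continuous_bm.
have [bp ->] := expectation_prod mXt bf; congr (_%:E).
have [M M1 fM] := bounded_family bf.
have M0 : 0 <= M by exact: le_trans ler01 M1.
apply/eqP; rewrite -subr_eq0; apply/eqP.
apply: (@geometric_eq0 R _ (2 * (n%:R * M ^+ n)) 0) => k _.
have e0 : 0 < 2 ^- k :> R by rewrite invr_gt0 exprn_gt0.
have [N HN] := continuous_approx_family cf e0.
pose g i x := f i (pt (pre N x)).
have gN i : lev N (g i) by exact: lev_truncation.
have bg i : (i < n)%N -> bm (g i) by move=> _; exact: lev_bm (gN i).
have gM i : (i < n)%N -> forall x, `|g i x| <= M by move=> i_n x; exact: fM.
have [bpg _] := expectation_prod mXt bg.
have ut : uniq (mkseq t n).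
  have := transition_sorted tn (leqnn n); rewrite -rev_uniq.
  by apply: sorted_uniq; [exact: (rev_trans (@lt_trans _ R))|move=> x; exact: ltxx].
pose F u := g (index u (mkseq t n)).
have Fg i : (i < n)%N -> F (t i) = g i.
  move=> i_n; rewrite /F -[t i](nth_mkseq 0 t i_n) index_uniq// size_mkseq//.
have gE : \int[P]_w \prod_(i < n) g i (X (t i) w) = inner mu (cst 1) (transition_chain T t g n).
  rewrite (inner_transition muP nuP sP TP tn gN Fg) -(fdd N F _ (transition_sorted tn (leqnn n)) (fun _ _ => I) (fun _ => gN _)).
  apply: eq_Rintegral => w _; rewrite [RHS](perm_big (mkseq t n)); last by rewrite perm_rev.
  rewrite /mkseq big_map -[X in iota 0 X]subn0 -/(index_iota 0 n) big_mkord.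
  by apply: eq_bigr => i _; rewrite Fg.
have Lf := transition_L2 TP tn bf (leqnn n).
have Lg := transition_L2 TP tn bg (leqnn n).
have L1 : (cst 1 : C3 -> R) \in Lfun mu 2%:E by exact/bm_L2/bm_cst.
have h1 : `|\int[P]_w \prod_(i < n) f i (X (t i) w) -
    \int[P]_w \prod_(i < n) g i (X (t i) w)| <= n%:R * M ^+ n * 2 ^- k.
  rewrite -meanB; [|exact: bm_intg..]; apply: ler_norm_mean_cst.
    exact/bm_intg/bmB.
  move=> w; apply: (prod_dist (n := n) (a := fun i => f i (X (t i) w))
    (b := fun i => g i (X (t i) w)) M1 (ltW e0)) => // i i_n.
  - exact: fM.
  - exact: gM.
  - exact: HN.
have h2 : `|inner mu (cst 1) (transition_chain T t g n) -
    inner mu (cst 1) (transition_chain T t f n)| <= n%:R * M ^+ n * 2 ^- k.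
  rewrite (innerC mu (cst 1) (transition_chain T t g n)) (innerC mu (cst 1)).

  rewrite -innerBl//; apply: le_trans (ler_inner (L2B Lg Lf) L1) _.
  have n1 : nrm (cst 1) <= 1.
    by apply: nrm_bound => //; [exact: bm_cst|move=> x; rewrite normr1].
  apply: (@le_trans _ _ (nrm (fun x => transition_chain T t g n x - transition_chain T t f n x) * 1)).
    by rewrite ler_wpM2l// nrm_ge0.
  rewrite mulr1 nrm_distC; apply: (transition_dist TP tn M1 (ltW e0) bf bg fM gM) => //.
rewrite gE in h1; have := le_trans (ler_normD _ _) (lerD h1 h2).
rewrite addrA subrK => h; apply: (le_trans h).
by move: (n%:R * M ^+ n) => x; move: (2 ^- k : R) => y; lra.
Qed.

End process.

Lemma has_fdd_sub (R : realType) (mu : probability C3 R) (s : R) (d : measure_display)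
    (Omega : measurableType d) (P : probability Omega R) (X : R -> Omega -> C3) (I J : set R) :
  J `<=` I -> has_fdd mu s P X I -> has_fdd mu s P X J.
Proof.
move=> JI [mX fdd]; split=> [t /JI|N f ts sts tsJ]; first exact: mX.
by apply: fdd => // t /tsJ/JI.
Qed.

Theorem theorem9 (R : realType) (mu : probability C3 R)
    (nu : probability choice_space R) (s : R)
    (T : R -> (C3 -> R) -> (C3 -> R)) :
  is_mu mu -> is_nu mu nu -> s < s0 + 2 -> is_heat_semigroup mu nu s T ->
  (forall t : R, 0 < t ->
     let S (z : C3 * C3) : R :=
       limn (series (fun n => kappa R n z.1 z.2 * heat_coef t s n)) in
     (forall K : C3 * C3 -> R, is_heat_kernel mu T t K ->
        {ae (mu \x mu)%E, forall z, K z = S z} /\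
        {ae (mu \x mu)%E, forall z, 0 < K z} /\
        K \in Lfun (mu \x mu)%E +oo%E) /\
     (exists K : C3 * C3 -> R,
        [/\ is_heat_kernel mu T t K, continuous K,
            forall x y, x <> y -> K (x, y) = S (x, y) &
            forall x y, 0 < K (x, y)])) /\
  (exists (d : measure_display) (Omega : measurableType d)
     (P : probability Omega R) (X : R -> Omega -> C3),
     [/\ forall t, 0 <= t -> measurable_fun [set: Omega] (X t),
         is_process_of P X mu T, is_markov P X [set t | 0 <= t],
         is_stationary P X [set t | 0 <= t] &
         moment_asymptotics P X s [set t | 0 <= t]]) /\
  (forall (d : measure_display) (Omega : measurableType d)
     (P : probability Omega R) (X : R -> Omega -> C3),
     (forall t, 0 < t -> measurable_fun [set: Omega] (X t)) ->
     is_process_of P X mu T ->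
     [/\ is_markov P X [set t | 0 < t], is_stationary P X [set t | 0 < t] &
         moment_asymptotics P X s [set t | 0 < t]]).
Proof.
move=> muP nuP sP TP; split; last split.
- by move=> t t0; exact: heat_kernel_theorem muP nuP sP TP t t0.
- have [P fddT] := process_exists muP sP.
  have fdd0 := has_fdd_sub (J := [set t | 0 <= t]) (fun _ _ => I) fddT.
  have shift (u h : R) : 0 <= h -> 0 <= u -> 0 <= u + h by move=> h0 u0; exact: addr_ge0.
  do 4 eexists; split; last exact: (moments_of_fdd muP sP fdd0 shift).
  + by move=> t _; exact: fddT.1.
  + exact: (process_of_fdd muP nuP sP TP fddT).
  + exact: (markov_of_fdd muP sP fdd0).
  + exact: (stationary_of_fdd fdd0 shift).
- move=> d Omega P X mX XP; have fddP := fdd_of_process muP nuP sP TP mX XP.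
  have shift (u h : R) : 0 <= h -> 0 < u -> 0 < u + h.
    by move=> h0 u0; exact: ltr_pwDl.
  split; [exact: (markov_of_fdd muP sP fddP)|exact: (stationary_of_fdd fddP shift)|].
  exact: (moments_of_fdd muP sP fddP shift).
Qed.
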